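(* Let $\pi_A:A\to\mathcal{O}$ be an augmented ring such that $\ell(\Phi_A)$ is finite and $\mathrm{depth}(A)\ge 1$. Then $A$ is a complete intersection ring if and only if $\ell(\Phi_A)=\ell(\mathcal{O}/\eta_A)$.
   Context: All rings are commutative, noetherian, local and complete. $\mathcal{O}$ is a discrete valuation ring (not assumed finite over $\mathbb{Z}_p$; rings are not assumed to be $\mathcal{O}$-algebras). An augmented ring is a complete noetherian local ring $A$ with a surjective ring homomorphism $\pi_A:A\to\mathcal{O}$ such that $\Phi_A:=\ker(\pi_A)/(\ker(\pi_A))^2$ is of finite length. One sets $\eta_A:=\pi_A(\mathrm{Ann}_A(\ker(\pi_A)))$, an ideal of $\mathcal{O}$. $\ell$ denotes length as an $\mathcal{O}$-module. *)

(* Defs.v *)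
From HB Require Import structures.
From mathcomp Require Import all_boot all_algebra.
From mathcomp Require Import boolp.

Set Implicit Arguments.
Unset Strict Implicit.
Unset Printing Implicit Defensive.

Import GRing.Theory.
Local Open Scope ring_scope.
Local Open Scope quotient_scope.

(** Suprema of sets of natural numbers, [None] standing for infinity.  The set
    is never empty in the uses below. *)

Definition nat_max (P : nat -> Prop) (n : nat) : Prop :=
  P n /\ forall m, P m -> (m <= n)%N.

Definition nat_sup (P : nat -> Prop) : option nat :=
  if pselect (exists n, nat_max P n) is left ex then Some (projT1 (cid ex))
  else None.

Definition leq_ext (m : nat) (n : option nat) : bool :=
  if n is Some k then (m <= k)%N else true.

Lemma nat_sup_Some (P : nat -> Prop) n : nat_sup P = Some n <-> nat_max P n.
Proof.
rewrite /nat_sup; case: pselect => [ex|nex]; last first.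
  by split=> // Pn; case: nex; exists n.
case: cid => k /= [Pk maxk]; split=> [[<-] //|[Pn maxn]].
by congr Some; apply/eqP; rewrite eqn_leq maxn // maxk.
Qed.

(** Ideals are subsets of the ring, given as (classically decidable)
    predicates.  MathComp's [idealr_closed] includes properness; arbitrary
    ideals are the submodules of the regular module. *)

Section Ideals.
Variable R : comNzRingType.
Implicit Types (I J : {pred R}) (s : seq R).

Definition is_ideal I : Prop := submod_closed (I : {pred R^o}).

Definition prime_ideal I : Prop := idealr_closed I /\ prime_idealr_closed I.

Definition maximal_ideal I : Prop :=
  idealr_closed I /\
  forall J, idealr_closed J -> {subset I <= J} -> {subset J <= I}.

Definition ideal_span s : {pred R} :=
  [pred x | `[< exists c : 'I_(size s) -> R, x = \sum_i c i * s`_i >]].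

Definition ideal_mul I J : {pred R} :=
  [pred x | `[< exists s : seq (R * R),
    (forall p, p \in s -> p.1 \in I /\ p.2 \in J)
    /\ x = \sum_(p <- s) p.1 * p.2 >]].

Fixpoint ideal_exp I (n : nat) : {pred R} :=
  if n is n'.+1 then ideal_mul I (ideal_exp I n') else predT.

Definition noetherian : Prop :=
  forall I, is_ideal I -> exists s, I =i ideal_span s.

Definition local_ring : Prop :=
  exists m, maximal_ideal m /\ forall m', maximal_ideal m' -> m' =i m.

(* The two clauses are injectivity and surjectivity of R -> lim_n R/I^n. *)
Definition adic_complete I : Prop :=
  (forall x, (forall n, x \in ideal_exp I n) -> x = 0) /\
  (forall u : nat -> R, (forall n, u n.+1 - u n \in ideal_exp I n) ->
     exists l, forall n, u n - l \in ideal_exp I n).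

Definition regular_sequence s : Prop :=
  (forall i x, (i < size s)%N ->
     s`_i * x \in ideal_span (take i s) -> x \in ideal_span (take i s)) /\
  1 \notin ideal_span s.

Definition prime_chain (n : nat) : Prop :=
  exists P : nat -> {pred R},
    (forall i, (i <= n)%N -> prime_ideal (P i)) /\
    (forall i, (i < n)%N ->
       {subset P i <= P i.+1} /\ ~ {subset P i.+1 <= P i}).

Definition krull_dim : option nat := nat_sup prime_chain.

End Ideals.

Section LocalRings.
Variable R : comUnitRingType.

(* In a local ring, the maximal ideal is the set of nonunits. *)
Definition max_ideal : {pred R} := [pred x | x \isn't a GRing.unit].

Definition complete_noetherian_local : Prop :=
  [/\ local_ring R, noetherian R & adic_complete max_ideal].

Definition depth : option nat :=
  nat_sup (fun n => exists s : seq R,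
    [/\ size s = n, {subset s <= max_ideal} & regular_sequence s]).

Definition regular_local_ring : Prop :=
  [/\ local_ring R, noetherian R &
      exists s : seq R, max_ideal =i ideal_span s /\ krull_dim R = Some (size s)].

End LocalRings.
Arguments max_ideal : clear implicits.

(* For complete rings: A is isomorphic to R/(s) with R a complete regular local
   ring and s a regular sequence in R. *)
Definition complete_intersection (A : comUnitRingType) : Prop :=
  exists (R : comUnitRingType) (f : {rmorphism R -> A}) (s : seq R),
    [/\ complete_noetherian_local R, regular_local_ring R,
        (forall a, exists r, f r = a), regular_sequence s &
        forall r, f r = 0 <-> r \in ideal_span s].

Definition discrete_valuation_ring (O : idomainType) : Prop :=
  [/\ local_ring O,
      (forall I : {pred O}, is_ideal I -> exists t, I =i ideal_span [:: t]) &
      exists t : O, t != 0 /\ t \isn't a GRing.unit].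

Section Length.
Variables (R : nzRingType) (M : lmodType R).

Definition submodule_chain (n : nat) : Prop :=
  exists S : nat -> {pred M},
    (forall i, (i <= n)%N -> submod_closed (S i)) /\
    (forall i, (i < n)%N ->
       {subset S i <= S i.+1} /\ ~ {subset S i.+1 <= S i}).

Definition mod_length : option nat := nat_sup submodule_chain.

Definition finite_length : Prop := exists n, mod_length = Some n.

End Length.
Arguments mod_length {R} M.
Arguments finite_length {R} M.

Section QuotientModule.
Variables (R : nzRingType) (M : lmodType R) (N : submodClosed M).

(* A [submodClosed] is not declared to be closed under opposites, which the
   quotient construction needs. *)
Definition submod_pred : {pred M} := N.
HB.instance Definition _ := GRing.isZmodClosed.Build M submod_pred
  (GRing.submod_closedB (submodClosedP N)).

Definition quot_mod := Quotient.quot submod_pred.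
HB.instance Definition _ := GRing.Zmodule.on quot_mod.

Definition quot_class (x : M) : quot_mod := \pi_(Quotient.quot submod_pred) x.

Definition quot_scale (a : R) (x : quot_mod) : quot_mod :=
  quot_class (a *: repr x).

Lemma quot_classP x : exists y, x = quot_class y.
Proof. by exists (repr x); rewrite /quot_class reprK. Qed.

Lemma quot_classD x y : quot_class (x + y) = quot_class x + quot_class y.
Proof. exact: raddfD. Qed.

Lemma quot_scale_class a x : quot_scale a (quot_class x) = quot_class (a *: x).
Proof.
apply/eqP; rewrite /quot_scale -Quotient.idealrBE -scalerBr.
rewrite [_ \in _](rpredZ (s := N)) // -[_ \in _]/(_ \in submod_pred).
by rewrite Quotient.idealrBE reprK.
Qed.

Fact quot_scaleA a b x : quot_scale a (quot_scale b x) = quot_scale (a * b) x.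
Proof.
have [y ->] := quot_classP x.
by rewrite [quot_scale b _]quot_scale_class !quot_scale_class scalerA.
Qed.
Fact quot_scale1 : left_id 1 quot_scale.
Proof.
by move=> x; have [y ->] := quot_classP x; rewrite quot_scale_class scale1r.
Qed.
Fact quot_scaleDr : right_distributive quot_scale +%R.
Proof.
move=> a x y; have [x' ->] := quot_classP x; have [y' ->] := quot_classP y.
by rewrite -quot_classD !quot_scale_class -quot_classD scalerDr.
Qed.
Fact quot_scaleDl x : {morph quot_scale^~ x : a b / a + b}.
Proof.
move=> a b; have [y ->] := quot_classP x.
by rewrite !quot_scale_class -quot_classD scalerDl.
Qed.

HB.instance Definition _ := GRing.Zmodule_isLmodule.Build R quot_mod
  quot_scaleA quot_scale1 quot_scaleDr quot_scaleDl.

End QuotientModule.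

Record augmentation (A O : comNzRingType) := Augmentation {
  aug_map :> {rmorphism A -> O};
  aug_surj : forall o, exists a, aug_map a == o
}.

Section Augmentation.
Variables (A O : comNzRingType) (piA : augmentation A O).

Definition aug_ideal : {pred A} := [pred a | piA a == 0].

Definition annihilator (I : {pred A}) : {pred A} :=
  [pred a | `[< forall x, x \in I -> a * x = 0 >]].

Definition aug_eta : {pred O^o} :=
  [pred o | `[< exists a, a \in annihilator aug_ideal /\ piA a = o >]].

Fact aug_eta_submod : submod_closed aug_eta.
Proof.
split=> [|o x y]; rewrite !inE.
  apply/asboolP; exists 0; rewrite rmorph0 inE; split=> //.
  by apply/asboolP => x _; rewrite mul0r.
move=> /asboolP[a [+ <-]] /asboolP[b [+ <-]]; rewrite !inE.
move=> /asboolP annA /asboolP annB; have [c /eqP <-] := aug_surj piA o.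
apply/asboolP; exists (c * a + b); rewrite rmorphD rmorphM inE; split=> //.
by apply/asboolP => z pz; rewrite mulrDl -mulrA annA // annB // mulr0 addr0.
Qed.
HB.instance Definition _ :=
  GRing.isSubmodClosed.Build O O^o aug_eta aug_eta_submod.

(** The cotangent module of [piA], i.e. the quotient of the augmentation ideal
    [p] by [p^2], with [o : O] acting through any of its lifts to [A]. *)

Fact aug_ideal_zmod : zmod_closed aug_ideal.
Proof.
split=> [|x y]; rewrite !inE ?rmorph0 // => /eqP px /eqP py.
by rewrite rmorphB px py subrr.
Qed.
HB.instance Definition _ := GRing.isZmodClosed.Build A aug_ideal aug_ideal_zmod.

Record aug_elt := AugElt { aug_val :> A; aug_valP : aug_val \in aug_ideal }.
HB.instance Definition _ := [isSub for aug_val].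
HB.instance Definition _ := [Choice of aug_elt by <:].
HB.instance Definition _ := [SubChoice_isSubZmodule of aug_elt by <:].

Definition aug_sq : {pred aug_elt} :=
  [pred x | \val x \in ideal_mul aug_ideal aug_ideal].

Fact aug_idealM a x : x \in aug_ideal -> a * x \in aug_ideal.
Proof. by rewrite !inE rmorphM => /eqP ->; rewrite mulr0. Qed.

Fact ideal_mul_lin a x y (I2 := ideal_mul aug_ideal aug_ideal) :
  x \in I2 -> y \in I2 -> a * x + y \in I2.
Proof.
rewrite !inE => /asboolP[s [sP ->]] /asboolP[t [tP ->]].
apply/asboolP; exists ([seq (a * p.1, p.2) | p <- s] ++ t); split.
  move=> p; rewrite mem_cat => /orP[/mapP[q /sP[q1 q2] ->]|/tP //].
  by split=> //=; apply: aug_idealM.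
rewrite big_cat big_map /= mulr_sumr; congr (_ + _).
by apply: eq_bigr => p _; rewrite mulrA.
Qed.

Fact aug_sq_zmod : zmod_closed aug_sq.
Proof.
split=> [|x y x2 y2].
  by rewrite !inE; apply/asboolP; exists [::]; split=> //; rewrite big_nil.
by rewrite inE raddfB addrC -mulN1r; apply: ideal_mul_lin.
Qed.
HB.instance Definition _ := GRing.isZmodClosed.Build aug_elt aug_sq aug_sq_zmod.

Definition aug_lift (o : O) : A := xchoose (aug_surj piA o).

Lemma aug_liftK o : piA (aug_lift o) = o.
Proof. exact/eqP/(xchooseP (aug_surj piA o)). Qed.

Definition aug_act (a : A) (x : aug_elt) : aug_elt :=
  AugElt (aug_idealM a (aug_valP x)).

Definition cotangent := Quotient.quot aug_sq.
HB.instance Definition _ := GRing.Zmodule.on cotangent.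

Definition cotangent_class (x : aug_elt) : cotangent :=
  \pi_(Quotient.quot aug_sq) x.

Definition cotangent_scale (o : O) (x : cotangent) : cotangent :=
  cotangent_class (aug_act (aug_lift o) (repr x)).

Lemma cotangent_scale_class a x :
  cotangent_scale (piA a) (cotangent_class x) = cotangent_class (aug_act a x).
Proof.
apply/eqP; rewrite /cotangent_scale -Quotient.idealrBE inE raddfB /=.
set b := aug_lift _; set y := repr _.
have -> : b * aug_val y - a * aug_val x =
          b * (aug_val y - aug_val x) + (b - a) * aug_val x.
  by rewrite mulrBr mulrBl addrA subrK.
apply: ideal_mul_lin.
  have : y - x \in aug_sq by rewrite Quotient.idealrBE reprK.
  by rewrite inE raddfB.
apply/asboolP; exists [:: (b - a, aug_val x)]; rewrite big_seq1; split=> // p.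
rewrite inE => /eqP -> /=; split; last exact: aug_valP.
by rewrite inE rmorphB aug_liftK subrr.
Qed.

Fact cotangent_classP x : exists y, x = cotangent_class y.
Proof. by exists (repr x); rewrite /cotangent_class reprK. Qed.

Fact cotangent_classD x y :
  cotangent_class (x + y) = cotangent_class x + cotangent_class y.
Proof. exact: raddfD. Qed.

Fact cotangent_scaleA a b x :
  cotangent_scale a (cotangent_scale b x) = cotangent_scale (a * b) x.
Proof.
have [y ->] := cotangent_classP x; rewrite -[a]aug_liftK -[b]aug_liftK.
rewrite -rmorphM [cotangent_scale _ (cotangent_class y)]cotangent_scale_class.
rewrite !cotangent_scale_class; congr cotangent_class.
by apply: val_inj; rewrite /= mulrA.
Qed.
Fact cotangent_scale1 : left_id 1 cotangent_scale.
Proof.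
move=> x; have [y ->] := cotangent_classP x.
rewrite -(rmorph1 piA) cotangent_scale_class; congr cotangent_class.
by apply: val_inj; rewrite /= mul1r.
Qed.
Fact cotangent_scaleDr : right_distributive cotangent_scale +%R.
Proof.
move=> a x y; have [x' ->] := cotangent_classP x.
have [y' ->] := cotangent_classP y; rewrite -[a]aug_liftK.
rewrite -cotangent_classD !cotangent_scale_class -cotangent_classD.
by congr cotangent_class; apply: val_inj; rewrite /= mulrDr.
Qed.
Fact cotangent_scaleDl x : {morph cotangent_scale^~ x : a b / a + b}.
Proof.
move=> a b; have [y ->] := cotangent_classP x.
rewrite -[a]aug_liftK -[b]aug_liftK -rmorphD !cotangent_scale_class.
by rewrite -cotangent_classD; congr cotangent_class; apply: val_inj;
  rewrite /= mulrDl.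
Qed.

HB.instance Definition _ := GRing.Zmodule_isLmodule.Build O cotangent
  cotangent_scaleA cotangent_scale1 cotangent_scaleDr cotangent_scaleDl.

End Augmentation.

(* Main.v *)
(* Write A = R/I with R a complete regular local ring (Cohen's structure
   theorem), and let x_1, ..., x_n, t be a regular system of parameters of R such
   that the x_j generate the kernel P of R -> O and t maps to a uniformizer pi.
   The relations between the classes of the x_j in Phi_A are the rows of a
   square matrix T over O with det T = pi^v, v = l(Phi_A); each lifts to an
   element f_i = sum_j a_ij x_j of I. By Cramer's rule det a annihilates the
   augmentation ideal, so that eta_A = (pi^w) with w <= v.

   Let y be a nonzerodivisor of A in the maximal ideal; it has a lift
   y' = u t + sum_j b_j x_j. The matrix expressing (y', f) by (t, x) has
   determinant u det a, and everything depends on whether this determinant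
   vanishes in A/(y).

   If v = w, it does not vanish. A determinant criterion then shows that
   (y', f) is a regular sequence generating I + (y'), and I = (f) by Nakayama.

   If I = (f) with f regular, then f has length n (ranks for >=, heights for <=),
   det a and det T are associates in O, and the determinant does not vanish in
   A/(y) by Wiebe's theorem. Hence det a is not a multiple of t by an
   annihilating element, which forces v = w. *)

Require Import Defs.
From HB Require Import structures.
From mathcomp Require Import all_boot all_algebra.
From mathcomp Require Import boolp ring zify.
From mathcomp Require classical_sets wochoice.
From mathcomp Require finmap multinomials.monalg.

Set Implicit Arguments.
Unset Strict Implicit.
Unset Printing Implicit Defensive.

Import GRing.Theory.
Local Open Scope ring_scope.
Local Open Scope quotient_scope.

(** Socles call for finite length, but nothing says beforehand that $A/(y)$ has it: finiteness of
    $\Phi_A$ controls $A$ only near the augmentation ideal. The determinant criterion must produce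
    it. It perturbs the relations by high powers of the parameters until they form a regular
    sequence, uses that the determinant then generates the socle, and returns to the given relations
    by Krull's intersection theorem.

    Comparing $v$ and $w$ becomes a nonvanishing statement because $y$ is a nonzerodivisor: if $u
    \det a = y z$ in $A$, then $z$ annihilates the augmentation ideal and $\pi$ times its image in
    $\mathcal{O}$ is $\pi^v$, which is impossible for $v = w$.

    In the structure theorem, $R$ consists of power series over a coefficient ring of $A$: a maximal
    field in residue characteristic zero, a Cohen ring of the residue field otherwise. The latter is
    cut out of the polynomial ring over $\mathbb{Z}$ with one variable for each element of $A$, by
    means of a p-basis; a Frobenius lift there shows that powers of p vanish only to the expected
    order along the kernel to the residue field. *)

Lemma predeq (T : Type) (P Q : T -> Prop) : (forall x, P x <-> Q x) -> P = Q.
Proof. by move=> PQ; apply: funext => x; apply/propext. Qed.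

(** * Ideals as predicates: sums, products, Nakayama, primes *)

Section Ideals.
Variable R : comNzRingType.
Implicit Types (I J K A B : R -> Prop) (a b x y : R) (s t : seq R).

Record ideal I : Prop := Ideal {
  ideal0 : I 0;
  idealD : forall x y, I x -> I y -> I (x + y);
  idealM : forall a x, I x -> I (a * x)
}.

Lemma idealN I x : ideal I -> I x -> I (- x).
Proof. by move=> iI Ix; rewrite -mulN1r; apply: idealM. Qed.

Lemma idealB I x y : ideal I -> I x -> I y -> I (x - y).
Proof. by move=> iI Ix Iy; apply: idealD => //; apply: idealN. Qed.

Lemma idealRM I a x : ideal I -> I x -> I (x * a).
Proof. by move=> iI Ix; rewrite mulrC; apply: idealM. Qed.

Lemma ideal_sum I (T : Type) (r : seq T) (P : pred T) F :
  ideal I -> (forall i, P i -> I (F i)) -> I (\sum_(i <- r | P i) F i).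
Proof.
move=> iI IF; apply: (big_ind I) => //; [exact: ideal0 | exact: idealD].
Qed.

Lemma ideal_trans I x y : ideal I -> I (x - y) -> I y -> I x.
Proof. by move=> iI Ixy Iy; rewrite -(subrK y x); apply: idealD. Qed.

Lemma ideal_sym I x y : ideal I -> I (x - y) -> I (y - x).
Proof. by move=> iI Ixy; rewrite -opprB; apply: idealN. Qed.

Lemma ideal_transB I y x z : ideal I -> I (x - y) -> I (y - z) -> I (x - z).
Proof. by move=> iI Ixy Iyz; rewrite -(subrKA y); apply: idealD. Qed.

Definition zeroid : R -> Prop := fun x => x = 0.
Lemma zeroid_ideal : ideal zeroid.
Proof.
by split=> [|x y -> ->|a x ->]; rewrite /zeroid ?addr0 ?mulr0.
Qed.

Lemma zeroid_sub I x : ideal I -> zeroid x -> I x.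
Proof. by move=> iI ->; apply: ideal0. Qed.

(** The ideal J + (a). With its iterate [gen] it stands for passing to a quotient: statements about
    R/J are made in R modulo J, and no quotient ring is formed for them. *)
Definition adj J a x : Prop := exists r, J (x - r * a).

Lemma adj_ideal J a : ideal J -> ideal (adj J a).
Proof.
move=> iJ; split.
- by exists 0; rewrite mul0r subr0; apply: ideal0.
- move=> x y [r Jr] [q Jq]; exists (r + q).
  by rewrite (_ : _ - _ = (x - r * a) + (y - q * a)); [apply: idealD|ring].
- move=> c x [r Jr]; exists (c * r).
  by rewrite (_ : _ - _ = c * (x - r * a)); [apply: idealM|ring].
Qed.

Lemma adj_sub J a x : J x -> adj J a x.
Proof. by exists 0; rewrite mul0r subr0. Qed.

Lemma adj_self J a : ideal J -> adj J a a.
Proof. by move=> iJ; exists 1; rewrite mul1r subrr; apply: ideal0. Qed.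

Lemma adj_mul J a r : ideal J -> adj J a (r * a).
Proof. by move=> iJ; apply: idealM (adj_self a iJ); apply: adj_ideal. Qed.

Lemma adj_min J K a : ideal K -> (forall x, J x -> K x) -> K a ->
  forall x, adj J a x -> K x.
Proof.
move=> iK JK Ka x [r /JK Kr]; apply: (ideal_trans (y := r * a)) => //.
exact: idealM.
Qed.

Lemma adj_mono J K a x : (forall x, J x -> K x) -> adj J a x -> adj K a x.
Proof. by move=> JK [r /JK Kr]; exists r. Qed.

Lemma adjC J a b : adj (adj J a) b = adj (adj J b) a.
Proof.
suff H c d x : adj (adj J c) d x -> adj (adj J d) c x by apply: predeq; split; apply: H.
case=> r [q Jq]; exists q, r.
by rewrite (_ : _ - _ = x - r * d - q * c) //; ring.
Qed.

Lemma adj_id J a : ideal J -> J a -> adj J a = J.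
Proof.
move=> iJ Ja; apply: predeq => x; split; last exact: adj_sub.
exact: adj_min.
Qed.

Definition gen J s : R -> Prop := foldl adj J s.

Lemma gen_cat J s t : gen J (s ++ t) = gen (gen J s) t.
Proof. exact: foldl_cat. Qed.

Lemma gen_rcons J s a : gen J (rcons s a) = adj (gen J s) a.
Proof. exact: foldl_rcons. Qed.

Lemma gen_ideal J s : ideal J -> ideal (gen J s).
Proof. by elim: s J => //= a s IH J iJ; apply/IH/adj_ideal. Qed.

Lemma gen_sub J s x : J x -> gen J s x.
Proof. by elim: s J => //= a s IH J Jx; apply/IH/adj_sub. Qed.

Lemma gen_in J s a : ideal J -> a \in s -> gen J s a.
Proof.
elim: s J => //= b s IH J iJ; rewrite inE => /orP[/eqP <-|].
  exact/gen_sub/adj_self.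
exact/IH/adj_ideal.
Qed.

Lemma gen_min J K s : ideal K -> (forall x, J x -> K x) ->
  (forall a, a \in s -> K a) -> forall x, gen J s x -> K x.
Proof.
move=> iK; elim: s J => [//|a s IH] J JK sK; apply: IH => [|b bs].
  by apply: adj_min => //; apply: sK; rewrite mem_head.
by apply: sK; rewrite inE bs orbT.
Qed.

Lemma gen_subseq J s t x : ideal J -> {subset s <= t} -> gen J s x -> gen J t x.
Proof.
move=> iJ st; apply: gen_min; first exact: gen_ideal.
  by move=> y; apply: gen_sub.
by move=> a /st; apply: gen_in.
Qed.

Lemma gen_perm J s t : ideal J -> s =i t -> gen J s = gen J t.
Proof.
by move=> iJ st; apply: predeq => x; split; apply: gen_subseq => // y; rewrite st.
Qed.

Lemma gen_adj J s a : gen (adj J a) s = adj (gen J s) a.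
Proof. by elim: s J => //= b s IH J; rewrite adjC IH. Qed.

Lemma genP J s x : ideal J -> gen J s x <->
  exists c : 'I_(size s) -> R, J (x - \sum_i c i * s`_i).
Proof.
move=> iJ; elim: s J x iJ => [|a s IH] J x iJ /=.
  split=> [Jx|[c]]; last by rewrite big_ord0 subr0.
  by exists (fun=> 0); rewrite big_ord0 subr0.
rewrite IH; last exact: adj_ideal; split=> [[c [r Jr]]|[c Jc]].
  exists (fun i => oapp c r (unlift ord0 i)); rewrite big_ord_recl unlift_none /=.
  under eq_bigr do rewrite liftK.
  by rewrite opprD addrA addrAC.
exists (fun i => c (lift ord0 i)), (c ord0).
by move: Jc; rewrite big_ord_recl /= opprD addrA addrAC.
Qed.

Inductive mulI A B : R -> Prop :=
| mulI0 : mulI A B 0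
| mulID x y : mulI A B x -> mulI A B y -> mulI A B (x + y)
| mulIM a b : A a -> B b -> mulI A B (a * b).

Lemma mulI_ideal A B : ideal A -> ideal (mulI A B).
Proof.
move=> iA; split; [exact: mulI0 | exact: mulID | move=> c x].
elim=> [|y z _ IHy _ IHz|a b Aa Bb]; first by rewrite mulr0; apply: mulI0.
  by rewrite mulrDr; apply: mulID.
by rewrite mulrA; apply: mulIM => //; apply: idealM.
Qed.

Lemma mulI_min A B K : ideal K -> (forall a b, A a -> B b -> K (a * b)) ->
  forall x, mulI A B x -> K x.
Proof.
move=> iK ABK x; elim=> [|y z _ IHy _ IHz|a b Aa Bb]; first exact: ideal0.
  exact: idealD.
exact: ABK.
Qed.

Lemma mulI_genP A s x : ideal A -> mulI A (gen zeroid s) x ->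
  exists2 c : 'I_(size s) -> R, forall i, A (c i) & x = \sum_i c i * s`_i.
Proof.
move=> iA; elim=> [|y z _ [c Ac ->] _ [d Ad ->]|a b Aa].
- exists (fun=> 0) => [i|]; first exact: ideal0.
  by rewrite big1 // => i _; rewrite mul0r.
- exists (fun i => c i + d i) => [i|]; first exact: idealD.
  by rewrite -big_split; apply: eq_bigr => i _; rewrite mulrDl.
case/(genP _ _ zeroid_ideal) => c /eqP; rewrite subr_eq0 => /eqP ->.
exists (fun i => a * c i) => [i|]; first exact: idealRM.
by rewrite mulr_sumr; apply: eq_bigr => i _; rewrite mulrA.
Qed.

(** Multiplying the relations by the adjugate matrix isolates each [g j]: the determinant trick
    behind Nakayama's lemma. *)
Lemma det_kill n (M : 'M[R]_n) (g : 'I_n -> R) J : ideal J ->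
  (forall i, J (\sum_j M i j * g j)) -> forall j, J (\det M * g j).
Proof.
move=> iJ Mg j; pose G : 'cV[R]_n := \col_i g i.
have -> : \det M * g j = (\adj M *m (M *m G)) j 0.
  by rewrite mulmxA mul_adj_mx mul_scalar_mx !mxE.
rewrite mxE; apply: ideal_sum => // i _; apply: idealM => //.
by rewrite mxE; under eq_bigr do rewrite mxE.
Qed.

Lemma prod_cong I (T : Type) (r : seq T) (F G : T -> R) : ideal I ->
  (forall i, I (F i - G i)) -> I (\prod_(i <- r) F i - \prod_(i <- r) G i).
Proof.
move=> iI FG; apply: (big_ind2 (fun x y => I (x - y))) => //.
  by rewrite subrr; apply: ideal0.
move=> x1 x2 y1 y2 h1 h2.
rewrite (_ : _ - _ = x1 * (y1 - y2) + y2 * (x1 - x2)); last by ring.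
by apply: idealD => //; apply: idealM.
Qed.

Lemma det_cong I n (M N : 'M[R]_n) : ideal I ->
  (forall i j, I (M i j - N i j)) -> I (\det M - \det N).
Proof.
move=> iI MN; rewrite -sumrB; apply: ideal_sum => // s _.
by rewrite -mulrBr; apply: idealM => //; apply: prod_cong.
Qed.

(* With U = {1} this is Nakayama's lemma; with U the complement of a prime it is
   Nakayama's lemma after localization. *)
Lemma nakayama_gen A J (U : R -> Prop) s : ideal A -> ideal J -> U 1 ->
  (forall a b, U a -> U b -> U (a * b)) ->
  (forall a, a \in s -> exists u y,
     [/\ U u, mulI A (gen zeroid s) y & J (u * a - y)]) ->
  exists d u, [/\ U u, A (u - d) & forall x, gen zeroid s x -> J (d * x)].
Proof.
move=> iA iJ U1 UM H.
have /choice[u] : forall i : 'I_(size s), exists u, exists c : 'I_(size s) -> R,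
    [/\ U u, forall j, A (c j) & J (u * s`_i - \sum_j c j * s`_j)].
  move=> i; have [u [y [Uu /mulI_genP[//|c Ac yE] Jy]]] := H s`_i (mem_nth _ (ltn_ord i)).
  by exists u, c; rewrite -yE.
move=> /choice[c uc].
(* The relations u_i s_i = sum_j c_ij s_j, read as M s = 0 modulo J. As the c_ij are in A, det M is
   the product of the u_i modulo A. *)
pose M : 'M[R]_(size s) := \matrix_(i, j) ((i == j)%:R * u i - c i j).
have JM (j : 'I_(size s)) : J (\det M * s`_j).
  apply: (@det_kill _ M (fun k => s`_k) J iJ _ j) => i.
  under eq_bigr do rewrite mxE mulrBl.
  rewrite sumrB (bigD1 i) //= eqxx mul1r big1 ?addr0; first by case: (uc i).
  by move=> k /negPf ki; rewrite eq_sym ki !mul0r.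
exists (\det M), (\prod_i u i); split.
- by apply: (big_ind U) => // i _; case: (uc i).
- have -> : \prod_i u i = \det (diag_mx (\row_i u i)).
    by rewrite det_diag; apply: eq_bigr => i _; rewrite mxE.
  apply: det_cong => // i j; rewrite !mxE; have [_ Ac _] := uc i.
  by have [<-|_] := eqVneq i j; rewrite ?mulr1n ?mulr0n ?mul1r ?mul0r
    ?sub0r ?opprK ?subKr.
have iJd : ideal (fun x => J (\det M * x)).
  split=> [|x y Jx Jy|a x Jx]; first by rewrite mulr0; apply: ideal0.
    by rewrite mulrDr; apply: idealD.
  by rewrite mulrCA; apply: idealM.
apply: (gen_min iJd) => [y ->|a as_]; first exact: ideal0 iJd.
by have := JM (Ordinal (etrans (index_mem a s) as_)); rewrite /= nth_index.
Qed.

Definition noeth : Prop := forall I, ideal I -> exists s, I = gen zeroid s.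

(** Without a maximal member above [I0], choice yields a strictly increasing sequence. Its union is
    an ideal with finitely many generators; they all lie in one term, so the next term cannot be
    larger. *)
Lemma noeth_max (F : (R -> Prop) -> Prop) I0 : noeth ->
  (forall I, F I -> ideal I) -> F I0 ->
  exists M, [/\ F M, forall x, I0 x -> M x &
    forall K, F K -> (forall x, M x -> K x) -> forall x, K x -> M x].
Proof.
move=> nR Fi FI0; apply: contrapT => nmax.
pose T := {M | F M /\ forall x, I0 x -> M x}.
have /choice[g gP] : forall M : T, exists K : T,
    (forall x, sval M x -> sval K x) /\ exists2 x, sval K x & ~ sval M x.
  move=> [M [FM IM]]; apply: contrapT => nK; apply: nmax; exists M; split=> //.
  move=> K FK MK x Kx; apply: contrapT => nMx; apply: nK.
  have KT : F K /\ forall x, I0 x -> K x by split=> // y /IM/MK.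
  by exists (exist _ K KT); split=> //; exists x.
have T0 : T by exists I0; split.
pose u n := sval (iter n g T0).
have uS n x : u n x -> u n.+1 x by have [+ _] := gP (iter n g T0); apply.
have umon m n x : (m <= n)%N -> u m x -> u n x.
  by move=> /subnK <-; elim: (n - m)%N => //= k IH /IH/uS.
have ui n : ideal (u n) by rewrite /u; case: (iter n g T0) => M /= [FM _]; apply: Fi.
have iU : ideal (fun x => exists n, u n x).
  split=> [|x y [m um] [n un]|a x [n un]]; first by exists 0%N; apply: ideal0.
    exists (maxn m n); apply: idealD; first exact: ui.
      by apply: umon um; apply: leq_maxl.
    by apply: umon un; apply: leq_maxr.
  by exists n; apply: idealM.
have [s sE] := nR _ iU.
have [n sn] : exists n, forall a, a \in s -> u n a.
  have : forall a, a \in s -> exists n, u n a.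
    move=> a as_; have : gen zeroid s a by apply: gen_in => //; apply: zeroid_ideal.
    by rewrite -sE.
  elim: (s) => [|a s' IH] H; first by exists 0%N.
  have [n Hn] := IH (fun b bs => H b (mem_behead (s := a :: s') bs)).
  have [m Hm] := H a (mem_head _ _).
  exists (maxn m n) => b; rewrite inE => /orP[/eqP ->|/Hn].
    by apply: umon Hm; apply: leq_maxl.
  by apply: umon; apply: leq_maxr.
have [_ [x xS nx]] := gP (iter n g T0).
apply: nx; have : gen zeroid s x by rewrite -sE; exists n.+1.
by apply: (gen_min (ui n)) => // y ->; apply: ideal0 (ui n).
Qed.

(** A maximal one among the ideals spanned by finite lists from [G] absorbs every element of [G].
    The set [G] will be [maxann], which is not an ideal. *)
Lemma noeth_span (G : R -> Prop) : noeth ->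
  exists2 s, (forall a, a \in s -> G a) & forall x, G x -> gen zeroid s x.
Proof.
move=> nR.
pose F I := exists2 s, (forall a, a \in s -> G a) & I = gen zeroid s.
have F0 : F zeroid by exists [::].
have Fi I : F I -> ideal I.
  by move=> [s _ ->]; apply/gen_ideal/zeroid_ideal.
have [M [[s sG ->] _ Mmax]] := noeth_max nR Fi F0.
exists s => // x Gx; apply: (Mmax (gen zeroid (rcons s x))).
- exists (rcons s x) => // a; rewrite mem_rcons inE => /orP[/eqP ->//|/sG//].
- by move=> y ys; rewrite gen_rcons; apply: adj_sub.
by apply: gen_in; [apply: zeroid_ideal|rewrite mem_rcons mem_head].
Qed.

Definition primeI Q : Prop :=
  [/\ ideal Q, ~ Q 1 & forall a b, Q (a * b) -> Q a \/ Q b].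

(** An ideal maximal among those that miss a multiplicative set is prime; two elements outside it
    would give two members of [S] whose product lies in it. *)
Lemma prime_exists (S J : R -> Prop) : noeth -> ideal J -> S 1 ->
  (forall a b, S a -> S b -> S (a * b)) -> (forall x, S x -> ~ J x) ->
  exists Q, [/\ primeI Q, forall x, J x -> Q x & forall x, S x -> ~ Q x].
Proof.
move=> nR iJ S1 SM SJ.
pose F I := ideal I /\ forall x, S x -> ~ I x.
have [||Q [[iQ SQ] JQ Qmax]] := @noeth_max F J nR; first by move=> I [].
  by [].
exists Q; split=> //; split=> //; first exact: SQ.
move=> a b Qab; apply: contrapT => /not_orP[nQa nQb].
have meet c : ~ Q c -> exists2 x, S x & adj Q c x.
  move=> nQc; apply: contrapT => nS; apply: nQc; apply: (Qmax (adj Q c)).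
  - split; first exact: adj_ideal.
    by move=> x Sx Qx; apply: nS; exists x.
  - by move=> x; apply: adj_sub.
  - exact: adj_self.
have [x Sx [r Qr]] := meet a nQa; have [y Sy [q Qq]] := meet b nQb.
apply: (SQ (x * y)); first exact: SM.
rewrite (_ : x * y = (x - r * a) * y + r * a * (y - q * b) + r * q * (a * b)); last by ring.
apply: idealD => //; last exact: idealM.
by apply: idealD => //; [apply: idealRM|apply: idealM].
Qed.

Lemma primeX Q a n : primeI Q -> Q (a ^+ n) -> Q a.
Proof.
move=> [iQ Q1 QM]; elim: n => [|n IH]; first by rewrite expr0.
by rewrite exprS => /QM[].
Qed.

Lemma prime_prod Q (s : seq R) : primeI Q -> Q (\prod_(a <- s) a) -> exists2 a, a \in s & Q a.
Proof.
move=> [iQ Q1 QM]; elim: s => [|a s IH]; first by rewrite big_nil.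
rewrite big_cons => /QM[Qa|/IH[b bs Qb]]; first by exists a; rewrite ?mem_head.
by exists b; rewrite // inE bs orbT.
Qed.

Fixpoint pw A n : R -> Prop := if n is n'.+1 then mulI A (pw A n') else fun=> True.

Lemma pw_ideal A n : ideal A -> ideal (pw A n).
Proof. by case: n => [|n] iA; [split | apply: mulI_ideal]. Qed.

Lemma pwX A a n : A a -> pw A n (a ^+ n).
Proof. by move=> Aa; elim: n => //= n IH; rewrite exprS; apply: mulIM. Qed.

Lemma pwS A n x : ideal A -> pw A n.+1 x -> pw A n x.
Proof.
move=> iA; elim: n x => // n IH x; apply: mulI_min; first exact: mulI_ideal.
by move=> a b Aa /IH pb; apply: mulIM.
Qed.

Lemma pw_le A m n x : ideal A -> (m <= n)%N -> pw A n x -> pw A m x.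
Proof.
by move=> iA /subnK <-; elim: (n - m)%N => // k IH /(pwS iA).
Qed.

Lemma pw1 A x : ideal A -> pw A 1 x <-> A x.
Proof.
move=> iA; split; first by apply: mulI_min => // a b Aa _; apply: idealRM.
by move=> Ax; rewrite -[x]mulr1; apply: mulIM.
Qed.

Lemma pwM A m n x y : ideal A -> pw A m x -> pw A n y -> pw A (m + n) (x * y).
Proof.
move=> iA + py; elim: m x => [|m IH] x.
  by move=> _; apply: idealM => //; apply: pw_ideal.
elim=> [|a b _ IHa _ IHb|a b Aa pb].
- by rewrite mul0r; apply: mulI0.
- by rewrite mulrDl; apply: mulID.
- by rewrite -mulrA; apply: mulIM => //; apply: IH.
Qed.

End Ideals.
Arguments zeroid {R}.

(** * Regular sequences *)

Section Regular.
Variable R : comNzRingType.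
Implicit Types (I J K A B : R -> Prop) (a b x y : R) (s t : seq R).

Definition nzd J a := forall x, J (a * x) -> J x.

(** Weakly regular sequences on R/J: that the ideal generated is proper is stated apart where it
    matters, as in [regular_sequenceP]. *)
Fixpoint reg J s : Prop :=
  if s is a :: s' then nzd J a /\ reg (adj J a) s' else True.

Lemma reg_cat J s t : reg J (s ++ t) <-> reg J s /\ reg (gen J s) t.
Proof.
elim: s J => [|a s IH] J /=; first by split=> // -[].
by rewrite IH; split=> [[? []]|[[]]].
Qed.

Lemma nzdX J a n : nzd J a -> nzd J (a ^+ n).
Proof.
move=> Ja; elim: n => [|n IH] x; first by rewrite expr0 mul1r.
by rewrite exprS -mulrA => /Ja/IH.
Qed.

Section Avoidance.
Variable J : R -> Prop.
Hypotheses (nR : noeth R) (iJ : ideal J).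

(** The colon ideal (J : z) is maximal among the proper ones, that is, a maximal associated prime of
    R/J. The prime is represented by the element z. *)
Definition maxann z := ~ J z /\ forall z', ~ J z' ->
  (forall a, J (a * z) -> J (a * z')) -> forall a, J (a * z') -> J (a * z).

Lemma ann_ideal z : ideal (fun a => J (a * z)).
Proof.
split=> [|x y Jx Jy|a x Jx]; first by rewrite mul0r; apply: ideal0.
  by rewrite mulrDl; apply: idealD.
by rewrite -mulrA; apply: idealM.
Qed.

Lemma maxann_exists (P : R -> Prop) y : P y -> ~ J y ->
  exists z, [/\ P z, ~ J z, forall a, J (a * y) -> J (a * z) &
    forall z', P z' -> ~ J z' ->
      (forall a, J (a * z) -> J (a * z')) -> forall a, J (a * z') -> J (a * z)].
Proof.
move=> Py Jy; pose F I := exists z, [/\ P z, ~ J z & I = fun a => J (a * z)].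
have Fi I : F I -> ideal I by move=> [z [_ _ ->]]; apply: ann_ideal.
have Fy : F (fun a => J (a * y)) by exists y.
have [M [[z [Pz Jz ->]] yz zmax]] := noeth_max nR Fi Fy.
exists z; split=> // z' Pz' Jz' zz' a; apply: (zmax (fun a => J (a * z'))) => //.
by exists z'.
Qed.

Lemma maxann_prime z : maxann z -> primeI (fun a => J (a * z)).
Proof.
move=> [Jz zmax]; split; [exact: ann_ideal|by rewrite mul1r|move=> a b].
case: (pselect (J (b * z))) => [|Jbz]; first by right.
move=> Jabz; left; apply: (zmax (b * z)); rewrite ?mulrA // => c Jcz.
by rewrite mulrCA; apply: idealM.
Qed.

(** Prime avoidance by induction: if w + r b^k falls into the new prime (J : z), r is moved by an
    element p that lies in all primes already treated but not in (J : z). As b is a nonzerodivisor,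
    b^k is outside (J : z) too. *)
Lemma avoid_list b w k s : nzd J b -> (forall z, z \in s -> maxann z) ->
  exists r, forall z, z \in s -> ~ J ((w + r * b ^+ k) * z).
Proof.
move=> bJ; elim: s => [|z s IH] sm; first by exists 0.
have [r rP] := IH (fun y ys => sm y (mem_behead (s := z :: s) ys)).
have zm := sm z (mem_head _ _).
have [Jr|Jr] := pselect (J ((w + r * b ^+ k) * z)); last first.
  by exists r => y; rewrite inE => /orP[/eqP ->|/rP].
(* Otherwise (J : y) lies in (J : z) and equals it by maximality; then w + r b^k is in (J : y),
   against the choice of r. *)
have H y : exists h, y \in s -> J (h * y) /\ ~ J (h * z).
  have [ys|_] := boolP (y \in s); last by exists 0.
  apply: contrapT => nh; apply: (rP _ ys).
  have ym := sm y (mem_behead (s := z :: s) ys).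
  case: (ym) => _ /(_ z); apply=> //; first by case: zm.
  move=> a Ja; apply: contrapT => nJ; apply: nh; exists a => _; split=> //.
have [h hP] := choice H.
pose p := \prod_(y <- s) h y.
have pP y : y \in s -> J (p * y).
  move=> ys; rewrite /p (big_rem y) //= mulrAC; apply: idealRM => //.
  by case: (hP y ys).
have pz : ~ J (p * (b ^+ k * z)).
  move=> Jp; have pr := maxann_prime zm; have [_ _ prM] := pr.
  have := Jp; rewrite mulrA => /prM[].
    rewrite /p -(big_map h xpredT id) => /(prime_prod pr)[c /mapP[y ys ->]].
    by case: (hP y ys).
  by move=> /(nzdX bJ); case: zm.
exists (r + p) => y; rewrite inE => /orP[/eqP ->|ys] Jy; last first.
  apply: (rP y ys); rewrite (_ : _ * y = (w + (r + p) * b ^+ k) * y - b ^+ k * (p * y)); last by ring.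
  by apply: idealB => //; apply: idealM => //; apply: pP.
apply: pz; rewrite (_ : _ * _ = (w + (r + p) * b ^+ k) * z - (w + r * b ^+ k) * z); last by ring.
exact: idealB.
Qed.

(** The zero divisors modulo J form the union of the maximal associated primes. Finitely many
    members of [maxann] span all the others, and their primes are all there are: if none of them
    were inside (J : z), a product of elements h in (J : y) outside (J : z) would kill z. *)
Lemma nzd_avoid b w k : nzd J b -> exists r, nzd J (w + r * b ^+ k).
Proof.
move=> bJ; have [s sm sG] := noeth_span maxann nR.
have [r rP] := avoid_list w k bJ sm.
exists r => y Jy; apply: contrapT => nJy.
have [z [_ Jz yz zmax]] := @maxann_exists (fun=> True) y I nJy.
have zm : maxann z by split=> // z'; apply: zmax.
have /sG zs := zm.
have [|nz'] := pselect (exists2 z', z' \in s & forall a, J (a * z') -> J (a * z)).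
  move=> [z' zs' zz']; apply: (rP _ zs').
  by case: (sm z' zs') => _ /(_ z); apply=> //; apply: yz.
have H z' : exists h, z' \in s -> J (h * z') /\ ~ J (h * z).
  have [ys|_] := boolP (z' \in s); last by exists 0.
  apply: contrapT => nh; apply: nz'; exists z' => // a Ja.
  by apply: contrapT => nJ; apply: nh; exists a => _; split.
have [h hP] := choice H.
have : J ((\prod_(y <- s) h y) * z).
  have iK : ideal (fun x => J ((\prod_(y <- s) h y) * x)).
    split=> [|x1 x2 J1 J2|a x Jx]; first by rewrite mulr0; apply: ideal0.
      by rewrite mulrDr; apply: idealD.
    by rewrite mulrCA; apply: idealM.
  apply: (gen_min iK _ _ zs) => [x ->|x xs]; first exact: ideal0 iK.
  rewrite (big_rem x) //= mulrAC; apply: idealRM => //.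
  by case: (hP x xs).
rewrite -(big_map h xpredT id) => /(prime_prod (maxann_prime zm))[c /mapP[y' ys ->]].
by case: (hP y' ys).
Qed.

End Avoidance.
End Regular.

(** * Local rings: Nakayama, Krull's intersection theorem, permuting regular sequences *)

Section Local.
Variable R : comUnitRingType.
Implicit Types (I J K A B : R -> Prop) (a b x y : R) (s t : seq R).

Definition mI : R -> Prop := fun x => x \isn't a GRing.unit.

Hypotheses (nR : noeth R) (lR : ideal mI).

Lemma mI_nunit x : ~ mI x -> x \is a GRing.unit.
Proof. by rewrite /mI => /negP/negbNE. Qed.

Lemma unit_1B x : mI x -> 1 - x \is a GRing.unit.
Proof.
move=> mx; apply: mI_nunit => m1; have : mI 1.
  by rewrite -(subrK x 1); apply: (idealD lR).
by rewrite /mI unitr1.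
Qed.

Lemma mI_unitB u x : u \is a GRing.unit -> mI (u - x) -> x \is a GRing.unit.
Proof.
move=> Uu mux; apply: mI_nunit => mx; have : mI u by apply: (ideal_trans lR mux).
by rewrite /mI Uu.
Qed.

Lemma ideal_unit I a x : ideal I -> a \is a GRing.unit -> I (a * x) -> I x.
Proof. by move=> iI Ua Iax; rewrite -(mulKr Ua x); apply: idealM. Qed.

Lemma proper_mI I x : ideal I -> ~ I 1 -> I x -> mI x.
Proof.
move=> iI I1 Ix; apply/negP => Ux; apply: I1.
by rewrite -(mulVr Ux); apply: idealM.
Qed.

Lemma nakayama I J : ideal I -> ideal J ->
  (forall x, I x -> exists2 y, mulI mI I y & J (x - y)) -> forall x, I x -> J x.
Proof.
move=> iI iJ H; have [s sE] := nR iI.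
have [|a b -> ->|a as_|d [u [-> m1d dJ]]] := @nakayama_gen _ mI J (fun x => x = 1) s lR iJ.
- by [].
- by rewrite mulr1.
- have [|y my Jy] := H a; first by rewrite sE; apply/gen_in/as_/zeroid_ideal.
  by exists 1, y; rewrite -sE mul1r.
move=> x; rewrite sE => /dJ; apply: ideal_unit => //.
exact: (mI_unitB (unitr1 _) m1d).
Qed.

Lemma nakayama1 I J a : ideal I -> ideal J -> mI a ->
  (forall x, I x -> exists2 y, I y & J (x - a * y)) -> forall x, I x -> J x.
Proof.
move=> iI iJ ma H; apply: nakayama => // x /H[y Iy Jy].
by exists (a * y) => //; apply: mulIM.
Qed.

Lemma gen_pw A s K : ideal A -> ideal K -> A = gen (@zeroid R) s ->
  (forall a, a \in s -> exists n, K (a ^+ n)) ->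
  exists n, forall x, pw A n x -> K x.
Proof.
move=> iA iK ->{A iA}; elim: s => [|a s IH] sK.
  exists 1%N => x /pw1-/(_ (@zeroid_ideal R)) ->; exact: ideal0.
have [n nK] := IH (fun b bs => sK b (mem_behead (s := a :: s) bs)).
have [m mK] := sK a (mem_head _ _).
set A := gen zeroid s in nK *.
have iA : ideal A by apply/gen_ideal/zeroid_ideal.
have -> : gen zeroid (a :: s) = adj A a by rewrite /= gen_adj.
(* Modulo a^j, the power i + j of A + (a) is inside A^i. *)
have H i j x : pw (adj A a) (i + j) x -> exists2 y, pw A i y & exists z, x = y + a ^+ j * z.
  elim: i j x => [|i IHi] j x; first by exists x => //; exists 0; rewrite mulr0 addr0.
  elim: j x => [|j IHj] x; first by exists 0; [apply: mulI0|exists x; rewrite expr0 mul1r add0r].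
  rewrite addSn; elim=> [|x1 x2 _ [y1 p1 [z1 ->]] _ [y2 p2 [z2 ->]]|b c [r Ab] pc].
  - by exists 0; [apply: mulI0|exists 0; rewrite mulr0 addr0].
  - by exists (y1 + y2); [apply: mulID|exists (z1 + z2); ring].
  have [y1 p1 [z1 c1]] := IHi j.+1 c pc.
  have [|y2 p2 [z2 c2]] := IHj c; first by rewrite addSnnS.
  have iP : ideal (pw A i.+1) by apply: pw_ideal.
  exists ((b - r * a) * y1 + r * a * y2); first apply: (idealD iP).
  - exact: mulIM.
  - exact: idealM.
  exists ((b - r * a) * z1 + r * z2).
  by rewrite -[b in LHS](subrK (r * a)) mulrDl {1}c1 c2 exprS; ring.
exists (n + m)%N => x /H[y /nK Ky [z ->]].
by apply: (idealD iK) => //; apply: (idealRM _ iK).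
Qed.

(** Let D be the intersection of the J + m^k. Take K maximal among the ideals that contain mD + J
    and meet D only inside it. A power of m lies in K, so D lies in K, hence in mD + J, and Nakayama
    applies. This takes the place of the Artin-Rees lemma. *)
Lemma krull_intersection J : ideal J ->
  forall x, (forall k, exists2 y, J y & pw mI k (x - y)) -> J x.
Proof.
move=> iJ.
pose D x := forall k, exists2 y, J y & pw mI k (x - y).
have iD : ideal D.
  split=> [k|x y Dx Dy k|a x Dx k].
  - by exists 0; [apply: ideal0|rewrite subrr; apply: (ideal0 (pw_ideal k lR))].
  - have [x' Jx px] := Dx k; have [y' Jy py] := Dy k; exists (x' + y'); first exact: idealD.
    by rewrite opprD addrACA; apply: (idealD (pw_ideal k lR)) px py.
  - have [x' Jx px] := Dx k; exists (a * x'); first exact: idealM.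
    by rewrite -mulrBr; apply: (idealM (pw_ideal k lR)) px.
pose mDJ x := exists2 y, mulI mI D y & J (x - y).
have imD : ideal (mulI mI D) by apply: mulI_ideal.
have imDJ : ideal mDJ.
  split=> [|x y [x' x1 x2] [y' y1 y2]|a x [x' x1 x2]].
  - by exists 0; [apply: ideal0|rewrite subrr; apply: ideal0].
  - by exists (x' + y'); [apply: idealD|rewrite opprD addrACA; apply: idealD].
  - by exists (a * x'); [apply: idealM|rewrite -mulrBr; apply: idealM].
pose F K := [/\ ideal K, forall x, mDJ x -> K x & forall x, K x -> D x -> mDJ x].
have [|K [[iK mK KD] _ Kmax]] := @noeth_max R F mDJ nR (fun I '(And3 iI _ _) => iI).
  by split.
suff [e eK] : exists e, forall x, pw mI e x -> K x.
  apply: nakayama => // x Dx; apply: (KD _ _ Dx).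
  have [y Jy pxy] := Dx e; apply: (ideal_trans iK (eK _ pxy)).
  by apply: mK; exists 0; [apply: ideal0|rewrite subr0].
have [s sE] := nR lR; apply: (gen_pw lR iK sE) => z zs.
have mz : mI z by rewrite sE; apply/gen_in/zs/zeroid_ideal.
pose G I := exists j, I = fun x => K (x * z ^+ j).
have Gi I : G I -> ideal I by move=> [j ->]; apply: ann_ideal.
have [M [[j ->] _ jmax]] := noeth_max nR Gi (ex_intro _ 0%N erefl).
have jS x : K (x * z ^+ j.+1) -> K (x * z ^+ j).
  apply: (jmax (fun x => K (x * z ^+ j.+1))); first by exists j.+1.
  by move=> y Ky; rewrite exprS mulrCA; apply: idealM.
(* Since (K : z^j) is stationary at j, the ideal K + (z^j) still meets D only inside mD + J; by
   maximality z^j is in K. *)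
exists j; apply: (Kmax (adj K (z ^+ j))); last exact: adj_self.
  split; [exact: adj_ideal|by move=> x /mK; apply: adj_sub|].
  move=> d [r Kd] Dd; apply: KD => //; apply: (ideal_trans iK Kd).
  apply: jS; rewrite exprSr mulrA.
  have -> : r * z ^+ j * z = z * d - z * (d - r * z ^+ j) by rewrite mulrBr subKr mulrC.
  apply: (idealB iK); last exact: idealM.
  by apply: mK; exists (z * d); [apply: mulIM|rewrite subrr; apply: ideal0].
by move=> x; apply: adj_sub.
Qed.

(** Let N be the ideal of elements killed by b modulo J. For x in N one has x = a y modulo J, and
    cancelling a from a b y puts y in N: so N is inside J + aN, and Nakayama makes b a
    nonzerodivisor. The second claim is then formal. *)
Lemma nzd_swap J a b : ideal J -> mI a -> nzd J a -> nzd (adj J a) b ->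
  nzd J b /\ nzd (adj J b) a.
Proof.
move=> iJ ma Ja Jb; have bJ : nzd J b.
  have iN : ideal (fun x => J (b * x)).
    split=> [|x y Jx Jy|c x Jx]; first by rewrite mulr0; apply: ideal0.
      by rewrite mulrDr; apply: idealD.
    by rewrite mulrCA; apply: idealM.
  move=> z Jz; apply: (nakayama1 iN iJ ma) Jz => x Jx.
  have [|y Jy] := Jb x; first exact: adj_sub.
  exists y; last by rewrite mulrC.
  apply: Ja; have -> : a * (b * y) = b * x - b * (x - y * a) by ring.
  by apply: idealB => //; apply: idealM.
split=> // x [y Jy].
have [|y' Jy'] := Jb y.
  exists x; have -> : b * y - x * a = - (a * x - y * b) by ring.
  exact: idealN.
exists y'; apply: Ja.
have -> : a * (x - y' * b) = (a * x - y * b) + b * (y - y' * a) by ring.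
by apply: idealD => //; apply: idealM.
Qed.

Lemma reg_rot J a s : ideal J -> mI a -> reg J (a :: s) -> reg J (rcons s a).
Proof.
move=> + ma; elim: s J => [|b s IH] J iJ // [Ja [Jb Js]].
have [bJ aJ] := nzd_swap iJ ma Ja Jb.
split=> //; apply: IH; first exact: adj_ideal.
by split=> //; rewrite adjC.
Qed.

Lemma reg_unrot J a s : ideal J -> (forall b, b \in s -> mI b) ->
  reg J (rcons s a) -> reg J (a :: s).
Proof.
elim: s J => [|b s IH] J iJ ms // [Jb Js].
have [||Ja Js'] := IH _ _ _ Js; first exact: adj_ideal.
  by move=> c cs; apply: ms; rewrite inE cs orbT.
have [aJ bJ] := nzd_swap iJ (ms b (mem_head _ _)) Jb Ja.
by split=> //; split=> //; rewrite adjC.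
Qed.

Lemma reg_last J s a t : ideal J -> mI a -> reg J (s ++ a :: t) -> reg J (s ++ rcons t a).
Proof.
move=> iJ ma; rewrite !reg_cat => -[Js Jt]; split=> //.
by apply: reg_rot => //; apply: gen_ideal.
Qed.

End Local.

(** * Dimension theory *)

Section PrincipalIdealTheorem.
Variable R : comNzRingType.
Hypothesis nR : noeth R.
Implicit Types (I J K A B P Q : R -> Prop) (a b x y : R).

(** Saturated ideals correspond to the ideals of the localization at P, for which they stand in. *)
Definition saturated P I := forall s x, ~ P s -> I (s * x) -> I x.

(** The localization of R/G at a minimal prime P over G is artinian. Noetherian induction: a maximal
    counterexample A admits z outside A with P z inside A, so that passing from A to A + (z)
    accounts for at most one step of a chain. *)
Lemma dcc_saturated P G : primeI P -> ideal G ->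
  (forall Q, primeI Q -> (forall x, G x -> Q x) -> (forall x, Q x -> P x) ->
     forall x, P x -> Q x) ->
  forall I : nat -> R -> Prop, (forall n, ideal (I n)) ->
  (forall n, saturated P (I n)) -> (forall n x, G x -> I n x) ->
  (forall n x, I n.+1 x -> I n x) ->
  exists N, forall n, (N <= n)%N -> forall x, I n x -> I n.+1 x.
Proof.
move=> prP iG minP I Ii Is GI ID; have [iP P1 PM] := prP.
pose dcc A := forall I : nat -> R -> Prop, (forall n, ideal (I n)) ->
  (forall n, saturated P (I n)) -> (forall n x, A x -> I n x) ->
  (forall n x, I n.+1 x -> I n x) ->
  exists N, forall n, (N <= n)%N -> forall x, I n x -> I n.+1 x.
pose sat A x := exists2 s, ~ P s & A (s * x).
have sat_ideal A : ideal A -> ideal (sat A).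
  move=> iA; split=> [|x y [s Ps Asx] [t Pt Aty]|a x [s Ps Asx]].
  - by exists 1; rewrite ?mulr0; [|apply: ideal0].
  - exists (s * t); first by move/PM => [].
    have -> : s * t * (x + y) = t * (s * x) + s * (t * y) by ring.
    by apply: idealD => //; apply: idealM.
  - by exists s; rewrite // mulrCA; apply: idealM.
have sat_sat A : saturated P (sat A).
  by move=> s x Ps [t Pt Ats]; exists (t * s); [move/PM => []|rewrite -mulrA].
have sat_sub A x : A x -> sat A x by exists 1; rewrite // mul1r.
have sat_min A B : saturated P B -> (forall x, A x -> B x) -> forall x, sat A x -> B x.
  by move=> Bs AB x [s Ps /AB]; apply: Bs.
pose F A := [/\ ideal A, saturated P A, forall x, G x -> A x & ~ dcc A].
suff dccG : dcc (sat G) by apply: dccG => // n; apply: sat_min => // x; apply: GI.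
apply: contrapT => nG.
have FG : F (sat G) by split=> //; [apply: sat_ideal|move=> x; apply: sat_sub].
have [A [[iA sA GA nA] _ Amax]] :=
  @noeth_max R F _ nR (fun A '(And4 iA _ _ _) => iA) FG.
apply: nA => {I Ii Is GI ID} I Ii Is AI ID.
have [A1|A1] := pselect (A 1).
  by exists 0%N => n _ x _; apply: AI; rewrite -[x]mulr1; apply: idealM.
have [z [_ Az _ zmax]] := @maxann_exists _ _ nR iA (fun=> True) 1 Logic.I A1.
have zm : maxann A z by split=> // z'; apply: zmax.
have Pz x : P x -> A (x * z).
  apply: (minP (fun x => A (x * z))); first exact: maxann_prime.
    by move=> y /GA; apply: idealRM.
  by move=> y Ayz; apply: contrapT => /sA/(_ Ayz).
pose A' := sat (adj A z).
have iA' : ideal A' by apply/sat_ideal/adj_ideal.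
have dccA' : dcc A'.
  apply: contrapT => nA'; apply: Az; apply: (Amax A'); last exact/sat_sub/adj_self.
    by split=> // [|x /GA Ax]; [apply: sat_sat|apply/sat_sub/adj_sub].
  by move=> x Ax; apply/sat_sub/adj_sub.
pose I' n := sat (adj (I n) z).
have [n|n|n x|n x|N NI] := dccA' I'.
- exact/sat_ideal/adj_ideal.
- exact: sat_sat.
- by move=> [s Ps As]; exists s => //; apply: adj_mono As => y; apply: AI.
- by move=> [s Ps As]; exists s => //; apply: adj_mono As => y; apply: ID.
(* Either all terms contain z, and the chain is one over A + (z); or z is missing from some term on,
   and then the coefficient c of z must lie in P, so that c z is in A. *)
have [zI|/existsNP[M nMz]] := pselect (forall n, I n z).
  exists N => n /NI nI x Inx; have [|s Ps] := nI x; first exact/sat_sub/adj_sub.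
  rewrite adj_id //; first exact: Is.
exists (maxn N M) => n; rewrite geq_max => /andP[Nn Mn] x Inx.
have nz : ~ I n z.
  move=> Inz; apply: nMz; move: Mn Inz => /subnK <-.
  by elim: (n - M)%N => //= k IH /ID/IH.
have [|s Ps [c Ic]] := NI _ Nn x; first exact/sat_sub/adj_sub.
apply: (Is _ _ _ Ps); apply: (ideal_trans (Ii _) Ic); apply: AI; apply: Pz.
apply: contrapT => Pc; apply: nz; apply: (Is _ _ _ Pc).
have -> : c * z = s * x - (s * x - c * z) by ring.
by apply: (idealB (Ii _)); [apply: idealM|apply: ID].
Qed.

(** Krull's theorem in the domain R/P. The symbolic powers of Q plus (x) become stationary after
    localization at r, where [dcc_saturated] applies; Nakayama at r removes x, and Nakayama at Q
    makes some symbolic power vanish modulo P although it contains a^N. *)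
Lemma principal_ideal_theorem P Q r x : primeI P -> primeI Q -> primeI r ->
  (forall y, P y -> Q y) -> (exists2 y, Q y & ~ P y) -> (forall y, Q y -> r y) ->
  r x -> ~ Q x ->
  ~ (forall r', primeI r' -> (forall y, P y -> r' y) -> r' x ->
       (forall y, r' y -> r y) -> forall y, r y -> r' y).
Proof.
move=> prP prQ prr PQ [a Qa Pa] Qr rx Qx minr.
have [[[iP P1 PM] [iQ Q1 QM]] [ir r1 rM]] := (prP, prQ, prr).
(* The n-th symbolic power of Q, taken modulo P. *)
pose Sy n u := exists2 t, ~ Q t & exists2 y, pw Q n y & P (t * u - y).
have Syi n : ideal (Sy n).
  have ip := pw_ideal n iQ.
  split=> [|u v [t Qt [y py Py]] [s Qs [z pz Pz]]|c u [t Qt [y py Py]]].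
  - by exists 1 => //; exists 0; rewrite ?mulr0 ?subrr; [exact: ideal0|exact: ideal0].
  - exists (t * s); first by move/QM => [].
    exists (s * y + t * z); first by apply: idealD => //; apply: idealM.
    have -> : t * s * (u + v) - (s * y + t * z) = s * (t * u - y) + t * (s * v - z) by ring.
    by apply: idealD => //; apply: idealM.
  - exists t => //; exists (c * y); first exact: idealM.
    by rewrite mulrCA -mulrBr; apply: idealM.
have Sysat n t u : ~ Q t -> Sy n (t * u) -> Sy n u.
  by move=> Qt [s Qs [y py Py]]; exists (s * t); [move/QM => []|exists y; rewrite -?mulrA].
have PSy n u : P u -> Sy n u.
  move=> Pu; exists 1 => //; exists 0; last by rewrite mul1r subr0.
  exact: (ideal0 (pw_ideal n iQ)).
have SyS n u : Sy n.+1 u -> Sy n u.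
  by move=> [t Qt [y py Py]]; exists t => //; exists y => //; apply: pwS.
pose I n u := exists2 s, ~ r s & adj (Sy n) x (s * u).
have [||n|n|n u|n u|N NI] := @dcc_saturated r (adj P x) prr _ _ I.
- exact: adj_ideal.
- move=> r' pr' Gr' r'r; apply: minr => //; first by move=> y Py; apply/Gr'/adj_sub.
  exact/Gr'/adj_self.
- have iS := adj_ideal x (Syi n).
  split=> [|u v [s rs us] [t rt vt]|c u [s rs us]].
  + by exists 1; rewrite ?mulr0 //; apply: ideal0.
  + exists (s * t); first by move/rM => [].
    have -> : s * t * (u + v) = t * (s * u) + s * (t * v) by ring.
    by apply: idealD => //; apply: idealM.
  + by exists s; rewrite // mulrCA; apply: idealM.
- by move=> s u rs [t rt ut]; exists (t * s); [move/rM => []|rewrite -mulrA].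
- move=> Gu; exists 1 => //; rewrite mul1r; apply: adj_mono Gu; exact: PSy.
- by move=> [s rs us]; exists s => //; apply: adj_mono us; apply: SyS.
(* After multiplication by some t outside r, a generator is h x modulo the next symbolic power. As x
   is outside Q, h is again in the N-th one, and Nakayama at r applies because x is in r. *)
have SyN u : Sy N u -> Sy N.+1 u.
  have [s sE] := nR (Syi N).
  have [u1 v1|g gs|d [t [rt rtd dS]]] :=
    @nakayama_gen _ r (Sy N.+1) (fun t => ~ r t) s ir (Syi _) r1.
  - by move=> ru1 rv1 /rM[].
  - have Sg : Sy N g by rewrite sE; apply/gen_in/gs/zeroid_ideal.
    have [|t rt [h Sh]] := NI N (leqnn _) g.
      by exists 1 => //; rewrite mul1r; apply: adj_sub.
    exists t, (h * x); split=> //; rewrite -sE mulrC; apply: mulIM => //.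
    apply: (@Sysat _ x) => //; rewrite mulrC.
    have -> : h * x = t * g - (t * g - h * x) by ring.
    by apply: (idealB (Syi N)); [apply: idealM|apply: SyS].
  rewrite sE => /dS; apply: Sysat => /Qr rd.
  by apply: rt; apply: (ideal_trans ir rtd).
(* The equality just proved says that, localized at Q and modulo P, the N-th symbolic power is Q
   times itself. *)
have SyP u : Sy N u -> P u.
  have [s sE] := nR (Syi N).
  have [u1 v1|g gs|d [t [Qt Qtd dS]]] :=
    @nakayama_gen _ Q P (fun t => ~ Q t) s iQ iP Q1.
  - by move=> ru1 rv1 /QM[].
  - have /SyN[t Qt [y py Py]] : Sy N g by rewrite sE; apply/gen_in/gs/zeroid_ideal.
    exists t, y; split=> //; rewrite -sE; move: py => /=.
    apply: mulI_min; first exact: mulI_ideal.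
    move=> b c Qb pc; apply: mulIM => //; exists 1 => //; exists c => //.
    by rewrite mul1r subrr; apply: ideal0.
  rewrite sE => /dS/PM[/PQ Qd|//].
  by case: Qt; apply: (ideal_trans iQ Qtd).
apply: Pa; apply: (primeX (n := N) prP); apply: SyP; exists 1 => //; exists (a ^+ N).
  exact: pwX.
by rewrite mul1r subrr; apply: ideal0.
Qed.

Definition ltI P Q := (forall y, P y -> Q y) /\ (exists2 y, Q y & ~ P y).

Lemma ltI_sub P Q Q' : ltI P Q -> (forall y, Q y -> Q' y) -> ltI P Q'.
Proof.
by move=> [PQ [y Qy Py]] QQ'; split=> [z /PQ/QQ'//|]; exists y => //; apply: QQ'.
Qed.

Definition chainI (Q : nat -> R -> Prop) n :=
  (forall i, (i <= n)%N -> primeI (Q i)) /\ forall i, (i < n)%N -> ltI (Q i) (Q i.+1).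

(** If x is not in Q, the principal ideal theorem says that r is not minimal over P + (x); a smaller
    prime over it takes the place of Q. *)
Lemma middle_prime P Q r x : primeI P -> primeI Q -> primeI r -> ltI P Q ->
  ltI Q r -> r x -> exists Q', [/\ primeI Q', ltI P Q', ltI Q' r & Q' x].
Proof.
move=> prP prQ prr [PQ PQ'] [Qr Qr'] rx.
have [Qx|Qx] := pselect (Q x); first by exists Q.
apply: contrapT => nQ'; apply: (principal_ideal_theorem prP prQ prr PQ PQ' Qr rx Qx).
move=> r' prr' Pr' r'x r'r y ry; apply: contrapT => r'y; apply: nQ'.
exists r'; split=> //; split=> //; last by exists y.
by exists x => // /PQ.
Qed.

Definition setc (Q : nat -> R -> Prop) (n : nat) P := fun i => if i == n then P else Q i.

Lemma chain_extend (Q : nat -> R -> Prop) n P : chainI Q n -> primeI P -> ltI (Q n) P ->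
  chainI (setc Q n.+1 P) n.+1.
Proof.
move=> [prQ ltQ] prP QP; rewrite /setc; split=> i.
  by move=> le; case: eqP => // /eqP ni; apply: prQ; rewrite -ltnS ltn_neqAle ni.
rewrite ltnS => lin; rewrite (ltn_eqF (_ : i < n.+1)%N) ?ltnS // eqSS.
by case: eqP => [->//|/eqP ni]; apply: ltQ; rewrite ltn_neqAle ni.
Qed.

Lemma chain_replace (Q : nat -> R -> Prop) n P : chainI Q n.+1 -> primeI P -> ltI (Q n) P ->
  chainI (setc Q n.+1 P) n.+1.
Proof.
move=> [prQ ltQ]; apply: chain_extend; split=> i ni; first exact/prQ/ltnW.
exact/ltQ/ltnW.
Qed.

(** Applying [middle_prime] from the top down pushes x one place lower in the chain each time. *)
Lemma chain_through n (Q : nat -> R -> Prop) x : chainI Q n.+1 -> Q n.+1 x ->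
  exists Q' : nat -> R -> Prop, [/\ chainI Q' n.+1, Q' 0%N = Q 0%N, Q' n.+1 = Q n.+1 & Q' 1%N x].
Proof.
elim: n Q => [|n IH] Q; first by exists Q.
move=> cQ Qx; have [prQ ltQ] := cQ.
have [q [prq Qq qQ qx]] := middle_prime (prQ n (leqW (leqnSn n)))
  (prQ n.+1 (leqnSn _)) (prQ n.+2 (leqnn _)) (ltQ n (leqnSn _)) (ltQ n.+1 (leqnn _)) Qx.
have cQ1 : chainI (setc Q n.+1 q) n.+1.
  by apply: chain_replace => //; split=> i ni; [apply/prQ/leqW|apply/ltQ/leqW].
have [|Q' [cQ' Q'0 Q'n Q'x]] := IH _ cQ1; first by rewrite /setc eqxx.
exists (setc Q' n.+2 (Q n.+2)); split=> //; last by rewrite /setc eqxx.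
apply: chain_extend => //; first exact: prQ.
by rewrite Q'n /setc eqxx.
Qed.

(** As a is a nonzerodivisor modulo the earlier elements, the products a^k u with u outside P avoid
    their ideal. A prime over that ideal missing these products lies in P and does not contain a. *)
Lemma regular_chain J s P : ideal J -> reg J s -> primeI P ->
  (forall x, gen J s x -> P x) ->
  exists Q : nat -> R -> Prop, [/\ chainI Q (size s), forall x, J x -> Q 0%N x & Q (size s) = P].
Proof.
move=> iJ; elim/last_ind: s P => [|s a IH] P.
  by move=> _ prP JP; exists (fun=> P).
rewrite -cats1 reg_cat cats1 gen_rcons size_rcons => -[Js [Ja _]] prP JP.
have [iP P1 PM] := prP.
pose S x := exists k u, ~ P u /\ x = a ^+ k * u.
have [||||Q [prQ JQ SQ]] := @prime_exists _ S (gen J s) nR.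
- exact: gen_ideal.
- by exists 0%N, 1; rewrite expr0 mul1r.
- move=> x y [k [u [Pu ->]]] [l [v [Pv ->]]]; exists (k + l)%N, (u * v).
  by split; [move/PM => []|rewrite exprD mulrACA].
- by move=> x [k [u [Pu ->]]] /(nzdX Ja) Ju; apply/Pu/JP/adj_sub.
have [C [cC JC CE]] := IH Q Js prQ JQ.
exists (setc C (size s).+1 P); split=> //; last by rewrite /setc eqxx.
apply: chain_extend => //; rewrite CE; split=> [x Qx|].
  apply: contrapT => Px; apply: (SQ x) => //.
  by exists 0%N, x; rewrite expr0 mul1r.
exists a; first exact/JP/adj_self/gen_ideal.
by apply: SQ; exists 1%N, 1; rewrite expr1 mulr1.
Qed.

End PrincipalIdealTheorem.

Section Dimension.
Variable R : comUnitRingType.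
Hypotheses (nR : noeth R) (lR : ideal (@mI R)).
Implicit Types (I J K A B P Q : R -> Prop) (a b x y : R).

Lemma mI_prime : primeI (@mI R).
Proof.
split=> //; first by rewrite /mI unitr1.
move=> a b; rewrite /mI unitrM negb_and => /orP[]; by [left|right].
Qed.

Lemma parameters_regular J s (Q : nat -> R -> Prop) : ideal J ->
  (forall x, mI x -> gen J s x) -> (forall a, a \in s -> mI a) ->
  chainI Q (size s) -> (forall x, J x -> Q 0%N x) ->
  (forall x, Q 0%N x -> J x) /\ reg J s.
Proof.
elim: s J Q => [|a s IH] J Q iJ Jm ms cQ JQ.
  split=> // x Qx; apply: Jm; have [/(_ 0%N isT) [iQ Q1 _] _] := cQ.
  exact: proper_mI Qx.
have [prQ ltQ] := cQ.
have cQm : chainI (setc Q (size s).+1 (@mI R)) (size s).+1.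
  apply: chain_replace => //; first exact: mI_prime.
  apply: ltI_sub (ltQ _ (ltnSn _)) _ => y Qy.
  by have [iQ Q1 _] := prQ _ (leqnn _); apply: proper_mI Qy.
have ma : mI a := ms a (mem_head _ _).
have [|Q' [cQ' Q'0 _ Q'a]] := chain_through nR (x := a) cQm; first by rewrite /setc eqxx.
rewrite {}/setc in Q'0 cQm; have {}Q'0 : Q' 0%N = Q 0%N by rewrite Q'0.
have [prQ' ltQ'] := cQ'.
have [iQ1 _ _] := prQ' 1%N isT.
have [Q01 [b Qb Q0b]] := ltQ' 0%N isT.
have [x mx|c cs||x Jx|H1 H2] := IH (adj J a) (fun i => Q' i.+1) (adj_ideal a iJ).
- exact: Jm.
- by apply: ms; rewrite inE cs orbT.
- by split=> i ni; [apply: prQ'|apply: ltQ'].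
- by apply: adj_min Jx => // y /JQ Qy; apply: Q01; rewrite Q'0.
have [iQ Q1 QM] := prQ 0%N isT.
have Qa : ~ Q 0%N a.
  move=> Qa; apply: Q0b; move: (H1 _ Qb); rewrite Q'0; exact: adj_min.
have QJ x : Q 0%N x -> J x.
  apply: (nakayama1 nR lR iQ iJ ma) => y Qy.
  have /H1[r Jr] : Q' 1%N y by apply: Q01; rewrite Q'0.
  exists r; last by rewrite mulrC.
  have : Q 0%N (r * a).
    have -> : r * a = y - (y - r * a) by ring.
    by apply: (idealB iQ) => //; apply: JQ.
  by move=> /QM[].
split=> //; split=> // x /JQ/QM[//|/QJ//].
Qed.

(** Dropping the bottom prime of a chain that is too long leaves one to which [parameters_regular]
    applies; it forces Q_1 into J, hence into Q_0. *)
Lemma height_bound J s (Q : nat -> R -> Prop) n : ideal J ->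
  (forall x, mI x -> gen J s x) -> (forall a, a \in s -> mI a) ->
  chainI Q n -> (forall x, J x -> Q 0%N x) -> (n <= size s)%N.
Proof.
move=> iJ Jm ms [prQ ltQ] JQ; rewrite leqNgt; apply/negP => sn.
have [Q01 [b Qb Q0b]] := ltQ 0%N (leq_ltn_trans (leq0n _) sn).
have [||Q1J _] := @parameters_regular J s (fun i => Q i.+1) iJ Jm ms.
- by split=> i ni; [apply/prQ/(leq_ltn_trans ni)|apply/ltQ/(leq_ltn_trans ni)].
- by move=> x /JQ/Q01.
by apply/Q0b/JQ/Q1J.
Qed.

End Dimension.

(** * Determinants and socles *)

Section LinearForms.
Variable R : comNzRingType.
Implicit Types (J K : R -> Prop).

Definition lin m n (M : 'M[R]_(m, n)) (x : 'I_n -> R) i := \sum_j M i j * x j.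

(** Families over ordinals suit matrices and lists suit [reg] and [gen]; this passes from the former
    to the latter. *)
Definition fl n (f : 'I_n -> R) := [seq f i | i <- enum 'I_n].

Lemma flS n (f : 'I_n.+1 -> R) : fl f = f ord0 :: fl (fun i => f (lift ord0 i)).
Proof. by rewrite /fl enum_ordSl /= -map_comp. Qed.

Lemma size_fl n (f : 'I_n -> R) : size (fl f) = n.
Proof. by rewrite size_map size_enum_ord. Qed.

Lemma fl_mem n (f : 'I_n -> R) i : f i \in fl f.
Proof. by apply: map_f; rewrite mem_enum. Qed.

Lemma fl_memP n (f : 'I_n -> R) (P : R -> Prop) :
  (forall i, P (f i)) -> forall a, a \in fl f -> P a.
Proof. by move=> Pf a /mapP[i _ ->]. Qed.

Lemma lin_mul m n p (A : 'M[R]_(m, n)) (B : 'M[R]_(n, p)) x :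
  lin (A *m B) x = lin A (lin B x).
Proof.
apply: funext => i; rewrite /lin; under eq_bigr do rewrite mxE mulr_suml.
rewrite exchange_big; apply: eq_bigr => j _ /=; rewrite mulr_sumr.
by apply: eq_bigr => k _; rewrite mulrA.
Qed.

Lemma lin1 n (x : 'I_n -> R) : lin 1%:M x = x.
Proof.
apply: funext => i; rewrite /lin (bigD1 i) //= mxE eqxx mul1r big1 ?addr0 //.
by move=> j /negPf ji; rewrite mxE eq_sym ji mul0r.
Qed.

Lemma lin_scalar n a (x : 'I_n -> R) i : lin (a%:M) x i = a * x i.
Proof.
rewrite /lin (bigD1 i) //= mxE eqxx big1 ?addr0 //.
by move=> j /negPf ji; rewrite mxE eq_sym ji mul0r.
Qed.

Lemma lin_ideal J m n (M : 'M[R]_(m, n)) x i : ideal J ->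
  (forall j, J (x j)) -> J (lin M x i).
Proof. by move=> iJ Jx; apply: ideal_sum => // j _; apply: idealM. Qed.

Lemma lin_cong J m n (M : 'M[R]_(m, n)) x y i : ideal J ->
  (forall j, J (x j - y j)) -> J (lin M x i - lin M y i).
Proof.
move=> iJ Jx; rewrite -sumrB; apply: ideal_sum => // j _.
by rewrite -mulrBr; apply: idealM.
Qed.

Lemma gen_lin J n (f : 'I_n -> R) a : ideal J ->
  gen J (fl f) a <-> exists c : 'I_n -> R, J (a - \sum_i c i * f i).
Proof.
move=> iJ; split; last first.
  move=> [c Jc]; apply: (ideal_trans (gen_ideal _ iJ) (gen_sub _ Jc)).
  apply: ideal_sum => [|i _]; first exact: gen_ideal.
  by apply: (idealM (gen_ideal _ iJ)); apply: gen_in => //; apply: fl_mem.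
elim: n J f a iJ => [|n IH] J f a iJ.
  by rewrite /fl enum_ord0 => Ja; exists (fun=> 0); rewrite big_ord0 subr0.
rewrite flS /= => /IH-/(_ (adj_ideal _ iJ))[c [r Jr]].
exists (fun i => oapp c r (unlift ord0 i)); rewrite big_ord_recl unlift_none /=.
by under eq_bigr do rewrite liftK; rewrite opprD addrA addrAC.
Qed.

Lemma cramer J n (M : 'M[R]_n) x f : ideal J -> (forall i, J (f i - lin M x i)) ->
  forall j, J (\det M * x j - lin (\adj M) f j).
Proof.
move=> iJ Jf j; rewrite -(lin_scalar (\det M)) -mul_adj_mx lin_mul.
by apply: lin_cong => // i; apply: ideal_sym.
Qed.

End LinearForms.

Section Wiebe.
Variable R : comUnitRingType.
Hypotheses (nR : noeth R) (lR : ideal (@mI R)).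
Implicit Types (I J K A B P Q : R -> Prop) (a b y : R).

(** By Cramer's rule det M multiplies each x_i into (f), and the x_i generate the maximal ideal
    modulo J: the class of det M is in the socle modulo f. *)
Lemma det_socle J n (M : 'M[R]_n) x f : ideal J -> (forall i, J (f i - lin M x i)) ->
  (forall y, mI y -> gen J (fl x) y) ->
  forall y, mI y -> gen J (fl f) (y * \det M).
Proof.
move=> iJ Jf mx y /mx/gen_lin-/(_ iJ)[c Jc].
have iG := gen_ideal (fl f) iJ.
apply: (ideal_trans (y := (\sum_i c i * x i) * \det M)) => //.
  by rewrite -mulrBl; apply: idealRM => //; apply: gen_sub.
rewrite mulr_suml; apply: ideal_sum => // i _.
rewrite -mulrA [x i * _]mulrC; apply: (idealM iG).
apply: (ideal_trans iG (gen_sub _ (cramer iJ Jf i))).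
by apply: lin_ideal => // j; apply: gen_in => //; apply: fl_mem.
Qed.

(* For a maximal regular sequence f = M x, the determinant of M generates the
   socle modulo f; the induction trades the first element of f for an element
   of a generating sequence of the maximal ideal. *)
Lemma wiebe N J (x f : 'I_N -> R) (M : 'M[R]_N) : ideal J ->
  (forall a, J a -> mI a) -> (forall i, mI (x i)) ->
  (forall y, mI y -> gen J (fl x) y) -> (forall i, J (f i - lin M x i)) ->
  reg J (fl f) ->
  ~ gen J (fl f) (\det M) /\
  forall a, (forall y, mI y -> gen J (fl f) (y * a)) ->
    exists e, gen J (fl f) (a - e * \det M).
Proof.
elim: N J x f M => [|N IH] J x f M iJ Jm mx mgen Jf rf.
  rewrite det_mx00 /fl enum_ord0 /=; split; first by move/Jm; rewrite /mI unitr1.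
  by move=> a _; exists a; rewrite mulr1 subrr; apply: ideal0.
pose f' i := f (lift ord0 i).
have mf i : mI (f i).
  by apply: (ideal_trans lR (Jm _ (Jf i))); apply: lin_ideal.
have mf' i : mI (f' i) by apply: mf.
pose J' := gen J (fl f').
have iJ' : ideal J' by apply: gen_ideal.
have JJ' a : J a -> J' a by apply: gen_sub.
have genf : gen J (fl f) = adj J' (f ord0) by rewrite flS /= gen_adj.
have [rf' f0J'] : reg J (fl f') /\ nzd J' (f ord0).
  have := rf; rewrite flS => /(reg_rot nR lR iJ (mf _)).
  by rewrite -cats1 reg_cat /= => -[? []].
rewrite genf.
(* It is enough to treat generators z whose first member is a nonzerodivisor modulo J', the ideal of
   J and all f_i but the first. *)
suff stepA (z : 'I_N.+1 -> R) (L : 'M[R]_N.+1) : (forall i, mI (z i)) ->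
    (forall y, mI y -> gen J (fl z) y) -> (forall i, J (f i - lin L z i)) ->
    nzd J' (z ord0) ->
    ~ adj J' (f ord0) (\det L) /\
    forall a, (forall y, mI y -> adj J' (f ord0) (y * a)) ->
      exists e, adj J' (f ord0) (a - e * \det L).
  (* The exponent 2 matters: one factor f_0 is rewritten as the linear form of row 0 in the x_j, the
     other keeps the entries of E - 1 in the maximal ideal, so that E is invertible. *)
  have [r lJ'] := nzd_avoid nR iJ' (x ord0) 2 f0J'.
  pose g j := r * f ord0 * M ord0 j.
  have mg j : mI (g j).
    by rewrite /g mulrAC; apply: idealM.
  pose E : 'M[R]_N.+1 := \matrix_(i, j) ((i == j)%:R + (i == ord0)%:R * g j).
  have UE : E \in unitmx.
    rewrite unitmxE; apply: (mI_unitB lR (unitr1 _)); rewrite -(det1 _ N.+1).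
    apply: det_cong => // i j; rewrite !mxE opprD addrA subrr sub0r.
    by apply: idealN => //; apply: idealM.
  pose z := lin E x.
  have zE i : z i = x i + (i == ord0)%:R * \sum_j g j * x j.
    rewrite /z /lin; under eq_bigr do rewrite mxE mulrDl.
    rewrite big_split /= -[X in X + _ = _]/(\sum_j _) mulr_sumr; congr (_ + _).
      rewrite (bigD1 i) //= eqxx mul1r big1 ?addr0 // => j /negPf ji.
      by rewrite eq_sym ji mul0r.
    by apply: eq_bigr => j _; rewrite mulrA.
  have mz i : mI (z i) by apply: lin_ideal.
  have [|||nL sL] := stepA z (M *m invmx E) mz.
  - move=> y /mgen; apply: gen_min; first exact: gen_ideal.
      by move=> a; apply: gen_sub.
    apply: fl_memP => i; have -> : x i = lin (invmx E) z i.
      by rewrite /z -lin_mul mulVmx // lin1.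
    apply: lin_ideal; first exact: gen_ideal.
    by move=> j; apply: gen_in => //; apply: fl_mem.
  - by move=> i; rewrite /z -lin_mul -mulmxA mulVmx // mulmx1.
  - move=> y Jy; apply: lJ'.
    apply: (ideal_trans iJ' _ Jy); rewrite -mulrBl; apply: idealRM => //.
    apply: JJ'; rewrite zE eqxx mul1r opprD addrACA subrr add0r.
    have -> : \sum_j g j * x j = r * f ord0 * lin M x ord0.
      by rewrite mulr_sumr; apply: eq_bigr => j _; rewrite mulrA.
    rewrite expr2 mulrA -mulrBr; exact: idealM.
  have dE : \det M = \det (M *m invmx E) * \det E by rewrite -det_mulmx mulmxKV.
  have iA := adj_ideal (f ord0) iJ'.
  split=> [|a /sL[e Ae]].
    by rewrite dE mulrC => /(ideal_unit iA); rewrite -unitmxE => /(_ UE).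
  exists (e * (\det E)^-1).
  by rewrite dE [_ * \det E]mulrC mulrA divrK // -unitmxE.
move=> mz zgen Jz zJ'.
pose z' i := z (lift ord0 i).
pose L' := row' ord0 (col' ord0 L).
(* Row 0 of the adjugate applied to f: modulo the f_i with i > 0 only the cofactor at (0, 0)
   survives. *)
have key : J' (\det L * z ord0 - \det L' * f ord0).
  apply: (ideal_transB (y := lin (\adj L) f ord0)) => //.
    exact: (JJ' _ (cramer iJ Jz _)).
  rewrite /lin big_ord_recl mxE /cofactor addn0 expr0 mul1r addrAC subrr add0r.
  apply: ideal_sum => // i _; apply: idealM => //.
  by apply: gen_in => //; apply: (fl_mem f').
have genz : gen (adj J (z ord0)) (fl z') = gen J (fl z) by rewrite flS.
have [||||||nL' sL'] := IH (adj J (z ord0)) z' f' L'.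
- exact: adj_ideal.
- by apply: adj_min => //; apply: mz.
- by move=> i; apply: mz.
- by move=> y; rewrite genz; apply: zgen.
- move=> i; exists (L (lift ord0 i) ord0).
  have -> : lin L' z' i = \sum_j L (lift ord0 i) (lift ord0 j) * z' j.
    by apply: eq_bigr => j _; rewrite !mxE.
  have := Jz (lift ord0 i).
  by rewrite addrAC /lin big_ord_recl opprD addrA.
- have : reg J (rcons (fl f') (z ord0)) by rewrite -cats1 reg_cat.
  by case/(reg_unrot nR lR iJ (fl_memP mf')).
rewrite gen_adj -/J' in nL' sL'.
(* The relation z_0 a = b f_0 modulo J' matches the socle modulo (J', f_0) with the socle modulo
   (J', z_0), and by [key] it matches det L with det L'. *)
split=> [[e Je]|a ma].
  apply: nL'; exists e.
  apply: f0J'.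
  have -> : f ord0 * (\det L' - e * z ord0) =
     z ord0 * (\det L - e * f ord0) - (\det L * z ord0 - \det L' * f ord0) by ring.
  by apply: idealB => //; apply: idealM.
have [b Jb] := ma _ (mz ord0).
have [y my|e [c Jc]] := sL' b.
  have [c Jc] := ma _ my; exists c; apply: f0J'.
  have -> : f ord0 * (y * b - c * z ord0) =
    z ord0 * (y * a - c * f ord0) - y * (z ord0 * a - b * f ord0) by ring.
  by apply: idealB => //; apply: idealM.
exists e, c; apply: zJ'.
have -> : z ord0 * (a - e * \det L - c * f ord0) = (z ord0 * a - b * f ord0)
  + f ord0 * (b - e * \det L' - c * z ord0)
  - e * (\det L * z ord0 - \det L' * f ord0) by ring.
by apply: idealB; [|apply: idealD => //; apply: idealM|apply: idealM].
Qed.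
End Wiebe.

(** * Perturbation of relations and the determinant criterion *)

Section SystemOfParameters.
Variable R : comUnitRingType.
Hypotheses (nR : noeth R) (lR : ideal (@mI R)).
Implicit Types (I J K A B P Q : R -> Prop) (a b y : R).

(** The x_i are replaced one at a time: x_0 is rotated to the end, where [nzd_avoid] gives a
    nonzerodivisor f_0 + r x_0^k, and this new member is rotated back to the front. *)
Lemma perturb_regular N J (x f : 'I_N -> R) k : ideal J -> (forall i, mI (x i)) ->
  reg J (fl x) -> exists r : 'I_N -> R, reg J (fl (fun i => f i + r i * x i ^+ k)).
Proof.
elim: N J x f => [|N IH] J x f iJ mx; first by exists (fun=> 0); rewrite /fl enum_ord0.
pose x' i := x (lift ord0 i).
rewrite flS -/x' => /(reg_rot nR lR iJ (mx _)); rewrite -cats1 reg_cat => -[rx' /= [x0 _]].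
have [r r0] := nzd_avoid nR (gen_ideal (fl x') iJ) (f ord0) k x0.
have : reg J (rcons (fl x') (f ord0 + r * x ord0 ^+ k)) by rewrite -cats1 reg_cat.
case/(reg_unrot nR lR iJ (fl_memP (fun i => mx (lift ord0 i)))) => fJ /IH.
have iA := adj_ideal (f ord0 + r * x ord0 ^+ k) iJ.
case/(_ (fun i => f (lift ord0 i)) iA (fun i => mx _)) => r' rP.
exists (fun i => oapp r' r (unlift ord0 i)); rewrite flS unlift_none /=; split=> //.
by move: rP; congr (reg _ (fl _)); apply: funext => i; rewrite liftK.
Qed.

(** One generator at a time: modulo J and the other g_j, f_0 is (1 - c) g_0 with c in the maximal
    ideal, hence an associate of g_0. *)
Lemma regular_exchange N J I (f g : 'I_N -> R) : ideal J ->
  (forall i, mI (f i)) -> (forall i, mI (g i)) ->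
  reg J (fl g) -> I = gen J (fl g) -> (forall i, mulI (@mI R) I (g i - f i)) ->
  reg J (fl f) /\ I = gen J (fl f).
Proof.
elim: N J f g => [|N IH] J f g iJ mf mg; first by rewrite /fl enum_ord0.
pose g' i := g (lift ord0 i); pose f' i := f (lift ord0 i).
have mg' i : mI (g' i) by apply: mg.
rewrite !flS -/g' -/f' => /(reg_rot nR lR iJ (mg _)).
rewrite -cats1 reg_cat => -[rg' /= [g0 _]] IE mgf.
have iG := gen_ideal (fl g') iJ.
have [c mc Gc] : exists2 c, mI c & gen J (fl g') ((1 - c) * g ord0 - f ord0).
  have := mgf ord0; rewrite IE gen_adj.
  suff H z : mulI (@mI R) (adj (gen J (fl g')) (g ord0)) z ->
      exists2 c, mI c & gen J (fl g') (z - c * g ord0).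
    by case/H => c mc Gc; exists c => //; move: Gc; congr (gen _ _ _); ring.
  elim=> [|u v _ [c mc Gc] _ [d md Gd]|a b ma [r Gr]].
  - by exists 0; [apply: ideal0|rewrite mul0r subr0; apply: ideal0].
  - exists (c + d); first exact: (idealD lR).
    have -> : u + v - (c + d) * g ord0 = (u - c * g ord0) + (v - d * g ord0) by ring.
    exact: idealD.
  - exists (a * r); first exact: idealRM.
    by rewrite -mulrA -mulrBr; apply: idealM.
have U1c := unit_1B lR mc.
have f0 : nzd (gen J (fl g')) (f ord0).
  move=> y Gy; apply: g0; apply: (ideal_unit iG U1c); rewrite mulrA.
  by apply: (ideal_trans iG _ Gy); rewrite -mulrBl; apply: idealRM.
have : reg J (rcons (fl g') (f ord0)) by rewrite -cats1 reg_cat.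
case/(reg_unrot nR lR iJ (fl_memP mg')) => f0J rg1.
have iA := adj_ideal (f ord0) iJ.
have IE1 : I = gen (adj J (f ord0)) (fl g').
  rewrite IE !gen_adj; apply: predeq => y; split; apply: adj_min.
  - exact: adj_ideal.
  - by move=> z; apply: adj_sub.
  - apply: (ideal_unit (adj_ideal _ iG) U1c); exists 1.
    by rewrite mul1r.
  - exact: adj_ideal.
  - by move=> z; apply: adj_sub.
  - exists (1 - c); rewrite -opprB; exact: idealN.
have [] := IH (adj J (f ord0)) f' g' iA _ mg' rg1 IE1 _; last by [].
  by move=> i; apply: mf.
by move=> i; apply: mgf.
Qed.

Section RegularParameters.
Variables (N : nat) (x : 'I_N -> R).
Hypotheses (mx : forall i, mI (x i)) (xgen : forall y, mI y -> gen zeroid (fl x) y)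
  (xreg : reg zeroid (fl x)).

(** A regular sequence of length N inside P gives a prime chain of length N ending in P. If P were
    not maximal, the chain could be prolonged beyond the N generators of the maximal ideal. *)
Lemma regular_primary (f : 'I_N -> R) P : reg zeroid (fl f) -> primeI P ->
  (forall y, gen zeroid (fl f) y -> P y) -> forall y, mI y -> P y.
Proof.
move=> rf prP fP y my; apply: contrapT => Py.
have [Q [cQ zQ]] := regular_chain nR (@zeroid_ideal R) rf prP fP.
rewrite size_fl => QN; rewrite size_fl in cQ.
have [iP P1 _] := prP.
have ltP : ltI (Q N) (@mI R).
  by rewrite QN; split=> [z|]; [apply: proper_mI|exists y].
have cQ' := chain_extend cQ (mI_prime lR) ltP.
have := height_bound nR lR (@zeroid_ideal R) xgen (fl_memP mx) cQ'.
rewrite size_fl ltnn => H; suff : false by []; apply: H => z zz.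
by rewrite /setc /=; apply: zQ.
Qed.

Let k_pw_ideal k : ideal (pw (@mI R) k).
Proof. exact: pw_ideal. Qed.

Definition plus I J y := exists2 z, I z & J (y - z).

Lemma plus_ideal I J : ideal I -> ideal J -> ideal (plus I J).
Proof.
move=> iI iJ; split=> [|y z [y' ? ?] [z' ? ?]|a y [y' ? ?]].
- by exists 0; rewrite ?subr0; apply: ideal0.
- by exists (y' + z'); rewrite ?opprD 1?addrACA; apply: idealD.
- by exists (a * y'); rewrite -?mulrBr; apply: idealM.
Qed.

Lemma plus_l I J y : ideal J -> I y -> plus I J y.
Proof. by move=> iJ Iy; exists y => //; rewrite subrr; apply: ideal0. Qed.

Lemma plus_r I J y : ideal I -> J y -> plus I J y.
Proof. by move=> iI Jy; exists 0; rewrite ?subr0 //; apply: ideal0. Qed.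

(** The perturbation r_i x_i^(k+1) of the i-th form is absorbed by the i-th diagonal entry as r_i
    x_i^k; hence the exponent k + 1 in the call of [perturb_regular]. *)
Lemma perturb_lin (M : 'M[R]_N) k :
  exists2 M' : 'M[R]_N, reg zeroid (fl (lin M' x)) &
    pw (@mI R) k (\det M' - \det M) /\
    forall i, exists r, lin M' x i - lin M x i = x i * (r * x i ^+ k).
Proof.
have [r rP] := perturb_regular (lin M x) k.+1 (@zeroid_ideal R) mx xreg.
pose M' := M + diag_mx (\row_i (r i * x i ^+ k)).
have px i : pw (@mI R) k (r i * x i ^+ k).
  by apply: idealM => //; apply: pwX.
have M'M i j : pw (@mI R) k (M' i j - M i j).
  rewrite !mxE addrC addKr; case: eqP => _; rewrite ?mulr1n ?mulr0n //.
  exact: ideal0.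
have M'x i : lin M' x i = lin M x i + r i * x i ^+ k.+1.
  rewrite /lin; under eq_bigr do rewrite !mxE mulrDl.
  rewrite big_split /=; congr (_ + _); rewrite (bigD1 i) //= eqxx mulr1n big1 ?addr0.
    by rewrite exprSr mulrA.
  by move=> j /negPf ji; rewrite eq_sym ji mulr0n mul0r.
exists M'; first by rewrite (funext M'x).
split=> //; first exact: det_cong.
by move=> i; exists (r i); rewrite M'x addrC addKr exprS mulrCA.
Qed.

(** Let G be generated by the perturbed forms f'_i with i different from j0. As row j0 of M' still
    gives 0, det M' multiplies the maximal ideal into G, in particular f'_j0, which is a
    nonzerodivisor modulo G. So det M' is in G, and det M is in K + m^k for every k. *)
Lemma det_syzygy K (M : 'M[R]_N) j0 : ideal K -> (forall i, K (lin M x i)) ->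
  lin M x j0 = 0 -> K (\det M).
Proof.
move=> iK KM M0; apply: (krull_intersection nR lR iK) => k.
have [r rP] := perturb_regular (lin M x) k.+1 (@zeroid_ideal R) mx xreg.
set f' := (fun i => _) in rP.
(* Row [j0] is left alone, so its form stays 0, while the regular sequence f' has there a multiple
   of the power k + 1 of x_j0. *)
pose M' : 'M[R]_N := \matrix_(i, j) (M i j + ((i == j) && (i != j0))%:R * (r i * x i ^+ k)).
have px i : pw (@mI R) k (r i * x i ^+ k) by apply: idealM => //; apply: pwX.
have M'x i : lin M' x i = if i == j0 then 0 else f' i.
  rewrite /lin; under eq_bigr do rewrite mxE mulrDl.
  rewrite big_split /= -[X in X + _]/(lin M x i) (bigD1 i) //= eqxx big1 ?addr0; last first.
    by move=> j /negPf ji; rewrite eq_sym ji !mul0r.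
  case: eqP => [->|_] /=.
    by rewrite M0 !mul0r add0r.
  by rewrite mul1r -mulrA -exprSr.
have [s1 [s2 sE]] : exists s1 s2, enum 'I_N = s1 ++ j0 :: s2.
  by have := mem_enum 'I_N j0; case/splitPr => p1 p2; exists p1, p2.
pose G := gen zeroid (map f' (s1 ++ s2)).
have iG : ideal G by apply/gen_ideal/zeroid_ideal.
have mf' : mI (f' j0).
  by rewrite /f' M0 add0r; apply: idealM => //; rewrite exprS; apply: idealRM.
have f'G : nzd G (f' j0).
  have := rP; rewrite /fl sE map_cat map_cons.
  move=> /(reg_last nR lR (@zeroid_ideal R) mf').
  by rewrite -cats1 catA -map_cat reg_cat => -[_ []].
have Gf i : i != j0 -> G (f' i).
  move=> ij; apply: gen_in; first exact: zeroid_ideal.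
  apply: map_f; have := mem_enum 'I_N i; rewrite sE !mem_cat inE (negPf ij) /=.
  by case: (_ \in s1).
have Gd y : mI y -> G (y * \det M').
  move=> my; have H i : zeroid (lin M' x i - lin M' x i) by rewrite /zeroid subrr.
  have := det_socle (@zeroid_ideal R) H xgen my.
  apply: (gen_min iG) => [z ->|]; first exact: (ideal0 iG).
  apply: fl_memP => i; rewrite M'x; case: eqP => [_|/eqP]; first exact: (ideal0 iG).
  exact: Gf.
have /f'G Gdet := Gd _ mf'.
have [z Kz pz] : plus K (pw (@mI R) k) (\det M').
  apply: (gen_min (plus_ideal iK (k_pw_ideal k)) _ _ Gdet).
    by move=> y ->; apply: (ideal0 (plus_ideal iK (k_pw_ideal k))).
  move=> a /mapP[i _ ->]; exists (lin M x i) => //.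
  by rewrite /f' addrC addKr exprSr mulrA; apply: idealRM.
exists z => //; apply: (ideal_transB (k_pw_ideal k) _ pz).
apply: det_cong => // i j; rewrite !mxE opprD addNKr.
by apply: idealN => //; apply: idealM.
Qed.

(** Rows of M are exchanged for rows of L one by one. By multilinearity each exchange changes the
    determinant by that of a matrix having a syzygy of x as a row, which is in K. Thus det M modulo
    K depends only on the forms M x. *)
Lemma det_syzygyB K (L M : 'M[R]_N) : ideal K -> (forall i, K (lin M x i)) ->
  lin L x = lin M x -> K (\det M - \det L).
Proof.
move=> iK KM LM.
pose H k : 'M[R]_N := \matrix_(i, j) (if (i < k)%N then L i j else M i j).
have HN : \det L = \det (H N) by congr (\det _); apply/matrixP=> i j; rewrite mxE ltn_ord.
have H0 : \det M = \det (H 0%N) by congr (\det _); apply/matrixP=> i j; rewrite mxE.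
rewrite HN H0.
suff Hk k : (k <= N)%N -> K (\det (H 0%N) - \det (H k)) by exact: Hk.
elim: k => [|k IH] kN; first by rewrite subrr; apply: ideal0.
apply: (ideal_transB iK (IH (ltnW kN))).
pose k0 := Ordinal kN.
pose A : 'M[R]_N := \matrix_(i, j) (if i == k0 then M i j - L i j else H k i j).
have linH n i : lin (H n) x i = lin M x i.
  rewrite /lin -[RHS]/(lin M x i); case: (ltnP i n) => ni.
    by rewrite -LM; apply: eq_bigr => j _; rewrite mxE ni.
  by apply: eq_bigr => j _; rewrite mxE ltnNge ni.
have linA i : lin A x i = if i == k0 then 0 else lin M x i.
  rewrite /lin; case: eqP => [->|/eqP ik].
    under eq_bigr do rewrite mxE eqxx mulrBl.
    by rewrite sumrB -[X in X - _]/(lin M x k0) -LM subrr.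
  rewrite -[RHS]/(lin M x i) -(linH k).
  by apply: eq_bigr => j _; rewrite mxE (negPf ik).
have -> : \det (H k) - \det (H k.+1) = \det A.
  rewrite (determinant_multilinear (A := A) (B := H k) (C := H k.+1) (i0 := k0) (b := 1) (c := -1)).
  - by rewrite mul1r mulN1r.
  - by apply/rowP => j; rewrite !mxE eqxx ltnn ltnSn mul1r mulN1r.
  - by apply/matrixP => i j; rewrite !mxE eq_sym (negPf (neq_lift _ _)).
  - apply/matrixP => i j; rewrite !mxE eq_sym (negPf (neq_lift _ _)).
    have : lift k0 i != k0 by rewrite eq_sym neq_lift.
    by rewrite -val_eqE /= ltnS leq_eqVlt => /negPf ->.
apply: (@det_syzygy _ _ k0) => // [i|]; rewrite linA ?eqxx //.
by case: eqP => // _; apply: ideal0.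
Qed.

(** Perturbed forms g are regular and generate some G inside I + m^k. If I were not inside G, a
    multiple of an element of I would be a socle generator like det M', so that det M would be in I
    + m^k, excluded for k >= k0. Hence f = E g, with E invertible for a similar reason, and f, g and
    I give the same ideal. For large k the f_i differ from the g_i by elements of mI, and f is
    regular too. *)
Lemma det_criterion I (M : 'M[R]_N) : ideal I -> (forall i, I (lin M x i)) ->
  ~ I (\det M) -> reg zeroid (fl (lin M x)) /\ I = gen zeroid (fl (lin M x)).
Proof.
move=> iI IM ndet; set f := lin M x in IM *.
have mf i : mI (f i) by apply: lin_ideal.
(* Krull's intersection theorem keeps det M outside some I + m^k0, which leaves room for
   perturbations. *)
have [k0 k0P] : exists k0, ~ exists2 y, I y & pw (@mI R) k0 (\det M - y).
  apply: contrapT => nk; apply: ndet; apply: (krull_intersection nR lR iI) => k.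
  by apply: contrapT => nky; apply: nk; exists k.
have claim k : (k0 <= k)%N -> exists g : 'I_N -> R, [/\ reg zeroid (fl g),
    I = gen zeroid (fl g), forall i, mI (g i) &
    forall i, exists r, g i - f i = x i * (r * x i ^+ k)].
  move=> k0k; have [M' rM' [detM' M'M]] := perturb_lin M k.
  set g := lin M' x in rM' M'M.
  have mg i : mI (g i) by apply: lin_ideal.
  exists g; split=> //.
  pose G := gen zeroid (fl g); pose Ik := plus I (pw (@mI R) k).
  have iG : ideal G by apply/gen_ideal/zeroid_ideal.
  have iIk : ideal Ik by apply: plus_ideal.
  have gM' i : zeroid (g i - lin M' x i) by rewrite /zeroid subrr.
  have GIk y : G y -> Ik y.
    apply: gen_min => // [z ->|]; first exact: (ideal0 iIk).
    apply: fl_memP => i; exists (f i) => //; have [r ->] := M'M i.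
    by apply: idealM => //; apply: idealM => //; apply: pwX.
  have nIk : ~ Ik (\det M).
    by move=> [y Iy py]; apply: k0P; exists y => //; apply: pw_le py.
  have [ndet' soc] := wiebe nR lR (@zeroid_ideal R)
    (fun a (za : zeroid a) => zeroid_sub lR za) mx xgen gM' rM'.
  have msoc y : mI y -> G (y * \det M').
    exact: (det_socle (@zeroid_ideal R) gM' xgen).
  have IG y : I y -> G y.
    move=> Iy; apply: contrapT => nGy.
    (* A multiple c y whose colon ideal is maximal: that ideal is a prime over G, hence the maximal
       ideal, and c y is in the socle. *)
    have [_ [[c ->] nw _ wmax]] := maxann_exists nR iG (P := fun w => exists c, w = c * y)
      (ex_intro _ 1 (esym (mul1r y))) nGy.
    have prw : primeI (fun a => G (a * (c * y))).
      split; [exact: ann_ideal|by rewrite mul1r|move=> a b].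
      case: (pselect (G (b * (c * y)))) => [|nGb]; first by right.
      move=> Gab; left; apply: (wmax (b * (c * y))) => //.
      - by exists (b * c); rewrite mulrA.
      - by move=> d Gd; rewrite mulrCA; apply: idealM.
      - by rewrite mulrA.
    have mw z : mI z -> G (z * (c * y)).
      apply: (regular_primary rM' prw) => z' Gz'; exact: idealRM.
    have [e Ge] := soc _ mw.
    have Ue : e \is a GRing.unit.
      apply: mI_nunit => me; apply: nw; apply: (ideal_trans iG Ge); exact: msoc.
    apply: nIk; apply: (ideal_trans (y := \det M') iIk).
      apply: plus_r => //; apply: ideal_sym => //.
    apply: (ideal_unit iIk Ue).
    have -> : e * \det M' = c * y - (c * y - e * \det M') by ring.
    by apply: idealB => //; [apply: plus_l => //; apply: idealM|apply: GIk].
  have /choice[E' EP] : forall i, exists c : 'I_N -> R, f i = \sum_j c j * g j.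
    move=> i; have /IG/gen_lin-/(_ (@zeroid_ideal R))[c /eqP] := IM i.
    by rewrite subr_eq0 => /eqP ->; exists c.
  pose E : 'M[R]_N := \matrix_(i, j) E' i j.
  have fE : f = lin E g.
    by apply: funext => i; rewrite EP; apply: eq_bigr => j _; rewrite mxE.
  (* If det E were a nonunit, det (E M') would be in G because det M' is in the socle; but it equals
     det M modulo G by [det_syzygyB]. *)
  have UE : E \in unitmx.
    rewrite unitmxE; apply: mI_nunit => mE; apply: nIk; apply: GIk.
    apply: (ideal_trans (y := \det (E *m M')) iG).
      by apply: det_syzygyB => // [i|]; [apply: IG|rewrite lin_mul].
    by rewrite det_mulmx; apply: msoc.
  apply: predeq => y; split; first exact: IG.
  apply: gen_min => // [z ->|]; first exact: ideal0.
  apply: fl_memP => i; have -> : g i = lin (invmx E) f i.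
    by rewrite fE -lin_mul mulVmx // lin1.
  exact: lin_ideal.
have [g [rg IE mg _]] := claim _ (leqnn _).
have [e eP] : exists e, forall i, I (x i ^+ e).
  have H i : exists n, I (x i ^+ n).
    apply: contrapT => nI.
    have [|a b [m ->] [n ->]|a [n ->] In|P [prP IP SP]] :=
      @prime_exists _ (fun a => exists n, a = x i ^+ n) I nR iI.
    - by exists 0%N.
    - by exists (m + n)%N; rewrite exprD.
    - by apply: nI; exists n.
    have := regular_primary rg prP; rewrite -IE => /(_ IP _ (mx i)).
    by apply: SP; exists 1%N.
  have [n nP] := choice H; exists (\max_i n i) => i.
  rewrite -(subnK (leq_bigmax i)) exprD; exact: idealM.
(* With k at least e the factor x_i^k is in I, so that h_i - f_i is in mI. *)
have [h [rh IEh mh hf]] := claim _ (leq_maxl k0 e).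
apply: (regular_exchange (g := h)) => //; first exact: zeroid_ideal.
move=> i; have [r ->] := hf i; apply: mulIM => //; apply: idealM => //.
by rewrite -(subnK (leq_maxr k0 e)) exprD; apply: idealM.
Qed.

End RegularParameters.
End SystemOfParameters.

(** * Translation of the stated definitions into ideals as predicates *)

Section Bridge.
Variable R : comNzRingType.
Implicit Types (I J : R -> Prop) (s : seq R).

Definition toI (P : {pred R}) : R -> Prop := fun x => x \in P.
Definition ofI I : {pred R} := [pred x | `[< I x >]].

Lemma ofIE I x : x \in ofI I <-> I x.
Proof. by rewrite inE; split=> /asboolP. Qed.

Lemma is_idealP (P : {pred R}) : is_ideal P <-> ideal (toI P).
Proof.
split=> [[P0 PD]|[P0 PD PM]].
  split=> //; first by move=> x y Px Py; have := PD 1 x y Px Py; rewrite scale1r.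
  by move=> a x Px; have := PD a x 0 Px P0; rewrite addr0.
by split=> // a x y Px Py; apply: PD => //; apply: PM.
Qed.

Lemma is_ideal_ofI I : ideal I -> is_ideal (ofI I).
Proof.
move=> iI; apply/is_idealP; suff -> : toI (ofI I) = I by [].
by apply: predeq => x; apply: ofIE.
Qed.

Lemma idealr_closedP (P : {pred R}) : idealr_closed P <-> ideal (toI P) /\ ~ toI P 1.
Proof.
split=> [[P0 P1 PD]|[[P0 PD PM] /negP P1]].
  split; last exact/negP.
  split=> //; first by move=> x y Px Py; have := PD 1 x y Px Py; rewrite mul1r.
  by move=> a x Px; have := PD a x 0 Px P0; rewrite addr0.
by split=> // a x y Px Py; apply: PD => //; apply: PM.
Qed.

Lemma prime_idealP (P : {pred R}) : prime_ideal P <-> primeI (toI P).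
Proof.
split=> [[/idealr_closedP[iP P1] PM]|[iP P1 PM]]; first by split=> // a b /PM/orP.
by split=> [|a b /PM/orP]; first exact/idealr_closedP.
Qed.

Lemma ideal_spanP s x : x \in ideal_span s <-> gen zeroid s x.
Proof.
rewrite genP; last exact: zeroid_ideal.
rewrite inE; split=> [/asboolP[c ->]|[c /eqP]].
  by exists c; rewrite /zeroid subrr.
by rewrite subr_eq0 => /eqP xE; apply/asboolP; exists c.
Qed.

Lemma noetherianP : noetherian R <-> noeth R.
Proof.
split=> H I iI.
  have [s sE] := H _ (is_ideal_ofI iI); exists s.
  by apply: predeq => x; rewrite -ideal_spanP -sE ofIE.
have [s sE] := H _ (iffLR (is_idealP I) iI); exists s => x.
by apply/idP/idP; rewrite ideal_spanP -sE.
Qed.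

Lemma ideal_mulP (I J : {pred R}) x : x \in ideal_mul I J <-> mulI (toI I) (toI J) x.
Proof.
rewrite inE; split=> [/asboolP[s [sP ->]]|H].
  elim: s sP => [|p s IH] sP; first by rewrite big_nil; apply: mulI0.
  rewrite big_cons; apply: mulID.
    by have [p1 p2] := sP p (mem_head _ _); apply: mulIM.
  by apply: IH => q qs; apply: sP; rewrite inE qs orbT.
apply/asboolP; elim: H => [|y z _ [s [sP ->]] _ [t [tP ->]]|a b Ia Jb].
- by exists [::]; rewrite big_nil; split.
- exists (s ++ t); rewrite big_cat; split=> // p.
  by rewrite mem_cat => /orP[/sP|/tP].
- by exists [:: (a, b)]; rewrite big_seq1; split=> // p; rewrite inE => /eqP ->.
Qed.

Lemma ideal_expP (I : {pred R}) n x : x \in ideal_exp I n <-> pw (toI I) n x.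
Proof.
elim: n x => [//|n IH] x /=; rewrite ideal_mulP.
have -> // : toI (ideal_exp I n) = pw (toI I) n.
by apply: predeq => y; apply: IH.
Qed.

Lemma regular_sequenceP s :
  regular_sequence s <-> reg zeroid s /\ ~ gen zeroid s 1.
Proof.
suff H : (forall i x, (i < size s)%N ->
     s`_i * x \in ideal_span (take i s) -> x \in ideal_span (take i s)) <-> reg zeroid s.
  rewrite /regular_sequence H; split=> -[rs s1]; split=> //.
    by move/ideal_spanP; apply/negP.
  by apply/negP => /ideal_spanP.
suff H J : reg J s <-> forall i x, (i < size s)%N ->
     gen J (take i s) (s`_i * x) -> gen J (take i s) x.
  rewrite H; split=> h i x ix; have := h i x ix; by rewrite ?ideal_spanP // => h1 /ideal_spanP/h1/ideal_spanP.
elim: s J => [|a s IH] J //=; rewrite IH; split=> [[Ja Js] [|i] x|h].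
- by move=> _; apply: Ja.
- by apply: Js.
- by split=> [x|i x]; [apply: (h 0%N)|apply: (h i.+1)].
Qed.

Lemma prime_chainP n : prime_chain R n <-> exists Q : nat -> R -> Prop, chainI Q n.
Proof.
split=> [[P [prP ltP]]|[Q [prQ ltQ]]].
  exists (fun i => toI (P i)); split=> i ni; first exact/prime_idealP/prP.
  have [PS /existsNP[x nx]] := ltP i ni; split=> [y|]; first exact: PS.
  by move/not_implyP: nx => [Px Qx]; exists x.
exists (fun i => ofI (Q i)).
have QE i : toI (ofI (Q i)) = Q i by apply: predeq => y; apply: ofIE.
split=> i ni; first by apply/prime_idealP; rewrite QE; apply: prQ.
have [QS [y Qy nQ]] := ltQ i ni; split=> [z|H].
  by rewrite !ofIE; apply: QS.
by apply: nQ; apply/ofIE/H/ofIE.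
Qed.

End Bridge.

Section LocalBridge.
Variable R : comUnitRingType.

Lemma max_idealP : toI (max_ideal R) = @mI R.
Proof. by apply: predeq. Qed.

(** Noetherianity puts a maximal ideal over the multiples of any nonunit, and by uniqueness it is
    the given one. *)
Lemma local_ideal : local_ring R -> noeth R -> ideal (@mI R).
Proof.
move=> [m [maxm um]] nR.
have [/idealr_closedP[im m1] mmax] := maxm.
have H x : mI x -> toI m x.
  move=> mx.
  pose F (I : R -> Prop) := ideal I /\ ~ I 1.
  have Fi I : F I -> ideal I by case.
  have F0 : F (adj zeroid x).
    split=> [|[r /eqP]]; first exact/adj_ideal/zeroid_ideal.
    rewrite subr_eq0 => /eqP r1; move: mx; rewrite /mI => /negP; apply.
    by apply/unitrPr; exists r; rewrite mulrC -r1.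
  have [M [[iM M1] xM Mmax]] := noeth_max nR Fi F0.
  have ME : toI (ofI M) = M by apply: predeq => y; apply: ofIE.
  have : maximal_ideal (ofI M).
    split; first by apply/idealr_closedP; rewrite ME.
    move=> J /idealr_closedP FJ MJ y yJ; apply/ofIE; apply: (Mmax _ FJ) => //.
    by move=> z Mz; apply: MJ; apply/ofIE.
  move/um => mE; rewrite /toI -mE; apply/ofIE/xM/adj_self; exact: zeroid_ideal.
suff -> : @mI R = toI m by [].
apply: predeq => x; split=> [/H//|mx]; apply/negP => Ux; apply: m1.
by rewrite -(mulVr Ux); apply: idealM.
Qed.

Lemma ideal_local : ideal (@mI R) -> local_ring R.
Proof.
move=> im; exists (max_ideal R); split.
  split; first by apply/idealr_closedP; split=> //; rewrite /toI inE unitr1.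
  move=> J /idealr_closedP[iJ J1] mJ x Jx; rewrite inE; exact: (proper_mI iJ J1 Jx).
move=> m' [/idealr_closedP[im' m'1] mmax].
have m'm : {subset m' <= max_ideal R} by move=> x Jx; rewrite inE; exact: (proper_mI im' m'1 Jx).
move=> x; apply/idP/idP; first exact: m'm.
by apply: mmax m'm x; apply/idealr_closedP; split=> //; rewrite /toI inE unitr1.
Qed.

Definition complete_sep :=
  (forall x : R, (forall n, pw (@mI R) n x) -> x = 0) /\
  (forall u : nat -> R, (forall n, pw (@mI R) n (u n.+1 - u n)) ->
     exists l, forall n, pw (@mI R) n (u n - l)).

Lemma complete_sepP : adic_complete (max_ideal R) <-> complete_sep.
Proof.
rewrite /adic_complete /complete_sep -max_idealP.
split=> -[sep lim]; split.
- by move=> x Hx; apply: sep => n; apply/ideal_expP.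
- move=> u Hu; have [|l Hl] := lim u; first by move=> n; apply/ideal_expP.
  by exists l => n; apply/ideal_expP.
- by move=> x Hx; apply: sep => n; apply/ideal_expP.
- move=> u Hu; have [|l Hl] := lim u; first by move=> n; apply/ideal_expP.
  by exists l => n; apply/ideal_expP.
Qed.

Definition cnl := [/\ ideal (@mI R), noeth R & complete_sep].

Lemma cnlP : complete_noetherian_local R <-> cnl.
Proof.
split=> [[lR /noetherianP nR /complete_sepP cR]|[lR nR cR]].
  by split=> //; apply: local_ideal.
by split; [apply: ideal_local|apply/noetherianP|apply/complete_sepP].
Qed.

(** The dimension is the length of s: [regular_chain] gives a chain of this length and
    [height_bound] excludes longer ones. *)
Lemma regular_localP (s : seq R) : ideal (@mI R) -> noeth R ->
  @mI R = gen zeroid s -> reg zeroid s -> regular_local_ring R.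
Proof.
move=> lR nR ms rs; split; [exact: ideal_local|exact/noetherianP|].
exists s; split.
  move=> x; have E : mI x <-> gen zeroid s x by rewrite ms.
  by apply/idP/idP => [mx|/ideal_spanP/E//]; apply/ideal_spanP/E.
apply/nat_sup_Some; split.
  apply/prime_chainP; have [|Q [cQ _ _]] :=
    regular_chain nR (@zeroid_ideal R) rs (mI_prime lR); first by rewrite ms.
  by exists Q.
move=> m /prime_chainP[Q cQ].
apply: (height_bound nR lR (@zeroid_ideal R) _ _ cQ).
- by rewrite ms.
- by move=> a as_; rewrite ms; apply: gen_in as_; apply: zeroid_ideal.
- by move=> x ->; have [/(_ 0%N isT)[iQ _ _] _] := cQ; apply: ideal0.
Qed.

(** The conclusion concerns all generating lists of minimal size, because the parameters will be
    changed to suit the map to the valuation ring. *)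
Lemma regular_local_reg : regular_local_ring R -> exists s,
  [/\ ideal (@mI R), noeth R, @mI R = gen zeroid s &
      forall t, size t = size s -> @mI R = gen zeroid t -> reg zeroid t].
Proof.
move=> [lR /noetherianP nR [s [ms dimR]]].
have {}lR := local_ideal lR nR.
have mE : @mI R = gen zeroid s.
  by apply: predeq => x; split=> [mx|/ideal_spanP]; [apply/ideal_spanP|]; rewrite -ms.
exists s; split=> // t ts tE.
have [/prime_chainP[Q cQ] _] := iffLR (nat_sup_Some _ _) dimR.
rewrite -ts in cQ.
have [|||//] := parameters_regular nR lR (@zeroid_ideal R) _ _ cQ.
- by rewrite tE.
- by move=> a as_; rewrite tE; apply: gen_in as_; apply: zeroid_ideal.
- by move=> x ->; have [/(_ 0%N isT)[iQ _ _] _] := cQ; apply: ideal0.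
Qed.

End LocalBridge.

(** * Power series rings *)

Section ClassicalUnits.
Variable R : comNzRingType.

Definition clunit : {pred R} := [pred x | `[< exists y, y * x = 1 >]].

(** The rings constructed below get their units classically. Outside the units the inverse is the
    identity, as the unit ring interface demands. *)
Definition clinv (x : R) : R :=
  if pselect (exists y, y * x = 1) is left e then projT1 (cid e) else x.

Fact clmulVx : {in clunit, left_inverse 1 clinv *%R}.
Proof.
move=> x; rewrite inE => /asboolP ex; rewrite /clinv.
by case: pselect => // e; case: cid.
Qed.

Fact clunitPl (x y : R) : y * x = 1 -> clunit x.
Proof. by move=> yx; apply/asboolP; exists y. Qed.

Fact clinv_out : {in [predC clunit], clinv =1 id}.
Proof.
move=> x; rewrite !inE => /asboolP ex; rewrite /clinv.
by case: pselect.
Qed.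

End ClassicalUnits.

Section RMorphismOf.
Variables (R S : nzRingType) (f : R -> S).
Hypotheses (fB : zmod_morphism f) (fM : monoid_morphism f).

(** A carrier for the instances, so that a function shown to be a ring morphism inside a proof can
    be bundled there. *)
Definition rmorphism_of := f.
HB.instance Definition _ := GRing.isZmodMorphism.Build R S rmorphism_of fB.
HB.instance Definition _ := GRing.isMonoidMorphism.Build R S rmorphism_of fM.

Lemma rmorphism_ex : exists g : {rmorphism R -> S}, g =1 f.
Proof. by exists rmorphism_of. Qed.

End RMorphismOf.

Record ps (S : comNzRingType) := Ps { pc : nat -> S }.

HB.instance Definition _ (S : comNzRingType) := gen_eqMixin (ps S).
HB.instance Definition _ (S : comNzRingType) := gen_choiceMixin (ps S).

Section PowerSeries.
Variable S : comNzRingType.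
Implicit Types (f g h : ps S) (n : nat).

Lemma ps_ext f g : (forall n, pc f n = pc g n) -> f = g.
Proof. by case: f g => [f] [g] /= fg; congr Ps; apply: funext. Qed.

Definition ps0 : ps S := Ps (fun=> 0).
Definition psadd f g := Ps (fun n => pc f n + pc g n).
Definition psopp f := Ps (fun n => - pc f n).
Definition ps1 : ps S := Ps (fun n => (n == 0%N)%:R).
Definition psmul f g := Ps (fun n => \sum_(i < n.+1) pc f i * pc g (n - i)%N).

Fact psaddA : associative psadd.
Proof. by move=> f g h; apply: ps_ext => n /=; rewrite addrA. Qed.
Fact psaddC : commutative psadd.
Proof. by move=> f g; apply: ps_ext => n /=; rewrite addrC. Qed.
Fact psadd0 : left_id ps0 psadd.
Proof. by move=> f; apply: ps_ext => n /=; rewrite add0r. Qed.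
Fact psaddN : left_inverse ps0 psopp psadd.
Proof. by move=> f; apply: ps_ext => n /=; rewrite addNr. Qed.
HB.instance Definition _ := GRing.isZmodule.Build (ps S) psaddA psaddC psadd0 psaddN.

Definition trunc n f : {poly S} := \poly_(i < n) pc f i.

Lemma trunc_coef n f i : (i < n)%N -> (trunc n f)`_i = pc f i.
Proof. by move=> lt; rewrite coef_poly lt. Qed.

(** Coefficients below n depend only on truncations; commutativity and associativity of the product
    are thus inherited from polynomials. *)
Lemma trunc_mul n f g i : (i < n)%N -> (trunc n f * trunc n g)`_i = pc (psmul f g) i.
Proof.
move=> lt; rewrite coefM /=; apply: eq_bigr => j _.
have ji : (j <= i)%N by rewrite -ltnS.
by rewrite !trunc_coef // (leq_ltn_trans _ lt) // leq_subr.
Qed.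

Fact psmulC : commutative psmul.
Proof.
by move=> f g; apply: ps_ext => n; rewrite -!(@trunc_mul n.+1) // mulrC.
Qed.

Fact psmulA : associative psmul.
Proof.
suff H f g h n : pc (psmul (psmul f g) h) n = (trunc n.+1 f * trunc n.+1 g * trunc n.+1 h)`_n.
  move=> f g h; apply: ps_ext => n; rewrite H psmulC H.
  by rewrite mulrC mulrA.
rewrite -(@trunc_mul n.+1) // !coefM; apply: eq_bigr => j _.
by rewrite trunc_coef // trunc_mul.
Qed.

Fact psmul1 : left_id ps1 psmul.
Proof.
move=> f; apply: ps_ext => n /=; rewrite big_ord_recl /= mul1r subn0 big1 ?addr0 //.
by move=> i _; rewrite mul0r.
Qed.

Fact psmulDl : left_distributive psmul psadd.
Proof.
move=> f g h; apply: ps_ext => n /=; rewrite -big_split.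
by apply: eq_bigr => i _; rewrite mulrDl.
Qed.

Fact ps1_neq0 : ps1 != 0.
Proof.
apply/eqP => /(congr1 (fun f => pc f 0)) /= /eqP.
by rewrite (negPf (oner_neq0 S)).
Qed.

HB.instance Definition _ := GRing.Zmodule_isComNzRing.Build (ps S)
  psmulA psmulC psmul1 psmulDl ps1_neq0.

HB.instance Definition _ := GRing.ComNzRing_hasMulInverse.Build (ps S)
  (@clmulVx _) (@clunitPl _) (@clinv_out _).

Lemma pc1 n : pc 1 n = (n == 0%N)%:R :> S. Proof. by []. Qed.
Lemma pcD f g n : pc (f + g) n = pc f n + pc g n. Proof. by []. Qed.
Lemma pcB f g n : pc (f - g) n = pc f n - pc g n. Proof. by []. Qed.
Lemma pcM f g n : pc (f * g) n = \sum_(i < n.+1) pc f i * pc g (n - i)%N.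
Proof. by []. Qed.
Lemma pcM0 f g : pc (f * g) 0 = pc f 0 * pc g 0.
Proof. by rewrite pcM big_ord_recl big_ord0 addr0. Qed.

Lemma pc_sum (T : Type) (r : seq T) (P : pred T) (F : T -> ps S) n :
  pc (\sum_(i <- r | P i) F i) n = \sum_(i <- r | P i) pc (F i) n.
Proof. by apply: (big_morph (fun f => pc f n)) => // f g; rewrite pcD. Qed.

Definition psC (c : S) : ps S := Ps (fun n => if n == 0%N then c else 0).
Definition psX : ps S := Ps (fun n => (n == 1%N)%:R).
Definition pstl f : ps S := Ps (fun n => pc f n.+1).
Definition psdrop n f : ps S := Ps (fun i => pc f (n + i)%N).

Lemma pcCM c f n : pc (psC c * f) n = c * pc f n.
Proof.
by rewrite pcM big_ord_recl /= subn0 big1 ?addr0 // => i _; rewrite mul0r.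
Qed.

Lemma pcXM f n : pc (psX * f) n = if n is n'.+1 then pc f n' else 0.
Proof.
rewrite pcM big_ord_recl /= mul0r add0r; case: n => [|n]; first by rewrite big_ord0.
rewrite big_ord_recl /= mul1r subn1 big1 ?addr0 // => i _.
by rewrite mul0r.
Qed.

Lemma pcXnM f k n : pc (psX ^+ k * f) n = if (k <= n)%N then pc f (n - k) else 0.
Proof.
elim: k n => [|k IH] n; first by rewrite expr0 mul1r subn0.
by rewrite exprS -mulrA pcXM; case: n => // n; rewrite IH.
Qed.

Lemma psC_zmod : zmod_morphism psC.
Proof. by move=> a b; apply: ps_ext => -[|n] /=; rewrite ?subr0. Qed.

Lemma psC_monoid : monoid_morphism psC.
Proof.
split=> [|a b]; apply: ps_ext => n; first by case: n.
by rewrite pcCM /=; case: n => //= n; rewrite mulr0.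
Qed.
HB.instance Definition _ := GRing.isZmodMorphism.Build S (ps S) psC psC_zmod.
HB.instance Definition _ := GRing.isMonoidMorphism.Build S (ps S) psC psC_monoid.

Lemma ps_split k f : f = \sum_(i < k) psC (pc f i) * psX ^+ i + psX ^+ k * psdrop k f.
Proof.
apply: ps_ext => n; rewrite pcD pc_sum pcXnM.
have XE i : pc (psX ^+ i) n = (n == i)%:R.
  rewrite -[_ ^+ i]mulr1 pcXnM pc1 subn_eq0 eqn_leq.
  by case: (i <= n)%N; rewrite ?andbT ?andbF.
under eq_bigr do rewrite pcCM XE.
case: leqP => kn /=.
  rewrite subnKC // big1 ?add0r // => i _.
  by rewrite gtn_eqF ?mulr0 //; apply: leq_trans kn.
rewrite addr0 (bigD1 (Ordinal kn)) //= eqxx mulr1 big1 ?addr0 // => i.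
by rewrite -val_eqE /= eq_sym => /negPf ->; rewrite mulr0.
Qed.

Definition ord k f := forall i, (i < k)%N -> pc f i = 0.

Lemma ord_ideal k : ideal (ord k).
Proof.
split=> [i//|f g of_ og i ik|f g og i ik]; first by rewrite pcD of_ // og // addr0.
rewrite pcM big1 // => j _; rewrite og ?mulr0 //.
by apply: leq_ltn_trans ik; apply: leq_subr.
Qed.

Lemma ord_drop k f : ord k f -> f = psX ^+ k * psdrop k f.
Proof.
move=> of_; rewrite {1}(ps_split k f) big1 ?add0r // => i _.
by rewrite of_ // rmorph0 mul0r.
Qed.

Lemma ordXn k f : ord k (psX ^+ k * f).
Proof. by move=> i ik; rewrite pcXnM leqNgt ik. Qed.

Lemma ord_mul k l f g : ord k f -> ord l g -> ord (k + l) (f * g).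
Proof.
move=> /ord_drop -> /ord_drop ->; rewrite mulrACA -exprD; exact: ordXn.
Qed.

Lemma ord_le k l f : (k <= l)%N -> ord l f -> ord k f.
Proof. by move=> kl of_ i ik; apply: of_; apply: leq_trans kl. Qed.

Lemma ord_eq0 f : (forall k, ord k f) -> f = 0.
Proof. by move=> of_; apply: ps_ext => n; apply: (of_ n.+1). Qed.

(** The infinite sum of the F i when F i has order at least i: only terms with i <= n reach
    coefficient n. *)
Definition psum (F : nat -> ps S) : ps S := Ps (fun n => \sum_(i < n.+1) pc (F i) n).

Lemma psumP F n : (forall i, ord i (F i)) -> ord n (psum F - \sum_(i < n) F i).
Proof.
move=> oF i lt; rewrite pcB pc_sum /=; apply/eqP; rewrite subr_eq0; apply/eqP.
rewrite (big_ord_widen _ (fun j => pc (F j) i) lt) big_mkcond.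
by apply: eq_bigr => j _; case: ltnP => //; rewrite ltnNge => ij; rewrite oF // ltnNge.
Qed.

Lemma ps_unitP f : (f \is a GRing.unit) <-> exists y, y * f = 1.
Proof. by split=> [Uf|[y yf]]; [exists f^-1; rewrite mulVr|apply/asboolP; exists y]. Qed.

End PowerSeries.

Section PowerSeriesUnits.
Variable S : comUnitRingType.
Implicit Types (f g h : ps S) (n : nat).

(** If the constant term c is invertible, f = c (1 - h) with h of order at least one, and the
    geometric series of h inverts 1 - h. *)
Lemma ps_unit f : (f \is a GRing.unit) = (pc f 0 \is a GRing.unit).
Proof.
apply/idP/idP => [Uf|U0].
  apply/unitrPr; exists (pc f^-1 0); rewrite -pcM0 mulrV //.
pose h := 1 - psC (pc f 0)^-1 * f.
have oh : ord 1 h by case=> // _; rewrite pcB pcCM mulVr // subrr.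
have ohn n : ord n (h ^+ n).
  elim: n => [|n IH] //; rewrite exprS -add1n; exact: ord_mul.
apply/ps_unitP; exists (psum (fun n => h ^+ n) * psC (pc f 0)^-1).
rewrite -mulrA; have -> : psC (pc f 0)^-1 * f = 1 - h by rewrite /h subKr.
apply/eqP; rewrite -subr_eq0; apply/eqP/ord_eq0 => n.
have oi := @ord_ideal S n.
have -> : psum (fun n => h ^+ n) * (1 - h) - 1 =
  (psum (fun n => h ^+ n) - \sum_(i < n) h ^+ i) * (1 - h) - h ^+ n.
  have E : (\sum_(i < n) h ^+ i) * (1 - h) = 1 - h ^+ n.
    rewrite -{2}(expr1n _ n) subrXX mulrC; congr (_ * _).
    by apply: eq_bigr => i _; rewrite expr1n mul1r.
  by rewrite mulrBl E; ring.
apply: (idealB oi) => //; apply: (idealRM _ oi); exact: psumP.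
Qed.

Lemma mI_ps f : mI f <-> mI (pc f 0).
Proof. by rewrite /mI ps_unit. Qed.

Hypotheses (lS : ideal (@mI S)).

Lemma ps_local : ideal (@mI (ps S)).
Proof.
split=> [|f g /mI_ps mf /mI_ps mg|f g /mI_ps mg]; apply/mI_ps.
- exact: ideal0.
- exact: idealD.
- by rewrite pcM0; apply: idealM.
Qed.

Lemma ps_mI_gen s : @mI S = gen zeroid s ->
  @mI (ps S) = gen zeroid (psX S :: [seq psC c | c <- s]).
Proof.
move=> ms; have iz := @zeroid_ideal (ps S).
apply: predeq => f; split; last first.
  apply: gen_min; [exact: ps_local|by move=> x ->; apply: ideal0 ps_local|].
  move=> a; rewrite inE => /orP[/eqP ->|/mapP[c cs ->]]; apply/mI_ps => /=.
    exact: ideal0.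
  by rewrite ms; apply: gen_in cs; apply: zeroid_ideal.
move=> /mI_ps; rewrite ms => f0.
have iG := gen_ideal (psX S :: [seq psC c | c <- s]) iz.
rewrite (ps_split 1 f) big_ord_recl big_ord0 expr0 expr1 mulr1 addr0.
apply: (idealD iG); last first.
  by apply: (idealRM _ iG); apply: gen_in => //; rewrite mem_head.
have iC : ideal (fun c : S => gen zeroid (psX S :: [seq psC c | c <- s]) (psC c)).
  split=> [|a b Ga Gb|a b Gb]; first by rewrite rmorph0; apply: ideal0 iG.
    by rewrite rmorphD; apply: (idealD iG).
  by rewrite rmorphM; apply: (idealM iG).
apply: (gen_min iC _ _ f0) => [x ->|a as_]; first exact: ideal0 iC.
by apply: gen_in => //; rewrite inE map_f ?orbT.
Qed.

(** Modulo X everything is tested on constant coefficients, where the constants of s behave as s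
    does in S. *)
Lemma ps_reg s : reg zeroid s -> reg zeroid (psX S :: [seq psC c | c <- s]).
Proof.
move=> rs; split.
  move=> f Xf; apply: ps_ext => n; have := congr1 (fun f => pc f n.+1) Xf.
  by rewrite pcXM.
suff H (J : S -> Prop) : ideal J -> reg J s -> reg (fun f => J (pc f 0)) [seq psC c | c <- s].
  have -> : adj zeroid (psX S) = fun f => zeroid (pc f 0); last exact: H (@zeroid_ideal S) rs.
  apply: predeq => f; split=> [[r /eqP]|f0].
    by rewrite subr_eq0 => /eqP ->; rewrite /zeroid pcM0 mulr0.
  exists (pstl f); apply/eqP; rewrite subr_eq0; apply/eqP/ps_ext => n.
  by rewrite mulrC pcXM; case: n.
elim: s J {rs} => [|a s IH] J iJ //= [Ja Js]; split.
  by move=> f; rewrite pcCM => /Ja.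
have -> : adj (fun f => J (pc f 0)) (psC a) = fun f => adj J a (pc f 0).
  apply: predeq => f; split=> [[r]|[r Jr]].
    by rewrite pcB mulrC pcCM mulrC; exists (pc r 0).
  by exists (psC r); rewrite pcB pcCM.
by apply: IH => //; apply: adj_ideal.
Qed.

(** The variable counts for one factor of the maximal ideal. This reduces completeness of power
    series to that of S, coefficient by coefficient. *)
Lemma pw_ps n f : pw (@mI (ps S)) n f <->
  forall i, (i < n)%N -> pw (@mI S) (n - i) (pc f i).
Proof.
have lP := ps_local; split.
  elim: n f => [|n IH] f //; elim=> [|g h _ IHg _ IHh|a b ma pb] i lt.
  - exact: ideal0 (pw_ideal _ lS).
  - by apply: (idealD (pw_ideal _ lS)); [apply: IHg|apply: IHh].
  rewrite pcM; apply: ideal_sum => [|j _]; first exact: pw_ideal.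
  have ji : (j <= i)%N by rewrite -ltnS.
  case: (posnP j) => [->|j0].
    rewrite subn0 subSn //; case: (ltnP i n) => ni.
      by apply: (mulIM (R := S)); [apply/mI_ps|apply: IH].
    have -> : (n - i)%N = 0%N by apply/eqP; rewrite subn_eq0.
    by apply: (mulIM (R := S)) => //; apply/mI_ps.
  apply: (idealM (pw_ideal _ lS)).
  have lt' : (i - j < n)%N.
    by lia.
  by apply: (pw_le lS _ (IH _ pb _ lt')); lia.
move=> H; have iP := pw_ideal n lP.
have XnP i : pw (@mI (ps S)) i (psX S ^+ i).
  by apply: pwX; apply/mI_ps; apply: ideal0.
rewrite (ps_split n f); apply: (idealD iP); last exact: (idealRM _ iP).
apply: (ideal_sum _ iP) => i _.
apply: (pw_le lP (_ : (n <= n - i + i)%N)); first by rewrite subnK // ltnW.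
apply: pwM => //.
have := H i (ltn_ord i); elim: (n - i)%N (pc f i) => // k IH c.
elim=> [|x y _ Hx _ Hy|a b ma pb].
- by rewrite rmorph0; apply: mulI0.
- by rewrite rmorphD; apply: mulID.
- by rewrite rmorphM; apply: mulIM; [apply/mI_ps|apply: IH].
Qed.

Lemma ps_complete : complete_sep S -> complete_sep (ps S).
Proof.
move=> [sep lim]; split=> [f Hf|u Hu].
  apply: ps_ext => i; apply: sep => n.
  have /pw_ps-/(_ i) := Hf (n.+1 + i)%N; rewrite addnK => H.
  by apply: (pwS lS); apply: H; rewrite addSn ltnS leq_addl.
(* The shift by i compensates the weight of X^i: coefficient i of u_(n+i) is Cauchy with modulus
   n. *)
have /choice[l lP] : forall i, exists l, forall n, pw (@mI S) n (pc (u (n + i)%N) i - l).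
  move=> i; apply: lim => n; rewrite addSn -pcB.
  have /pw_ps H := Hu (n + i)%N.
  case: n H => // n H; have := H i; rewrite addnK; apply.
  by rewrite addSn ltnS leq_addl.
exists (Ps l) => n; apply/pw_ps => i lt.
by have := lP i (n - i)%N; rewrite subnK // ltnW.
Qed.

Hypothesis nS : noeth S.

(** Hilbert's basis argument with lowest coefficients. The ideals L k of coefficients at X^k of
    members of I of order at least k increase, and are constant from some K on. Below K each order
    adds finitely many generators; from K on division never stops, and the quotients assemble to
    power series. *)
Lemma ps_noeth : noeth (ps S).
Proof.
move=> I iI; have iz := @zeroid_ideal (ps S).
pose L k c := exists f, [/\ I f, ord k f & pc f k = c].
have iL k : ideal (L k).
  have ok := @ord_ideal S k.
  split=> [|c d [f [If of_ fk]] [g [Ig og gk]]|a c [f [If of_ fk]]].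
  - by exists 0; split=> //; apply: (ideal0 iI).
  - by exists (f + g); split; [apply: (idealD iI)|apply: (idealD ok)|rewrite pcD fk gk].
  - by exists (psC a * f); split; [apply: (idealM iI)|apply: (idealM ok)|rewrite pcCM fk].
have LS k l c : (k <= l)%N -> L k c -> L l c.
  move=> /subnK <-; elim: (l - k)%N => // j IH /IH[f [If of_ fk]].
  rewrite addSn; exists (psX S * f); split; first exact: idealM.
    by rewrite -(expr1 (psX S)) -[(j + k).+1]add1n; apply: ord_mul of_; rewrite expr1 -[psX S]mulr1 -(expr1 (psX S)); apply: ordXn.
  by rewrite pcXM.
have [M [[K ->] _ Kmax]] := @noeth_max S (fun M => exists k, M = L k) (L 0%N) nS
  (fun M '(ex_intro k e) => eq_ind_r (@ideal S) (iL k) e) (ex_intro _ 0%N erefl).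
have LK k c : L k c -> L K c.
  move=> Lc; apply: (Kmax (L (maxn k K))); first by exists (maxn k K).
    by move=> x; apply: LS; apply: leq_maxr.
  by apply: LS Lc; apply: leq_maxl.
have lift k : exists r (g : 'I_r -> ps S), (forall j, I (g j) /\ ord k (g j)) /\
    forall c, L k c -> exists b : 'I_r -> S, c = \sum_j b j * pc (g j) k.
  have [t tE] := nS (iL k).
  have /choice[g gP] : forall j : 'I_(size t), exists f, [/\ I f, ord k f & pc f k = t`_j].
    move=> j; have : gen zeroid t t`_j by apply: gen_in; [exact: zeroid_ideal|exact: mem_nth].
    by rewrite -tE.
  exists (size t), g; split=> [j|c]; first by case: (gP j).
  rewrite tE genP; last exact: zeroid_ideal.
  move=> [b /eqP]; rewrite subr_eq0 => /eqP ->; exists b.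
  by apply: eq_bigr => j _; case: (gP j) => _ _ ->.
have step k f r (g : 'I_r -> ps S) (b : 'I_r -> S) : I f -> ord k f ->
    (forall j, I (g j) /\ ord k (g j)) -> pc f k = \sum_j b j * pc (g j) k ->
    I (f - \sum_j psC (b j) * g j) /\ ord k.+1 (f - \sum_j psC (b j) * g j).
  move=> If of_ gP fk; split.
    by apply: (idealB iI) => //; apply: (ideal_sum _ iI) => j _; apply: (idealM iI); case: (gP j).
  move=> i; rewrite ltnS leq_eqVlt pcB pc_sum => /orP[/eqP ->|ik].
    by under eq_bigr do rewrite pcCM; rewrite fk subrr.
  rewrite of_ // big1 ?subr0 // => j _; rewrite pcCM.
  by have [_ ->] := gP j; rewrite ?mulr0.
pose P k := exists s, (forall a, a \in s -> I a) /\
  forall f, I f -> ord k f -> gen zeroid s f.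
suff [s [sI sP]] : P 0%N.
  exists s; apply: predeq => f; split=> [If|]; first exact: sP.
  by apply: gen_min => // x ->; apply: ideal0.
suff PK : P K.
  suff P0 k : P k -> P 0%N by exact: P0 PK.
  elim: k => // k IH [s [sI sP]]; apply: IH.
  have [r [g [gP gL]]] := lift k.
  exists (s ++ fl g); split=> [a|f If of_].
    rewrite mem_cat => /orP[/sI//|]; move: a; apply: fl_memP => j; by case: (gP j).
  have [|b bE] := gL (pc f k); first by exists f.
  have [If' of'] := step k f r g b If of_ gP bE.
  have iG := gen_ideal (s ++ fl g) iz.
  apply: (ideal_trans (y := \sum_j psC (b j) * g j) iG).
    by rewrite gen_cat; apply: gen_sub; apply: sP.
  apply: (ideal_sum _ iG) => j _; apply: (idealM iG); apply: gen_in => //.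
  by rewrite mem_cat fl_mem orbT.
have [r [g [gP gL]]] := lift K.
(* One division step at order K + n, by the generators of order K shifted by X^n. *)
have /choice[B BP] : forall nf : nat * ps S, exists b : 'I_r -> S,
    I nf.2 -> ord (K + nf.1) nf.2 ->
    let f' := nf.2 - psX S ^+ nf.1 * \sum_j psC (b j) * g j in
    I f' /\ ord (K + nf.1).+1 f'.
  move=> [n f] /=; have [[If of_]|nf] := pselect (I f /\ ord (K + n) f); last first.
    by exists (fun=> 0) => If of_; case: nf.
  have [|b bE] := gL (pc f (K + n)); first by apply: (LK (K + n)%N); exists f.
  exists b => _ _.
  have [||] := step (K + n)%N f r (fun j => psX S ^+ n * g j) b If of_.
  - move=> j; have [Ig og] := gP j; split; first exact: idealM.
    by rewrite addnC; apply: ord_mul og; rewrite -[_ ^+ n]mulr1; apply: ordXn.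
  - by rewrite bE; apply: eq_bigr => j _; rewrite pcXnM leq_addl addnK.
  suff -> : \sum_j psC (b j) * (psX S ^+ n * g j) = psX S ^+ n * \sum_j psC (b j) * g j by [].
  by rewrite mulr_sumr; apply: eq_bigr => j _; rewrite mulrCA.
exists (fl g); split=> [|f If of_]; first by apply: fl_memP => j; case: (gP j).
pose F := fix F n := if n is n'.+1 then
  F n' - psX S ^+ n' * \sum_j psC (B (n', F n') j) * g j else f.
have FP n : I (F n) /\ ord (K + n) (F n).
  elim: n => [|n [IF oF]]; first by rewrite addn0.
  by rewrite addnS; apply: (BP (n, F n)).
(* The quotients: the coefficient at X^n is the one chosen in step n. *)
pose h j : ps S := Ps (fun n => B (n, F n) j).
apply/(gen_lin _ _ iz); exists h; apply: ord_eq0 => n.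
have on := @ord_ideal S n.
have fF : f - F n = \sum_j (\sum_(i < n) psC (B (i : nat, F i) j) * psX S ^+ i) * g j.
  elim: n {on} => [|n IH] /=.
    by rewrite subrr big1 // => j _; rewrite big_ord0 mul0r.
  rewrite opprB addrCA IH mulr_sumr -big_split; apply: eq_bigr => j _ /=.
  by rewrite big_ord_recr mulrDl /= addrC mulrA [psX S ^+ n * _]mulrC.
have -> : f - \sum_j h j * g j = F n + \sum_j
   (\sum_(i < n) psC (B (i : nat, F i) j) * psX S ^+ i - h j) * g j.
  under [in RHS]eq_bigr do rewrite mulrBl.
  by rewrite sumrB -fF addrA addrCA subrr addr0.
apply: (idealD on).
  by apply: (ord_le (l := (K + n)%N)); [apply: leq_addl|case: (FP n)].
apply: (ideal_sum _ on) => j _; apply: (idealRM _ on).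
by rewrite (ps_split n (h j)) opprD addrA subrr sub0r; apply: (idealN on); apply: ordXn.
Qed.

End PowerSeriesUnits.

(** * Surjections from complete regular local rings *)

Section Covers.
Variable A : comUnitRingType.
Hypothesis cA : cnl A.

Let lA : ideal (@mI A). Proof. by case: cA. Qed.

Let pwA n : ideal (pw (@mI A) n). Proof. exact: pw_ideal. Qed.

Lemma cnl_lim_uniq (u : nat -> A) l l' : (forall n, pw (@mI A) n (u n - l)) ->
  (forall n, pw (@mI A) n (u n - l')) -> l = l'.
Proof.
case: cA => _ _ [sep _] ul ul'; apply/eqP; rewrite -subr_eq0; apply/eqP/sep => n.
have -> : l - l' = (u n - l') - (u n - l) by ring.
exact: (idealB (pwA n)).
Qed.

(** Maps that respect the operations only modulo growing powers of the maximal ideal converge to a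
    morphism. Evaluation of power series and the map from the Cohen ring to A are both of this
    kind. *)
Lemma cnl_rmorphism_lim (T : nzRingType) (e : nat -> T -> A) :
  (forall n x, pw (@mI A) n (e n.+1 x - e n x)) ->
  (forall n x y, pw (@mI A) n (e n (x - y) - (e n x - e n y))) ->
  (forall n x y, pw (@mI A) n (e n (x * y) - e n x * e n y)) ->
  (forall n, pw (@mI A) n (e n 1 - 1)) ->
  exists phi : {rmorphism T -> A}, forall x n, pw (@mI A) n (e n x - phi x).
Proof.
move=> eS eB eM e1; have [_ _ [_ lim]] := cA.
have /choice[f fP] : forall x, exists l, forall n, pw (@mI A) n (e n x - l).
  by move=> x; apply: lim.
have fB : zmod_morphism f.
  move=> x y; apply: (cnl_lim_uniq (fP _)) => n.
  have -> : e n (x - y) - (f x - f y) = (e n (x - y) - (e n x - e n y))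
    + ((e n x - f x) - (e n y - f y)) by ring.
  by apply: (idealD (pwA n)) => //; apply: (idealB (pwA n)).
have fM : monoid_morphism f.
  split; first exact: (cnl_lim_uniq (fP _)).
  move=> x y; apply: (cnl_lim_uniq (fP _)) => n.
  have -> : e n (x * y) - f x * f y = (e n (x * y) - e n x * e n y)
    + ((e n x - f x) * e n y + f x * (e n y - f y)) by ring.
  apply: (idealD (pwA n)) => //; apply: (idealD (pwA n)).
    exact: (idealRM _ (pwA n)).
  exact: (idealM (pwA n)).
have [g gf] := rmorphism_ex fB fM; exists g => x n.
by rewrite gf.
Qed.

(** The partial sums are values of truncations at a. The product of truncations differs from the
    truncated product only in degrees at least n, where a^i is in m^n. *)
Lemma ps_eval (S : comUnitRingType) (phi : {rmorphism S -> A}) a :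
  (forall c, mI c -> mI (phi c)) -> mI a ->
  exists psi : {rmorphism ps S -> A},
    [/\ forall c, psi (psC c) = phi c, psi (psX S) = a & forall f, mI f -> mI (psi f)].
Proof.
move=> mphi ma.
pose e n (f : ps S) := \sum_(i < n) phi (pc f i) * a ^+ i.
have anA n : pw (@mI A) n (a ^+ n) by apply: pwX.
have eE n f : e n f = (map_poly phi (trunc n f)).[a].
  rewrite (horner_coef_wide (n := n)); last first.
    by apply: leq_trans (size_poly _ _) _; apply: size_poly.
  by apply: eq_bigr => i _; rewrite coef_map /= trunc_coef.
have [|||n|psi psiP] := @cnl_rmorphism_lim (ps S) e.
- move=> n f; rewrite /e big_ord_recr /= addrAC subrr add0r; exact: (idealM (pwA n)).
- move=> n f g; rewrite /e -sumrB; under eq_bigr do rewrite pcB rmorphB mulrBl.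
  by rewrite subrr; apply: (ideal0 (pwA n)).
- move=> n f g; rewrite !eE -hornerM -rmorphM -hornerN -hornerD -rmorphB /=.
  rewrite horner_coef; apply: (ideal_sum _ (pwA n)) => i _; rewrite coef_map /=.
  case: (ltnP i n) => lt; last by apply: (idealM (pwA n)); apply: pw_le (anA _).
  rewrite coefB trunc_mul // trunc_coef // subrr rmorph0 mul0r.
  exact: (ideal0 (pwA n)).
- case: n => // n; rewrite /e big_ord_recl /= rmorph1 mulr1 big1 ?addr0 ?subrr.
    exact: (ideal0 (pwA n.+1)).
  by move=> i _; rewrite /= rmorph0 mul0r.
exists psi; split.
- move=> c; apply: (cnl_lim_uniq (psiP _)) => -[|n] //.
  rewrite /e big_ord_recl /= mulr1 big1 ?addr0 ?subrr; first exact: (ideal0 (pwA n.+1)).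
  by move=> i _; rewrite rmorph0 mul0r.
- apply: (cnl_lim_uniq (psiP _)) => n; rewrite /e; case: n => [|[|n]] //.
    rewrite big_ord_recl big_ord0 /= rmorph0 mul0r addr0 sub0r.
    by apply: (idealN (pwA 1)); apply/pw1.
  rewrite big_ord_recl /= rmorph0 mul0r add0r big_ord_recl /= rmorph1 mul1r expr1.
  rewrite big1 ?addr0 ?subrr; first exact: (ideal0 (pwA n.+2)).
  by move=> i _; rewrite rmorph0 mul0r.
move=> f /mI_ps mf; have := psiP f 1%N.
rewrite /e big_ord_recl big_ord0 /= mulr1 addr0 => /(pw1 _ lA) H.
have -> : psi f = phi (pc f 0) - (phi (pc f 0) - psi f) by rewrite subKr.
by apply: (idealB lA) => //; apply: mphi.
Qed.

(** A complete local ring with a regular sequence of parameters and a local morphism to A,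
    surjective only after variables have been adjoined. *)
Definition cover (S : comUnitRingType) (phi : {rmorphism S -> A}) (s : seq S) :=
  [/\ cnl S, @mI S = gen zeroid s, reg zeroid s & forall c, mI c -> mI (phi c)].

Lemma cover_adjoin (S : comUnitRingType) (phi : {rmorphism S -> A}) s (t : seq A) :
  cover phi s -> (forall a, a \in t -> mI a) ->
  exists (S' : comUnitRingType) (phi' : {rmorphism S' -> A}) s',
  [/\ cover phi' s', forall c, exists c', phi' c' = phi c &
      forall a, a \in t -> exists2 c, mI c & phi' c = a].
Proof.
(* The added clause carries nonunits through the induction, so that the images of variables adjoined
   earlier are kept. *)
move=> cS mt; suff [S' [phi' [s' [cS' _ Spt tP]]]] :
  exists (S' : comUnitRingType) (phi' : {rmorphism S' -> A}) s',
  [/\ cover phi' s', forall c, mI c -> exists2 c', mI c' & phi' c' = phi c,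
    forall c, exists c', phi' c' = phi c &
      forall a, a \in t -> exists2 c, mI c & phi' c = a] by exists S', phi', s'.
elim: t S phi s cS mt => [|a t IH] S phi s cS mt.
  by exists S, phi, s; split=> // c; exists c.
have [[lS nS compS] ms rs mphi] := cS.
have [psi [psiC psiX mpsi]] := ps_eval mphi (mt _ (mem_head _ _)).
have cP : cover psi (psX S :: [seq psC c | c <- s]).
  split=> //; last first; first exact: ps_reg.
    exact: ps_mI_gen.
  by split; [apply: ps_local|apply: ps_noeth|apply: ps_complete].
have [|S' [phi' [s' [cS' mS' sS' tS']]]] := IH (ps S) psi _ cP.
  by move=> b bt; apply: mt; rewrite inE bt orbT.
exists S', phi', s'; split=> //.
- move=> c mc; have [|c' mc' ce] := mS' (psC c); first exact/mI_ps.
  by exists c'; rewrite // ce psiC.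
- by move=> c; have [c' ce] := sS' (psC c); exists c'; rewrite ce psiC.
move=> b; rewrite inE => /orP[/eqP ->|/tS'//].
have [|c mc ce] := mS' (psX S); first by apply/mI_ps; apply: (ideal0 lS).
by exists c; rewrite // ce.
Qed.

(** Successive approximation: once residues and generators of the maximal ideal are hit, any element
    of m^n is an image from the n-th power in S modulo m^(n+1), and the corrections sum up in the
    complete ring S. *)
Lemma cover_surj (S : comUnitRingType) (phi : {rmorphism S -> A}) (t : seq A) :
  cnl S -> (forall c, mI c -> mI (phi c)) -> @mI A = gen zeroid t ->
  (forall a, a \in t -> exists2 c, mI c & phi c = a) ->
  (forall a, exists c, mI (a - phi c)) -> forall a, exists c, phi c = a.
Proof.
move=> [lS nS [_ limS]] mphi mt tP res.
have pwphi n c : pw (@mI S) n c -> pw (@mI A) n (phi c).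
  elim: n c => // n IH c; elim=> [|x y _ Hx _ Hy|x y mx py].
  - by rewrite rmorph0; apply: mulI0.
  - by rewrite rmorphD; apply: mulID.
  - by rewrite rmorphM; apply: mulIM; [apply: mphi|apply: IH].
have m2 x : mI x -> exists2 c, mI c & pw (@mI A) 2 (x - phi c).
  have iK : ideal (fun x => exists2 c, mI c & pw (@mI A) 2 (x - phi c)).
    split=> [|x1 x2 [c1 m1 p1] [c2 m2 p2]|b y [c mc pc]].
    - by exists 0; [apply: ideal0|rewrite rmorph0 subrr; apply: (ideal0 (pwA 2))].
    - exists (c1 + c2); first exact: idealD.
      by rewrite rmorphD opprD addrACA; apply: (idealD (pwA 2)).
    - have [d md] := res b; exists (d * c); first exact: idealM.
      have -> : b * y - phi (d * c) = (b - phi d) * phi c + b * (y - phi c).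
        by rewrite rmorphM; ring.
      apply: (idealD (pwA 2)); last exact: (idealM (pwA 2)).
      by apply: mulIM => //; apply/(pw1 _ lA); apply: mphi.
  move=> mx; have Gx : gen zeroid t x by rewrite -mt.
  apply: (gen_min iK _ _ Gx) => [y ->|a /tP[c mc <-]]; first exact: ideal0 iK.
  by exists c => //; rewrite subrr; apply: (ideal0 (pwA 2)).
have step n a : pw (@mI A) n a -> exists2 c, pw (@mI S) n c & pw (@mI A) n.+1 (a - phi c).
  elim: n a => [|n IH] a.
    by move=> _; have [c mc] := res a; exists c => //; apply/(pw1 _ lA).
  elim=> [|x y _ [c pc qc] _ [d pd qd]|x y mx py].
  - exists 0; first exact: mulI0.
    by rewrite rmorph0 subrr; apply: (ideal0 (pwA n.+2)).
  - exists (c + d); first exact: mulID.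
    by rewrite rmorphD opprD addrACA; apply: (idealD (pwA n.+2)).
  - have [c mc pc] := m2 _ mx; have [d pd qd] := IH _ py.
    exists (c * d); first exact: mulIM.
    have -> : x * y - phi (c * d) = x * (y - phi d) + (x - phi c) * phi d.
      by rewrite rmorphM; ring.
    apply: (idealD (pwA n.+2)); first exact: mulIM.
    by rewrite -add2n; apply: pwM => //; apply: pwphi.
move=> a; have [_ _ [sepA _]] := cA.
have /choice[g gP] : forall na : nat * A, exists c, pw (@mI A) na.1 na.2 ->
    pw (@mI S) na.1 c /\ pw (@mI A) na.1.+1 (na.2 - phi c).
  move=> [n b]; have [|nb] := pselect (pw (@mI A) n b); last by exists 0.
  by move=> /step[c pc qc]; exists c.
pose u := fix u n := if n is n'.+1 then u n' + g (n', a - phi (u n')) else 0.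
have uP n : pw (@mI A) n (a - phi (u n)).
  elim: n => // n IH; have [_] := gP (n, a - phi (u n)) IH.
  by rewrite /= rmorphD opprD addrA.
have [|l lP] := limS u.
  move=> n; rewrite /= addrC addKr; by case: (gP (n, a - phi (u n)) (uP n)).
exists l; apply/eqP; rewrite -subr_eq0 -oppr_eq0 opprB; apply/eqP/sepA => n.
have -> : a - phi l = (a - phi (u n)) + phi (u n - l) by rewrite rmorphB; ring.
by apply: (idealD (pwA n)) => //; apply: pwphi.
Qed.

Lemma cover_regular (S : comUnitRingType) (phi : {rmorphism S -> A}) s :
  cover phi s -> (forall a, exists c, mI (a - phi c)) ->
  exists (R : comUnitRingType) (psi : {rmorphism R -> A}),
  [/\ cnl R, regular_local_ring R & forall a, exists r, psi r = a].
Proof.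
move=> cS res; have [_ nA _] := cA; have [t tE] := nA _ lA.
have [|R [psi [s' [cR Spsi tpsi]]]] := cover_adjoin (t := t) cS.
  by move=> a at_; rewrite tE; apply: gen_in at_; apply: zeroid_ideal.
have [cnlR ms rs mpsi] := cR; have [lR nR _] := cnlR.
exists R, psi; split=> //; first exact: regular_localP ms rs.
apply: (cover_surj cnlR mpsi tE) => // a.
by have [c] := res a; have [c' <-] := Spsi c; exists c'.
Qed.

End Covers.

(** * Coefficient rings *)

Record subring (R : comNzRingType) := Subring {
  sr_set :> R -> Prop;
  sr_1 : sr_set 1;
  sr_B : forall x y, sr_set x -> sr_set y -> sr_set (x - y);
  sr_M : forall x y, sr_set x -> sr_set y -> sr_set (x * y)
}.

Section SubringType.
Variables (R : comNzRingType) (F : subring R).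

Definition sr_pred : {pred R} := [pred x | `[< F x >]].

Fact sr_closed : subring_closed sr_pred.
Proof.
split; first by apply/asboolP/sr_1.
  by move=> x y; rewrite !inE => /asboolP Fx /asboolP Fy; apply/asboolP/sr_B.
by move=> x y; rewrite !inE => /asboolP Fx /asboolP Fy; apply/asboolP/sr_M.
Qed.
HB.instance Definition _ := GRing.isSubringClosed.Build R sr_pred sr_closed.

Record srT := SrT { sr_val :> R; sr_valP : sr_val \in sr_pred }.
HB.instance Definition _ := [isSub for sr_val].
HB.instance Definition _ := [Choice of srT by <:].
HB.instance Definition _ := [SubChoice_isSubComNzRing of srT by <:].
HB.instance Definition _ := GRing.ComNzRing_hasMulInverse.Build srT
  (@clmulVx _) (@clunitPl _) (@clinv_out _).

Definition sr_elt x (Fx : F x) : srT := SrT (asboolT Fx : x \in sr_pred).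

Lemma sr_eltP (x : srT) : F (sr_val x).
Proof. by have /asboolP := sr_valP x. Qed.

Lemma sr_inj (x y : srT) : sr_val x = sr_val y -> x = y.
Proof. exact: val_inj. Qed.

Lemma sr_unitP (x : srT) : x \is a GRing.unit <-> exists2 y, F y & y * sr_val x = 1.
Proof.
split=> [Ux|[y Fy yx]].
  exists (sr_val x^-1); first exact: sr_eltP.
  by rewrite -[_ * _]/(sr_val (x^-1 * x)) mulVr.
by apply/asboolP; exists (sr_elt Fy); apply: sr_inj.
Qed.

End SubringType.

(** * Coefficient fields in residue characteristic zero *)

Section CoefficientField.
Variable A : comUnitRingType.
Hypothesis cA : cnl A.
Hypothesis char0 : forall n, n.+1%:R \is a @GRing.unit A.

Let lA : ideal (@mI A). Proof. by case: cA. Qed.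
Let pwA n : ideal (pw (@mI A) n). Proof. exact: pw_ideal. Qed.

Definition srle (F G : subring A) := forall x, F x -> G x.

Lemma subring_eq (F G : subring A) : srle F G -> srle G F -> F = G.
Proof.
case: F => F F1 FB FM; case: G => G G1 GB GM FG GF.
have E : F = G by apply: predeq => x; split; [apply: FG|apply: GF].
by case: _ / E G1 GB GM {FG GF} => *; congr Subring; apply: Prop_irrelevance.
Qed.

(** Weaker than being a field, so that Zorn's lemma can start from the image of the integers; a
    maximal such subring is a field. *)
Definition fieldlike (F : subring A) := forall x, F x -> mI x -> x = 0.

Lemma max_fieldlike : exists F, fieldlike F /\
  forall G, fieldlike G -> srle F G -> srle G F.
Proof.
pose T := {F | fieldlike F}.
pose le (F G : T) := `[< srle (sval F) (sval G) >].
have [|||C tot|[F fF] Fmax] := @classical_sets.Zorn T le.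
- by move=> F; apply/asboolP.
- by move=> F G H /asboolP FG /asboolP GH; apply/asboolP => x /FG/GH.
- move=> [F fF] [G fG] /asboolP FG /asboolP GF.
  by apply: eq_exist; apply: subring_eq.
- have [[F0 CF0]|nC] := pselect (exists F, C F); last first.
    pose Z x := exists z : int, x = z%:~R :> A.
    have Z1 : Z 1 by exists 1.
    have ZB x y : Z x -> Z y -> Z (x - y).
      by move=> [m ->] [n ->]; exists (m - n); rewrite rmorphB.
    have ZM x y : Z x -> Z y -> Z (x * y).
      by move=> [m ->] [n ->]; exists (m * n); rewrite rmorphM.
    have fZ : fieldlike (Subring Z1 ZB ZM).
      move=> _ [[[|n]|n] ->] //; rewrite /mI; first by rewrite (char0 n).
      by rewrite NegzE rmorphN unitrN (char0 n).
    by exists (exist _ _ fZ) => F CF; case: nC; exists F.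
  pose U x := exists2 F, C F & sval F x.
  have U2 x y : U x -> U y -> exists2 F, C F & sval F x /\ sval F y.
    move=> [F CF Fx] [G CG Gy]; have [/asboolP FG|/asboolP GF] := tot F G CF CG.
      by exists G => //; split=> //; apply: FG.
    by exists F => //; split=> //; apply: GF.
  have U1 : U 1 by exists F0 => //; apply: sr_1.
  have UB x y : U x -> U y -> U (x - y).
    by move=> Ux Uy; have [F CF [Fx Fy]] := U2 x y Ux Uy; exists F => //; apply: sr_B.
  have UM x y : U x -> U y -> U (x * y).
    by move=> Ux Uy; have [F CF [Fx Fy]] := U2 x y Ux Uy; exists F => //; apply: sr_M.
  have fU : fieldlike (Subring U1 UB UM).
    by move=> x [F CF Fx]; apply: (svalP F).
  by exists (exist _ _ fU) => F CF; apply/asboolP => x Fx; exists F.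
exists F; split=> // G fG FG.
have /(congr1 sval) /= -> // : exist _ _ fG = exist _ _ fF :> T.
by apply: Fmax; apply/asboolP.
Qed.

Lemma taylor2 (q : {poly A}) x h : exists r, q.[x + h] = q.[x] + q^`().[x] * h + h ^+ 2 * r.
Proof.
elim/poly_ind: q => [|q c [r IH]]; first by exists 0; rewrite deriv0 !horner0; ring.
exists (r * (x + h) + q^`().[x]); rewrite derivD derivM derivX derivC !hornerE IH.
ring.
Qed.

(** Newton's iteration with the derivative d kept from the start: the error is multiplied by (d -
    q'(u_n)) / d up to a quadratic term, and u_n stays congruent to a. *)
Lemma hensel (q : {poly A}) a : mI q.[a] -> q^`().[a] \is a GRing.unit ->
  exists2 b, mI (b - a) & q.[b] = 0.
Proof.
move=> mq Uq; have [_ _ [sep lim]] := cA.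
set d := q^`().[a] in Uq.
pose u := fix u n := if n is n'.+1 then u n' - q.[u n'] / d else a.
have uP n : mI (u n - a) /\ pw (@mI A) n.+1 q.[u n].
  elim: n => [|n [IH1 IH2]]; first by rewrite subrr; split; [apply: ideal0|apply/pw1].
  have mqu : mI q.[u n] by apply/(pw1 _ lA)/(pw_le lA _ IH2).
  split; first by rewrite /= addrAC; apply: (idealB lA) => //; apply: idealRM.
  rewrite /=; have [r ->] := taylor2 q (u n) (- (q.[u n] / d)).
  have -> : q.[u n] + q^`().[u n] * - (q.[u n] / d) + (- (q.[u n] / d)) ^+ 2 * r =
    q.[u n] / d * (d - q^`().[u n]) + q.[u n] * (q.[u n] * (d^-1 ^+ 2 * r)).
    by rewrite mulrBr divrK //; ring.
  apply: (idealD (pwA n.+2)).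
    rewrite mulrC; apply: mulIM; last exact: (idealRM _ (pwA n.+1)).
    have [s] := taylor2 q^`() a (u n - a); rewrite addrC subrK => ->.
    have -> : d - (d + q^`()^`().[a] * (u n - a) + (u n - a) ^+ 2 * s) =
      (u n - a) * (- q^`()^`().[a] - (u n - a) * s) by ring.
    exact: idealRM.
  by apply: mulIM => //; apply: (idealRM _ (pwA n.+1)).
have [|b bP] := lim u.
  move=> n; rewrite /= addrAC subrr add0r; apply: (idealN (pwA n)).
  by apply: (idealRM _ (pwA n)); apply: (pw_le lA _ (uP n).2).
exists b.
  have -> : b - a = (u 1%N - a) - (u 1%N - b) by ring.
  by apply: (idealB lA); [case: (uP 1%N)|apply/(pw1 _ lA)].
apply: sep => n.
have [r] := taylor2 q (u n) (b - u n); rewrite addrC subrK => ->.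
have pn : pw (@mI A) n (b - u n) by rewrite -opprB; apply: (idealN (pwA n)).
apply: (idealD (pwA n)); first apply: (idealD (pwA n)).
- by apply: (pw_le lA _ (uP n).2).
- exact: (idealM (pwA n)).
- by rewrite expr2 -mulrA; apply: (idealRM _ (pwA n)).
Qed.

(** If F[a] is fieldlike, a is in F by maximality. Otherwise a shortest polynomial over F with
    nonunit value at a is separable in characteristic zero; Hensel's lemma moves a to a root b, F[b]
    is fieldlike, and b is in F. *)
Lemma coefficient_field : exists F : subring A, fieldlike F /\
  forall a, exists2 c, F c & mI (a - c).
Proof.
have [F [fF Fmax]] := max_fieldlike; exists F; split=> // a.
have F1 := sr_1 F; have FB := @sr_B _ F; have FM := @sr_M _ F.
have F0 : F 0 by rewrite -(subrr 1); apply: FB.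
have FN x : F x -> F (- x) by move=> Fx; rewrite -sub0r; apply: FB.
have FD x y : F x -> F y -> F (x + y).
  by move=> Fx Fy; rewrite -[y]opprK; apply: FB => //; apply: FN.
have FU x : F x -> x != 0 -> x \is a GRing.unit.
  by move=> Fx x0; apply: mI_nunit => mx; move: x0; rewrite (fF _ Fx mx) eqxx.
have FV x : F x -> x != 0 -> F x^-1.
  (* Fractions of elements of F again form a fieldlike subring, so maximality closes F under
     inverses. *)
  pose G y := exists b c, [/\ F b, F c, c != 0 & y = b / c].
  have G1 : G 1 by exists 1, 1; rewrite oner_neq0 divr1.
  have GB y z : G y -> G z -> G (y - z).
    move=> [b [c [Fb Fc c0 ->]]] [b' [c' [Fb' Fc' c0' ->]]].
    have Uc := FU c Fc c0; have Uc' := FU c' Fc' c0'.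
    exists (b * c' - b' * c), (c * c'); split; [by apply: FB; apply: FM|exact: FM| |].
      by apply/eqP => cc0; have := unitrM c c'; rewrite cc0 unitr0 Uc Uc'.
    rewrite mulrBl; congr (_ - _); first by rewrite invrM // mulrA mulrK.
    by rewrite [c * c']mulrC invrM // mulrA mulrK.
  have GM y z : G y -> G z -> G (y * z).
    move=> [b [c [Fb Fc c0 ->]]] [b' [c' [Fb' Fc' c0' ->]]].
    have Uc := FU c Fc c0; have Uc' := FU c' Fc' c0'.
    exists (b * b'), (c * c'); split; [exact: FM|exact: FM| |].
      by apply/eqP => cc0; have := unitrM c c'; rewrite cc0 unitr0 Uc Uc'.
    by rewrite invrM // mulrACA [c'^-1 * _]mulrC.
  have fG : fieldlike (Subring G1 GB GM).
    move=> y [b [c [Fb Fc c0 ->]]] mbc; have Uc := FU c Fc c0.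
    rewrite (fF b) ?mul0r //; rewrite -(divrK Uc b); exact: idealRM.
  move=> Fx x0; apply: (Fmax _ fG).
    by move=> y Fy; exists y, 1; rewrite oner_neq0 divr1.
  by exists 1, x; rewrite div1r.
pose Fpol (q : {poly A}) := forall i, F q`_i.
have sumF (n : nat) (f : nat -> A) : (forall i, F (f i)) -> F (\sum_(i < n) f i).
  by move=> Ff; elim: n => [|n IH]; rewrite ?big_ord0 // big_ord_recr; apply: FD.
have Fadj b : (forall h, Fpol h -> mI h.[b] -> h.[b] = 0) -> F b.
  move=> Hb; pose G y := exists2 h, Fpol h & y = h.[b].
  have G1 : G 1 by exists 1; rewrite ?hornerE // => i; rewrite coef1; case: (i == 0%N).
  have GB y z : G y -> G z -> G (y - z).
    move=> [h Fh ->] [k Fk ->]; exists (h - k); rewrite ?hornerE // => i.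
    by rewrite coefB; apply: FB.
  have GM y z : G y -> G z -> G (y * z).
    move=> [h Fh ->] [k Fk ->]; exists (h * k); rewrite ?hornerE // => i.
    by rewrite coefM; apply: (sumF _ (fun j => h`_j * k`_(i - j))) => j; apply: FM.
  have fG : fieldlike (Subring G1 GB GM) by move=> y [h Fh ->]; apply: Hb.
  apply: (Fmax _ fG).
    move=> y Fy; exists y%:P; rewrite ?hornerC // => i.
    by rewrite coefC; case: (i == 0%N).
  by exists 'X; rewrite ?hornerX // => i; rewrite coefX; case: (i == 1%N).
have [Ha|] := pselect (forall h, Fpol h -> mI h.[a] -> h.[a] = 0).
  by exists a; [apply: Fadj|rewrite subrr; apply: ideal0].
move=> /existsNP[q0 /not_implyP[Fq0 /not_implyP[mq0 nq0]]].
pose Q n := `[< exists q, [/\ Fpol q, q != 0, mI q.[a] & size q = n] >].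
have exQ : exists n, Q n.
  exists (size q0); apply/asboolP; exists q0; split=> //.
  by apply/eqP => q00; apply: nq0; rewrite q00 horner0.
case: (ex_minnP exQ) => n /asboolP[q1 [Fq1 q10 mq1 sq1]] nmin.
have l0 : lead_coef q1 != 0 by rewrite lead_coef_eq0.
have Fl : F (lead_coef q1) by apply: Fq1.
have Ul := FU _ Fl l0.
pose q := (lead_coef q1)^-1 *: q1.
have sq : size q = n by rewrite lreg_size //; apply/mulrI; rewrite unitrV.
have lq : lead_coef q = 1.
  by rewrite lead_coefE sq coefZ -sq1 -lead_coefE mulVr.
have Fq : Fpol q by move=> i; rewrite coefZ; apply: FM => //; apply: FV.
have mq : mI q.[a] by rewrite hornerZ; apply: idealM.
clearbody q.
have min h : Fpol h -> mI h.[a] -> (size h < n)%N -> h = 0.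
  move=> Fh mh lt; apply/eqP; apply: contraLR lt => h0; rewrite -leqNgt.
  by apply: nmin; apply/asboolP; exists h.
have n2 : (1 < n)%N.
  rewrite ltnNge -sq; apply/negP => s1.
  have qC := size1_polyC s1; move: mq lq; rewrite qC lead_coefC hornerC => + q1E.
  by rewrite q1E /mI unitr1.
(* Otherwise q', being shorter, is 0 by minimality, whereas its top coefficient is the degree of the
   monic q, an invertible integer. *)
have Uq' : q^`().[a] \is a GRing.unit.
  apply: mI_nunit => mq'.
  have Fq' : Fpol q^`().
    move=> i; rewrite coef_deriv; elim: {2}i.+1 => [|k IH]; first by rewrite mulr0n.
    by rewrite mulrS; apply: FD.
  have qn0 : q != 0.
    by apply/eqP => qE; move: lq; rewrite qE lead_coef0 => /esym/eqP; rewrite oner_eq0.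
  have := min _ Fq' mq'; rewrite -sq => /(_ (lt_size_deriv qn0)).
  move=> /(congr1 (fun p : {poly A} => p`_n.-2)).
  rewrite coef_deriv coef0; move: lq; rewrite lead_coefE sq.
  case: n n2 {sq1 nmin sq min} => [|[|n]] //= _ -> /eqP.
  by apply/negP/eqP => e0; have := char0 n; rewrite e0 unitr0.
have [b mb qb] := hensel mq Uq'.
exists b; last by rewrite -opprB; apply: idealN.
apply: Fadj => h Fh mh; have [r hr] := taylor2 h a (b - a).
have {r hr}mha : mI h.[a].
  have -> : h.[a] = h.[b] - (b - a) * (h^`().[a] + (b - a) * r).
    by rewrite addrC subrK in hr; rewrite hr; ring.
  by apply: (idealB lA) => //; apply: idealRM.
(* Division by the monic q, which vanishes at b, brings h below the size of q, where minimality
   gives 0. *)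
elim: {h}(size h) {-2}h (leqnn (size h)) Fh mha {mh} => [|k IH] h sh Fh mh.
  by move: sh; rewrite leqn0 size_poly_eq0 => /eqP ->; rewrite horner0.
case: (ltnP (size h) n) => [/(min h Fh mh) ->|nh]; first by rewrite horner0.
pose h1 := h - lead_coef h *: ('X^(size h - n) * q).
have Fl' : F (lead_coef h) by apply: Fh.
have -> : h.[b] = h1.[b] by rewrite /h1 hornerD hornerN hornerZ hornerM qb !mulr0 subr0.
have Fh1 : Fpol h1.
  move=> i; rewrite coefB coefZ coefXnM; apply: FB => //; apply: FM => //.
  by case: ltnP.
apply: IH => //; last first.
  rewrite /h1 hornerD hornerN hornerZ hornerM; apply: (idealB lA) => //.
  by do 2 apply: idealM => //.
have h0 : (0 < size h)%N by apply: leq_trans nh; apply: ltnW.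
rewrite -ltnS; apply: leq_trans sh; rewrite -(prednK h0) ltnS.
apply/leq_sizeP => j; rewrite leq_eqVlt => /orP[/eqP <-|hj].
  rewrite coefB coefZ coefXnM ltnNge (_ : _ <= _)%N /=; last by lia.
  have -> : ((size h).-1 - (size h - n))%N = n.-1 by lia.
  have -> : q`_n.-1 = 1 by rewrite -lq lead_coefE sq.
  by rewrite mulr1 lead_coefE subrr.
have sj : (size h <= j)%N by rewrite -(prednK h0).
rewrite coefB coefZ coefXnM (nth_default _ sj) sub0r.
case: ltnP => _; rewrite ?mulr0 ?oppr0 // nth_default ?mulr0 ?oppr0 // sq.
by lia.
Qed.

(** The coefficient field itself is the cover, with no parameters. *)
Lemma cover_char0 : exists (C : comUnitRingType) (phi : {rmorphism C -> A}) s,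
  cover phi s /\ forall a, exists c, mI (a - phi c).
Proof.
have [F [fF resF]] := coefficient_field.
have valM : monoid_morphism (@sr_val A F) by [].
have valB : zmod_morphism (@sr_val A F) by [].
have [phi phiE] := rmorphism_ex valB valM.
exists (srT F), phi, [::]; split; last first.
  by move=> a; have [c Fc mc] := resF a; exists (sr_elt Fc); rewrite phiE.
have FV (x : srT F) : x != 0 -> x \is a GRing.unit.
  move=> x0; apply/sr_unitP.
  have [c Fc mc] := resF (sr_val x)^-1.
  have Ux : sr_val x \is a GRing.unit.
    apply: mI_nunit => mx; move/eqP: x0; apply; apply: sr_inj.
    by rewrite (fF _ (sr_eltP x) mx).
  exists c => //; apply/eqP; rewrite -subr_eq0; apply/eqP; apply: fF.
    by apply: sr_B; [apply: sr_M => //; apply: sr_eltP|apply: sr_1].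
  rewrite -(mulVr Ux) -mulrBl -opprB; apply: idealRM => //; exact: idealN.
have mE : @mI (srT F) = zeroid.
  apply: predeq => x; rewrite /mI /zeroid; split=> [Ux|->]; last by rewrite unitr0.
  by apply/eqP; apply: contraNT Ux => /FV.
have iz := @zeroid_ideal (srT F).
split=> //; last by move=> c; rewrite mE => ->; rewrite rmorph0; apply: ideal0.
split; first by rewrite mE.
  move=> I iI; have [I1|nI1] := pselect (I 1).
    exists [:: 1]; apply: predeq => x; split=> _.
      by rewrite -[x]mulr1; apply: adj_mul.
    by rewrite -[x]mulr1; apply: idealM.
  exists [::]; apply: predeq => x; split=> [Ix|->]; last exact: ideal0.
  apply: contrapT => /eqP/FV Ux; apply: nI1; rewrite -(mulVr Ux); exact: idealM.
rewrite /complete_sep mE; have pwz n x : pw zeroid n.+1 x -> x = 0 :> srT F.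
  by move=> /(pw_le iz (isT : 1 <= n.+1)%N)/(pw1 _ iz).
split=> [x /(_ 1%N)/pwz //|u Hu]; exists (u 1%N) => -[|n] //.
suff -> : u n.+1 = u 1%N by rewrite subrr; apply: (ideal0 (pw_ideal _ iz)).
by elim: n => // n <-; apply/eqP; rewrite -subr_eq0; apply/eqP/(pwz n).
Qed.

End CoefficientField.

Section SubringTheory.
Variables (R : comNzRingType) (F : subring R).

Lemma sr_0 : F 0. Proof. by rewrite -(subrr 1); apply: sr_B; apply: sr_1. Qed.
Lemma sr_N x : F x -> F (- x).
Proof. by move=> Fx; rewrite -sub0r; apply: sr_B => //; apply: sr_0. Qed.
Lemma sr_D x y : F x -> F y -> F (x + y).
Proof. by move=> Fx Fy; rewrite -[y]opprK; apply: sr_B => //; apply: sr_N. Qed.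
Lemma sr_X x n : F x -> F (x ^+ n).
Proof.
by move=> Fx; elim: n => [|n IH]; rewrite ?exprS; [apply: sr_1|apply: sr_M].
Qed.
Lemma sr_nat n : F n%:R.
Proof.
by elim: n => [|n IH]; [apply: sr_0|rewrite -addn1 natrD; apply: sr_D => //; apply: sr_1].
Qed.
Lemma sr_sum (T : Type) (r : seq T) (P : pred T) (f : T -> R) :
  (forall i, P i -> F (f i)) -> F (\sum_(i <- r | P i) f i).
Proof. by move=> Ff; apply: (big_ind F) => //; [apply: sr_0|apply: sr_D]. Qed.

Definition polyF (h : {poly R}) := forall i, F h`_i.

Lemma polyFC c : F c -> polyF c%:P.
Proof. by move=> Fc i; rewrite coefC; case: eqP => // _; apply: sr_0. Qed.
Lemma polyFX n : polyF 'X^n.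
Proof. by move=> i; rewrite coefXn; apply: sr_nat. Qed.
Lemma polyFB h g : polyF h -> polyF g -> polyF (h - g).
Proof. by move=> Fh Fg i; rewrite coefB; apply: sr_B. Qed.
Lemma polyFM h g : polyF h -> polyF g -> polyF (h * g).
Proof. by move=> Fh Fg i; rewrite coefM; apply: sr_sum => j _; apply: sr_M. Qed.

End SubringTheory.

Inductive sgen_pred (R : comNzRingType) (X : R -> Prop) : R -> Prop :=
| sgen_in x : X x -> sgen_pred X x
| sgen_1 : sgen_pred X 1
| sgen_B x y : sgen_pred X x -> sgen_pred X y -> sgen_pred X (x - y)
| sgen_M x y : sgen_pred X x -> sgen_pred X y -> sgen_pred X (x * y).

Definition sgen (R : comNzRingType) (X : R -> Prop) : subring R :=
  Subring (sgen_1 X) (@sgen_B R X) (@sgen_M R X).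

Lemma sgen_min (R : comNzRingType) (X : R -> Prop) (F : subring R) :
  (forall x, X x -> F x) -> forall x, sgen X x -> F x.
Proof.
move=> XF x; elim=> [y /XF//||y z _ Fy _ Fz|y z _ Fy _ Fz].
- exact: sr_1. - exact: sr_B. - exact: sr_M.
Qed.

Lemma sgen_mono (R : comNzRingType) (X Y : R -> Prop) :
  (forall x, X x -> Y x) -> forall x, sgen X x -> sgen Y x.
Proof. by move=> XY; apply: sgen_min => x /XY; apply: sgen_in. Qed.

(** * Fields of characteristic p and p-bases *)

Section PowerPrime.
Variables (p : nat) (pp : prime p).

(** The inner binomial coefficients are divisible by p. That q stays in F makes p-th powers additive
    up to p F inside any subring. *)
Lemma binomial_prime (R : comNzRingType) (F : subring R) x y : F x -> F y ->
  exists2 q, F q & (x + y) ^+ p = x ^+ p + y ^+ p + p%:R * (x * y * q).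
Proof.
move=> Fx Fy; have p1 := prime_gt1 pp.
pose c i := ('C(p, i.+1) %/ p)%N.
have cE i : (i.+1 < p)%N -> 'C(p, i.+1) = (p * c i)%N.
  by move=> ip; rewrite mulnC divnK // prime_dvd_bin.
exists (\sum_(i < p.-1) (x ^+ (p.-2 - i) * y ^+ i) *+ c i).
  apply: sr_sum => i _; rewrite -mulr_natl; apply: sr_M; first exact: sr_nat.
  by apply: sr_M; apply: sr_X.
rewrite exprDn big_ord_recl subn0 bin0 mulr1n expr0 mulr1.
have E : p = p.-1.+1 by rewrite prednK // ltnW.
have -> : \sum_(i < p) x ^+ (p - lift ord0 i) * y ^+ lift ord0 i *+ 'C(p, lift ord0 i)
  = \sum_(i < p.-1.+1) x ^+ (p - i.+1) * y ^+ i.+1 *+ 'C(p, i.+1) by rewrite -E.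
rewrite big_ord_recr /= -E subnn expr0 mul1r binn mulr1n.
rewrite -[RHS]addrA; congr (_ + _); rewrite [RHS]addrC; congr (_ + _).
rewrite !mulr_sumr; apply: eq_bigr => i _.
have ip : (i.+1 < p)%N by have := ltn_ord i; lia.
rewrite cE // -[_ *+ (p * _)]mulr_natl -[_ *+ c i]mulr_natl natrM.
have -> : (p - i.+1 = (p.-2 - i).+1)%N by lia.
by rewrite !exprS; ring.
Qed.

Section Frobenius.
Variable k : fieldType.
Hypothesis pk : p \in [pchar k].

(** K contains the p-th powers, hence is a field, and the minimal polynomial of b over K divides X^p
    - b^p = (X - b)^p. So it is (X - b)^d up to a scalar, with 0 < d < p, and its second coefficient
    puts d b, hence b, in K. *)
Lemma p_independent (K : subring k) b (h : {poly k}) : (forall y, K (y ^+ p)) ->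
  ~ K b -> polyF K h -> (size h <= p)%N -> h.[b] = 0 -> h = 0.
Proof.
move=> Kp nKb Kh sh hb; apply: contrapT => /eqP h0; apply: nKb.
have p0 := prime_gt0 pp.
have KV x : K x -> K x^-1.
  move=> Kx; have [->|x0] := eqVneq x 0; first by rewrite invr0; apply: sr_0.
  have -> : x^-1 = x^-1 ^+ p * x ^+ p.-1.
    rewrite -{1}(prednK p0) exprS -mulrA -exprMn mulVf // expr1n mulr1 //.
  by apply: sr_M => //; apply: sr_X.
pose Q n := `[< exists q, [/\ polyF K q, q != 0, q.[b] = 0 & size q = n] >].
have exQ : exists n, Q n by exists (size h); apply/asboolP; exists h.
case: (ex_minnP exQ) => n /asboolP[q [Kq q0 qb sq]] nmin.
have min g : polyF K g -> g.[b] = 0 -> (size g < n)%N -> g = 0.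
  move=> Kg gb lt; apply/eqP; apply: contraLR lt => g0; rewrite -leqNgt.
  by apply: nmin; apply/asboolP; exists g.
have dvd g : polyF K g -> g.[b] = 0 -> q %| g.
  move: {2}(size g) (leqnn (size g)) => m.
  elim: m g => [|m IH] g sg Kg gb.
    by move: sg; rewrite leqn0 size_poly_eq0 => /eqP ->; apply: dvdp0.
  case: (ltnP (size g) n) => [/(min g Kg gb) ->|ng]; first exact: dvdp0.
  have g0 : (0 < size g)%N by apply: leq_trans ng; rewrite -sq size_poly_gt0.
  have lq : lead_coef q != 0 by rewrite lead_coef_eq0.
  pose m1 := (lead_coef g / lead_coef q)%:P * ('X^(size g - n) * q).
  have Km1 : polyF K m1.
    apply: polyFM; last by apply: polyFM => //; apply: polyFX.
    by apply: polyFC; apply: sr_M; [apply: Kg|apply: KV; apply: Kq].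
  rewrite -(subrK m1 g); apply: dvdp_add; last by rewrite /m1 mulrA dvdp_mulIr.
  apply: IH.
  - rewrite -ltnS; apply: leq_trans sg; rewrite -(prednK g0) ltnS.
    apply/leq_sizeP => j; rewrite leq_eqVlt coefB coefCM coefXnM => /orP[/eqP <-|gj].
      rewrite ltnNge (_ : _ <= _)%N /=; last by have := q0; rewrite -size_poly_gt0 sq; lia.
      have -> : ((size g).-1 - (size g - n))%N = (size q).-1 by rewrite sq; have := q0; rewrite -size_poly_gt0 sq; lia.
      by rewrite -!lead_coefE divfK // subrr.
    have sj : (size g <= j)%N by rewrite -(prednK g0).
    rewrite (nth_default _ sj) sub0r; case: ltnP => _; rewrite ?mulr0 ?oppr0 //.
    by rewrite nth_default ?mulr0 ?oppr0 // sq; lia.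
  - exact: polyFB.
  - by rewrite hornerD hornerN gb hornerM hornerM qb !mulr0 subr0.
have KXp : polyF K ('X^p - (b ^+ p)%:P).
  by apply: polyFB; [apply: polyFX|apply: polyFC].
have : q %| ('X - b%:P) ^+ p.
  have -> : ('X - b%:P) ^+ p = 'X^p - (b ^+ p)%:P.
    have pk' : p \in [pchar {poly k}] by rewrite pchar_poly.
    by rewrite -(pFrobenius_autE pk') rmorphB /= !pFrobenius_autE polyC_exp.
  by apply: dvd; rewrite // hornerD hornerN hornerXn hornerC subrr.
move/dvdp_exp_XsubCP => [d dp qd].
have sd : size q = d.+1 by rewrite (eqp_size qd) size_exp_XsubC.
have dlt : (d < p)%N.
  rewrite -sd sq; apply: leq_trans sh; apply: nmin; apply/asboolP; by exists h.
have d0 : (0 < d)%N.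
  rewrite lt0n; apply/eqP => d0; have := qd; rewrite d0 expr0 => /eqp_root/(_ b).
  by rewrite rootC oner_eq0 /root qb eqxx.
have /eqpP[[u v] /= /andP[u0 v0] uv] := qd.
have qE : q = (v / u) *: ('X - b%:P) ^+ d.
  by apply: (scalerI u0); rewrite uv scalerA mulrCA divff // mulr1.
have lE : lead_coef q = v / u.
  by rewrite qE lead_coefZ (monicP (monic_exp _ (monicXsubC b))) mulr1.
have cE : q`_d.-1 = (v / u) * - (b *+ d).
  rewrite qE coefZ; congr (_ * _).
  have := @coefPn_prod_XsubC k (nseq d b); rewrite size_nseq => /(_ (lt0n_neq0 d0)).
  by rewrite !big_nseq !iter_addr_0 iter_mulr_1.
have dk : d%:R != 0 :> k.
  by rewrite -(dvdn_pcharf pk) gtnNdvd.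
have -> : b = - (q`_d.-1 / lead_coef q / d%:R).
  have c0 : v / u != 0 by rewrite mulf_neq0 ?invr_eq0.
  by rewrite cE lE [v / u * _]mulrC mulfK // mulNr opprK -[b *+ d]mulr_natr mulfK.
apply: sr_N; apply: sr_M; last by apply: KV; apply: sr_nat.
by apply: sr_M; [apply: Kq|apply: KV; apply: Kq].
Qed.

Definition wo : rel k := sval (wochoice.well_ordering_principle k).

Lemma wo_min (P : k -> Prop) : (exists x, P x) ->
  exists x, P x /\ forall y, P y -> wo x y.
Proof.
move=> [x0 Px0]; have H := svalP (wochoice.well_ordering_principle k).
have [|x [[Px lx] _]] := H [pred x | `[< P x >]].
  by exists x0; apply/asboolP.
exists x; split; first by apply/asboolP.
by move=> y Py; apply: lx; apply/asboolP.
Qed.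

Lemma wo_anti x y : wo x y -> wo y x -> x = y.
Proof.
move=> xy yx; have H := svalP (wochoice.well_ordering_principle k).
have [|z [_ uz]] := H [pred z | (z == x) || (z == y)].
  by exists x; rewrite inE eqxx.
have refl u : wo u u.
  have [|v [-> vP]] := @wo_min (fun v => v = u); first by exists u.
  exact: vP.
have zx : z = x.
  apply: uz; split; first by rewrite !inE eqxx.
  by move=> u; rewrite !inE => /orP[] /eqP ->.
have zy : z = y.
  apply: uz; split; first by rewrite !inE eqxx orbT.
  by move=> u; rewrite !inE => /orP[] /eqP ->.
by rewrite -zx.
Qed.

(** Supplies the element that [tower_part_ker] eliminates first: all the others are then below
    it. *)
Lemma wo_max (s : seq k) : s != [::] -> exists2 x, x \in s & forall y, y \in s -> wo y x.
Proof.
have tot x y : wo x y \/ wo y x.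
  have [|v [[->|->] vP]] := @wo_min (fun v => v = x \/ v = y); first by exists x; left.
    by left; apply: vP; right.
  by right; apply: vP; left.
have trans x y z : wo x y -> wo y z -> wo x z.
  move=> xy yz; have [|v [vE vP]] := @wo_min (fun v => [\/ v = x, v = y | v = z]).
    by exists x; constructor 1.
  have [vx vy vz] : [/\ wo v x, wo v y & wo v z].
    by split; apply: vP; [constructor 1|constructor 2|constructor 3].
  case: vE vx vy vz => -> vx vy vz //; last by rewrite (wo_anti yz vy) in xy *.
  by rewrite (wo_anti xy vx).
elim: s => // x s IH _; have [->|s0] := eqVneq s [::].
  exists x; first exact: mem_head.
  by move=> y; rewrite mem_seq1 => /eqP ->; case: (tot x x).
have [y ys ym] := IH s0; have [xy|yx] := tot x y.
  exists y => [|z]; first by rewrite inE ys orbT.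
  by rewrite inE => /orP[/eqP -> //|/ym].
exists x => [|z]; first exact: mem_head.
rewrite inE => /orP[/eqP ->|/ym zy]; first by case: (tot x x).
exact: trans yx.
Qed.

Definition below x y := wo y x /\ y <> x.

Definition kbelow x : subring k := sgen (fun z => (exists y, z = y ^+ p) \/ below x z).

(* Elements minimal for the well-order in the sense that they are not generated
   by p-th powers and smaller elements; they form a p-basis of k. *)
Definition pbasis x := ~ kbelow x x.

(** A least element outside F would have all smaller ones in F; outside the p-basis it is generated
    by those and p-th powers. *)
Lemma pbasis_generates (F : subring k) : (forall y, F (y ^+ p)) ->
  (forall x, pbasis x -> F x) -> forall x, F x.
Proof.
move=> Fp FB x; apply: contrapT => nFx.
have [|y [nFy ymin]] := @wo_min (fun x => ~ F x); first by exists x.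
apply: nFy; have [/FB//|nB] := pselect (pbasis y).
have /contrapT := nB; apply: sgen_min => z [[w ->] //|[zy neq]].
by apply: contrapT => /ymin yz; apply: neq; apply: wo_anti.
Qed.

End Frobenius.
End PowerPrime.

(** * A tower of subrings approximating the Cohen ring *)

Section CohenTower.
Variables (p : nat) (pp : prime p) (T : comNzRingType) (k : fieldType).
Variable r : {rmorphism T -> k}.
Hypothesis pk : p \in [pchar k].
Hypothesis r_surj : forall x, exists t, r t = x.

Definition kerJ : T -> Prop := fun t => r t = 0.

Lemma kerJ_ideal : ideal kerJ.
Proof.
split=> [|x y rx ry|a x rx]; rewrite /kerJ ?rmorph0 //.
  by rewrite rmorphD rx ry addr0.
by rewrite rmorphM rx mulr0.
Qed.

Let iF n : ideal (pw kerJ n). Proof. exact/pw_ideal/kerJ_ideal. Qed.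

Lemma kerJ_p : kerJ p%:R.
Proof. by rewrite /kerJ rmorph_nat (pcharf0 pk). Qed.

Lemma pw_p n x : pw kerJ n x -> pw kerJ n.+1 (p%:R * x).
Proof. by apply: mulIM; apply: kerJ_p. Qed.

Definition slift (x : k) : T := projT1 (cid (r_surj x)).
Lemma sliftK x : r (slift x) = x.
Proof. by rewrite /slift; case: cid. Qed.

Definition full_subring : subring T := @Subring T (fun=> True) I (fun _ _ _ _ => I) (fun _ _ _ _ => I).

Definition frob_base (F : subring T) z :=
  (exists2 a, F a & z = a ^+ p) \/ (exists2 a, F a & z = p%:R * a).

(* D_0 = T and D_{n+1} is generated by D_n^p, p D_n and lifts of a p-basis. Up to
   the (n+1)-st power of the kernel, D_n meets the kernel of T -> k only in
   multiples of p, so that D_n approximates the Cohen ring of k modulo p^{n+1}. *)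
Fixpoint tower n : subring T := if n is n'.+1 then
  sgen (fun z => frob_base (tower n') z \/ exists2 x, pbasis p x & z = slift x)
  else full_subring.

(** One level of the tower with finitely many lifts only, so that they can be removed one at a
    time. *)
Definition tower_part (F : subring T) (bs : seq k) :=
  sgen (fun z => frob_base F z \/ exists2 x, x \in bs & z = slift x).

Lemma preim_1 (K : subring k) : K (r 1). Proof. by rewrite rmorph1; apply: sr_1. Qed.
Lemma preim_B (K : subring k) x y : K (r x) -> K (r y) -> K (r (x - y)).
Proof. by rewrite rmorphB; apply: sr_B. Qed.
Lemma preim_M (K : subring k) x y : K (r x) -> K (r y) -> K (r (x * y)).
Proof. by rewrite rmorphM; apply: sr_M. Qed.
Definition preim_sr K := Subring (preim_1 K) (@preim_B K) (@preim_M K).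

(** The elements a^p + p d already form a subring, since a^p - b^p is (a - b)^p up to p F. *)
Lemma tower_part_nil F z : tower_part F [::] z ->
  exists a d, [/\ F a, F d & z = a ^+ p + p%:R * d].
Proof.
pose P z := exists a d, [/\ F a, F d & z = a ^+ p + p%:R * d].
have P1 : P 1 by exists 1, 0; rewrite expr1n mulr0 addr0; split=> //; [apply: sr_1|apply: sr_0].
have PB x y : P x -> P y -> P (x - y).
  move=> [a [d [Fa Fd ->]]] [b [e [Fb Fe ->]]].
  have Fab := sr_B Fa Fb.
  have [q Fq qE] := binomial_prime pp Fab Fb; rewrite subrK in qE.
  exists (a - b), ((a - b) * b * q + d - e); split=> //; last by rewrite qE; ring.
  by apply: sr_B => //; apply: sr_D => //; apply: sr_M => //; apply: sr_M.
have PM x y : P x -> P y -> P (x * y).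
  move=> [a [d [Fa Fd ->]]] [b [e [Fb Fe ->]]].
  exists (a * b), (a ^+ p * e + d * b ^+ p + p%:R * (d * e)); split.
  - exact: sr_M.
  - have Fap := sr_X p Fa; have Fbp := sr_X p Fb.
    apply: sr_D; first by apply: sr_D; apply: sr_M.
    by apply: sr_M; [apply: sr_nat|apply: sr_M].
  - by rewrite exprMn; ring.
apply: (@sgen_min _ _ (Subring P1 PB PM)) => x [[[a Fa ->]|[a Fa ->]]|[y]] //.
  by exists a, 0; rewrite mulr0 addr0; split=> //; apply: sr_0.
exists 0, a; rewrite expr0n; case: p pp => // p' _; rewrite add0r.
by split=> //; apply: sr_0.
Qed.

(** Horner's scheme, in which b^p is replaced by its value in G as soon as degree p appears. *)
Lemma reduce_degree (G : subring T) b (h : {poly T}) : G (b ^+ p) -> polyF G h ->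
  exists2 h', polyF G h' & (size h' <= p)%N /\ h'.[b] = h.[b].
Proof.
move=> Gb; elim/poly_ind: h => [|h c IH] Gh.
  by exists 0; rewrite ?size_poly0.
have [|h' Gh' [sh' hE]] := IH.
  by move=> i; have := Gh i.+1; rewrite coefD coefMX coefC addr0.
have p0 := prime_gt0 pp.
pose g := h' * 'X - (h'`_p.-1)%:P * 'X^p + (c + h'`_p.-1 * b ^+ p)%:P.
have Gc : G c by have := Gh 0%N; rewrite coefD coefMX coefC add0r.
exists g; last split.
- move=> i; rewrite /g coefD coefB coefMX coefCM coefXn coefC.
  have Gp := Gh' p.-1.
  apply: sr_D; last first.
    by case: eqP => _; [apply: sr_D => //; apply: sr_M|apply: sr_0].
  apply: sr_B; first by case: eqP => _; [apply: sr_0|apply: Gh'].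
  by apply: sr_M => //; apply: sr_nat.
- apply/leq_sizeP => j pj; rewrite /g coefD coefB coefMX coefCM coefXn coefC.
  have -> : (j == 0%N) = false by apply/negbTE; rewrite -lt0n; apply: leq_trans pj.
  rewrite addr0; case: eqP => [->|/eqP jp]; first by rewrite mulr1 subrr.
  rewrite mulr0 subr0 nth_default //; apply: leq_trans sh' _.
  by rewrite -ltnS prednK ?(leq_trans p0 pj) // ltn_neqAle eq_sym jp.
- by rewrite /g !(hornerD, hornerN, hornerM, hornerX, hornerXn, hornerC) hE; ring.
Qed.

Lemma tower_part_split (F : subring T) bs x z : F (slift x) -> tower_part F bs z ->
  exists2 h, polyF (tower_part F [seq y <- bs | y != x]) h &
    (size h <= p)%N /\ z = h.[slift x].
Proof.
move=> Fx Gz; set G := tower_part F [seq y <- bs | y != x].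
have Gx : G (slift x ^+ p) by apply: sgen_in; left; left; exists (slift x).
suff [h Gh zE] : exists2 h, polyF G h & z = h.[slift x].
  by have [h' Gh' [sh' hE]] := reduce_degree Gx Gh; exists h'; rewrite // hE.
pose P z := exists2 h, polyF G h & z = h.[slift x].
have P1 : P 1 by exists 1%:P; rewrite ?hornerC //; apply/polyFC/sr_1.
have PB u v : P u -> P v -> P (u - v).
  by move=> [h Gh ->] [g Gg ->]; exists (h - g); rewrite ?hornerE //; apply: polyFB.
have PM u v : P u -> P v -> P (u * v).
  by move=> [h Gh ->] [g Gg ->]; exists (h * g); rewrite ?hornerE //; apply: polyFM.
apply: (@sgen_min _ _ (Subring P1 PB PM)) Gz => u [Fu|[y ybs ->]].
  by exists u%:P; rewrite ?hornerC //; apply/polyFC/sgen_in; left.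
have [->|yx] := eqVneq y x.
  by exists 'X; rewrite ?hornerX // -['X]expr1; apply: polyFX.
exists (slift y)%:P; rewrite ?hornerC //; apply/polyFC/sgen_in; right.
by exists y; rewrite // mem_filter yx.
Qed.

(** Induction on [bs], removing its largest member x. As a polynomial of degree less than p in the
    lift of x, z has coefficients with residues in [kbelow p x], over which the powers of x are
    independent; so all coefficients are in the kernel and induction applies to them. Without lifts,
    z = a^p + p d with a in the kernel. *)
Lemma tower_part_ker n (F : subring T) bs : (forall x, x \in bs -> F (slift x)) ->
  (forall x, x \in bs -> pbasis p x) ->
  (forall a, F a -> kerJ a -> exists c e,
     [/\ F (c ^+ p), pw kerJ n.+1 e & a = p%:R * c + e]) ->
  forall z, tower_part F bs z -> kerJ z -> exists c e,
     [/\ F c, pw kerJ n.+2 e & z = p%:R * c + e].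
Proof.
move=> + + HF; move: {2}(size bs) (leqnn (size bs)) => m.
elim: m bs => [|m IH] bs.
  rewrite leqn0 => /nilP -> _ _ z /tower_part_nil[a [d [Fa Fd ->]]] Jz.
  have p0 := prime_gt0 pp; have p1 := prime_gt1 pp.
  have Ja : kerJ a.
    move: Jz; rewrite /kerJ rmorphD rmorphXn rmorphM rmorph_nat (pcharf0 pk) mul0r addr0.
    by move=> /eqP; rewrite expf_eq0 p0 => /eqP.
  have [c [e [Fc pe ->]]] := HF a Fa Ja.
  (* In (p c + e)^p the first power is p times an element of F, the mixed terms carry a factor p,
     and e^p gains an order of vanishing because p >= 2. *)
  have [q _ ->] := binomial_prime pp (F := full_subring) (x := p%:R * c) (y := e) I I.
  exists (p%:R ^+ p.-1 * c ^+ p + d), (e ^+ p + p%:R * (p%:R * c * e * q)); split.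
  - apply: sr_D => //; apply: sr_M => //; apply/sr_X/sr_nat.
  - apply: (idealD (iF n.+2)); last first.
      apply: pw_p; apply: (idealRM _ (iF n.+1)); exact: (idealM (iF n.+1)).
    have Je : kerJ e by apply/(pw1 _ kerJ_ideal)/(pw_le kerJ_ideal _ pe).
    have -> : e ^+ p = e * e * e ^+ p.-2.
      by rewrite -expr2 -exprD; congr (_ ^+ _); lia.
    by apply: (idealRM _ (iF n.+2)); apply: mulIM.
  - have -> : (p%:R * c) ^+ p = p%:R * (p%:R ^+ p.-1 * c ^+ p).
      by rewrite exprMn mulrA -exprS prednK.
    by ring.
move=> sbs Fbs Bbs z Gz Jz; have [b0|bs0] := eqVneq bs [::].
  by apply: (IH [::]) => //; rewrite -b0.
have [x xbs xmax] := wo_max bs0.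
have [h Gh [sh zE]] := tower_part_split (Fbs x xbs) Gz.
set bs' := [seq y <- bs | y != x] in Gh.
have bs'P y : y \in bs' -> y \in bs /\ y != x by rewrite mem_filter => /andP[].
have sbs' : (size bs' <= m)%N.
  rewrite -ltnS; apply: leq_trans sbs; rewrite size_filter.
  rewrite -(count_predC (predC1 x) bs) -[X in (X < _)%N]addn0 ltn_add2l.
  by rewrite -has_count; apply/hasP; exists x; rewrite //= negbK.
have Gkb y : tower_part F bs' y -> kbelow p x (r y).
  apply: (@sgen_min _ _ (preim_sr (kbelow p x))) => u [[[a Fa ->]|[a Fa ->]]|[w wbs ->]] /=.
  - by rewrite rmorphXn; apply: sgen_in; left; exists (r a).
  - by rewrite rmorphM rmorph_nat (pcharf0 pk) mul0r; apply: (sr_0 (kbelow p x)).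
  - rewrite sliftK; have [wb wx] := bs'P _ wbs; apply: sgen_in; right.
    by split; [apply: xmax|apply/eqP].
have h0 : map_poly r h = 0.
  apply: (p_independent pp pk (K := kbelow p x) (b := x)).
  - by move=> y; apply: sgen_in; left; exists y.
  - exact: Bbs.
  - by move=> i; rewrite coef_map; apply: Gkb.
  - by apply: leq_trans sh; apply: size_poly.
  - by rewrite -[x]sliftK horner_map -zE.
have /choice[c cP] : forall i, exists c, exists e,
    [/\ F c, pw kerJ n.+2 e & h`_i = p%:R * c + e].
  move=> i; apply: (IH bs' sbs') => //.
  - by move=> y /bs'P[/Fbs].
  - by move=> y /bs'P[/Bbs].
  - by rewrite /kerJ -coef_map h0 coef0.
have [e eP] := choice cP.
exists (\sum_(i < size h) c i * slift x ^+ i), (\sum_(i < size h) e i * slift x ^+ i).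
split.
- apply: sr_sum => i _; case: (eP i) => Fc _ _.
  by apply: sr_M => //; apply: sr_X; apply: Fbs.
- by apply: (ideal_sum _ (iF n.+2)) => i _; apply: (idealRM _ (iF n.+2)); case: (eP i).
- rewrite zE horner_coef mulr_sumr -big_split; apply: eq_bigr => i _ /=.
  by case: (eP i) => _ _ ->; rewrite mulrDl mulrA.
Qed.

Lemma tower_S n z : tower n.+1 z -> tower n z.
Proof.
elim: n z => [//|n IH]; apply: sgen_min => z [[[a Ta ->]|[a Ta ->]]|[x Bx ->]].
- by apply: sgen_in; left; left; exists a => //; apply: IH.
- by apply: sgen_in; left; right; exists a => //; apply: IH.
- by apply: sgen_in; right; exists x.
Qed.

Lemma tower_p n z : tower n z -> tower n.+1 (p%:R * z).
Proof. by move=> Tz; apply: sgen_in; left; right; exists z. Qed.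

Lemma tower_lift n x : pbasis p x -> tower n (slift x).
Proof. by case: n => // n Bx; apply: sgen_in; right; exists x. Qed.

Lemma tower_parts n z : tower n.+1 z -> exists2 bs,
  (forall x, x \in bs -> pbasis p x) & tower_part (tower n) bs z.
Proof.
have mono (s t : seq k) y : {subset s <= t} -> tower_part (tower n) s y ->
    tower_part (tower n) t y.
  move=> st; apply: sgen_mono => u [|[x /st xt ->]]; first by left.
  by right; exists x.
pose P z := exists2 bs, (forall x, x \in bs -> pbasis p x) & tower_part (tower n) bs z.
have P2 x y : P x -> P y -> exists2 bs, (forall x, x \in bs -> pbasis p x) &
    tower_part (tower n) bs x /\ tower_part (tower n) bs y.
  move=> [s sB sx] [t tB ty]; exists (s ++ t).
    by move=> u; rewrite mem_cat => /orP[/sB|/tB].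
  by split; [apply: mono sx|apply: mono ty] => u us; rewrite mem_cat us ?orbT.
have P1 : P 1 by exists [::] => //; apply: sr_1.
have PB x y : P x -> P y -> P (x - y).
  by move=> Px Py; have [s sB [sx sy]] := P2 x y Px Py; exists s => //; apply: sr_B.
have PM x y : P x -> P y -> P (x * y).
  by move=> Px Py; have [s sB [sx sy]] := P2 x y Px Py; exists s => //; apply: sr_M.
apply: (@sgen_min _ _ (Subring P1 PB PM)) => u [Fu|[x Bx ->]].
  by exists [::] => //; apply: sgen_in; left.
exists [:: x]; first by move=> y; rewrite mem_seq1 => /eqP ->.
by apply: sgen_in; right; exists x; rewrite ?mem_head.
Qed.

(** The cofactor c is found one level lower, so that c^p is back at the level of z; this is why
    [tower_part_ker] asks for c^p and not for c. *)
Lemma tower_ker n z : tower n z -> kerJ z -> exists c e,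
  [/\ (if n is n'.+1 then tower n' c else c = 0), pw kerJ n.+1 e & z = p%:R * c + e].
Proof.
elim: n z => [|n IH] z Tz Jz.
  by exists 0, z; split=> //; rewrite ?mulr0 ?add0r //; apply/(pw1 _ kerJ_ideal).
have [bs Bbs Gz] := tower_parts Tz.
apply: (tower_part_ker (bs := bs)) => // [x xbs|a Ta Ja].
  exact/tower_lift/Bbs.
have [c [e [Tc pe ->]]] := IH a Ta Ja; exists c, e; split=> //.
by case: n Tc {IH Tz pe Ta Gz} => // n Tc; apply: sgen_in; left; left; exists c.
Qed.

Lemma tower_surj n x : exists2 z, tower n z & r z = x.
Proof.
elim: n x => [|n IH] x; first by have [t tx] := r_surj x; exists t.
pose P x := exists2 z, tower n.+1 z & r z = x.
have P1 : P 1 by exists 1; rewrite ?rmorph1 //; apply: sr_1.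
have PB u v : P u -> P v -> P (u - v).
  by move=> [y Ty <-] [z Tz <-]; exists (y - z); rewrite ?rmorphB //; apply: sr_B.
have PM u v : P u -> P v -> P (u * v).
  by move=> [y Ty <-] [z Tz <-]; exists (y * z); rewrite ?rmorphM //; apply: sr_M.
apply: (@pbasis_generates p k (Subring P1 PB PM)) => [y|y By].
  have [z Tz <-] := IH y; exists (z ^+ p); last by rewrite rmorphXn.
  by apply: sgen_in; left; left; exists z.
by exists (slift y); [apply: (tower_lift n.+1)|rewrite sliftK].
Qed.

(** The residue of z is lifted to the next level. The difference is p c + e by [tower_ker], and c is
    approximated by induction. *)
Lemma tower_approx n z : tower n z -> exists2 w, tower n.+1 w & pw kerJ n.+1 (z - w).
Proof.
elim: n z => [|n IH] z Tz.
  have [w Tw rw] := tower_surj 1 (r z); exists w => //; apply/(pw1 _ kerJ_ideal).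
  by rewrite /kerJ rmorphB rw subrr.
have [w Tw rw] := tower_surj n.+2 (r z).
have Tzw : tower n.+1 (z - w) by apply: sr_B => //; apply: tower_S.
have [|c [e [Tc pe zE]]] := tower_ker Tzw; first by rewrite /kerJ rmorphB rw subrr.
have [d Td pd] := IH c Tc.
exists (w + p%:R * d); first by apply: sr_D => //; apply: tower_p.
have -> : z - (w + p%:R * d) = p%:R * (c - d) + e.
  have -> : z - (w + p%:R * d) = (z - w) - p%:R * d by ring.
  by rewrite zE; ring.
by apply: (idealD (iF n.+2)) => //; apply: pw_p.
Qed.

(** Powers of p vanish only to the expected order along the kernel. The ring T used in the end has
    this property by its Frobenius lift, see [p_not_nilpotent]. *)
Hypothesis p_nonnil : forall n, ~ pw kerJ n.+1 (p%:R ^+ n).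

Lemma pw_exp_p m : pw kerJ m (p%:R ^+ m).
Proof. by apply: pwX; apply: kerJ_p. Qed.

(** An x outside the kernel is invertible modulo it, and p^(j+1) itself would vanish to order j +
    2. *)
Lemma kerJ_of_pw x i j : (j < i)%N -> pw kerJ i.+1 (p%:R ^+ j.+1 * x) -> kerJ x.
Proof.
move=> ji px; apply: contrapT => /eqP rx; apply: (p_nonnil (n := j.+1)).
have [y ry] := r_surj (r x)^-1.
have -> : p%:R ^+ j.+1 = p%:R ^+ j.+1 * x * y + (1 - x * y) * p%:R ^+ j.+1 :> T by ring.
apply: (idealD (iF j.+2)).
  by apply: (idealRM _ (iF j.+2)); apply: (pw_le kerJ_ideal _ px).
apply: mulIM; last exact: (pw_exp_p j.+1).
by rewrite /kerJ rmorphB rmorph1 rmorphM ry divff // subrr.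
Qed.

(** Cancellation of one p. Writing x = p c + e by [tower_ker] trades a level of the tower for a
    factor p, hence the spare power p^j; the bound on i makes the error p^j e negligible. *)
Lemma tower_divp n x j i : tower n x -> (i <= n.+1 + j)%N ->
  pw kerJ i.+1 (p%:R ^+ j.+1 * x) -> pw kerJ i (p%:R ^+ j * x).
Proof.
have pwj := pw_exp_p.
elim: n x j => [|n IH] x j Tx ij px; have [ij'|ji] := leqP i j.
- by apply: (idealRM _ (iF i)); apply: (pw_le kerJ_ideal ij').
- have Jx := kerJ_of_pw ji px.
  have [c [e [-> pe ->]]] := tower_ker Tx Jx; rewrite mulr0 add0r mulrC.
  by apply: (pw_le kerJ_ideal ij); apply: pwM => //; apply: kerJ_ideal.
- by apply: (idealRM _ (iF i)); apply: (pw_le kerJ_ideal ij').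
have Jx := kerJ_of_pw ji px.
have [c [e [Tc pe xE]]] := tower_ker Tx Jx.
have pje : pw kerJ i (p%:R ^+ j * e).
  rewrite mulrC; apply: (pw_le kerJ_ideal ij); apply: pwM => //; exact: kerJ_ideal.
rewrite xE mulrDr mulrA -exprSr; apply: (idealD (iF i)) => //.
apply: IH => //; first by rewrite addnS -addSn.
have -> : p%:R ^+ j.+2 * c = p%:R ^+ j.+1 * x - p%:R * (p%:R ^+ j * e).
  by rewrite xE !exprS; ring.
by apply: (idealB (iF i.+1)) => //; apply: pw_p.
Qed.

End CohenTower.

(** * Quotient rings and residue fields *)

Record properI (R : comNzRingType) := ProperI {
  pri :> R -> Prop;
  pri_ideal : ideal pri;
  pri_1 : ~ pri 1
}.

Section QuotientRing.
Variables (R : comNzRingType) (I : properI R).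

Definition pri_pred : {pred R} := [pred x | `[< I x >]].

Fact pri_closed : idealr_closed pri_pred.
Proof.
apply/idealr_closedP; have -> : toI pri_pred = I by apply: predeq => x; apply: ofIE.
by split; [apply: pri_ideal|apply: pri_1].
Qed.
HB.instance Definition _ := isIdealr.Build R pri_pred pri_closed.

Definition quoT := {ideal_quot pri_pred}.
HB.instance Definition _ := GRing.ComNzRing.on quoT.

Definition qcl (x : R) : quoT := \pi_({ideal_quot pri_pred}) x.

Lemma qcl_zmod : zmod_morphism qcl. Proof. by move=> x y; rewrite /qcl rmorphB. Qed.
Lemma qcl_monoid : monoid_morphism qcl.
Proof. by split=> [|x y]; rewrite /qcl ?rmorph1 ?rmorphM. Qed.
HB.instance Definition _ := GRing.isZmodMorphism.Build R quoT qcl qcl_zmod.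
HB.instance Definition _ := GRing.isMonoidMorphism.Build R quoT qcl qcl_monoid.

Lemma qcl_surj c : exists x, qcl x = c.
Proof. by exists (repr c); rewrite /qcl reprK. Qed.

Lemma qcl0 x : qcl x = 0 <-> I x.
Proof.
rewrite -[0](rmorph0 qcl); split=> [/eqP|Ix].
  by rewrite -Quotient.idealrBE subr0 inE => /asboolP.
by apply/eqP; rewrite -Quotient.idealrBE subr0 inE; apply/asboolP.
Qed.

End QuotientRing.

(** A copy of the quotient for the classical units; [fquoT] is another copy, for the field
    structure. *)
Definition uquoT (R : comNzRingType) (I : properI R) := quoT I.
HB.instance Definition _ (R : comNzRingType) (I : properI R) :=
  GRing.ComNzRing.on (uquoT I).
HB.instance Definition _ (R : comNzRingType) (I : properI R) :=
  GRing.ComNzRing_hasMulInverse.Build (uquoT I)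
    (@clmulVx _) (@clunitPl _) (@clinv_out _).

Lemma quotient_ring (R : comNzRingType) (I : properI R) :
  exists (C : comUnitRingType) (q : {rmorphism R -> C}),
    (forall c, exists x, q x = c) /\ forall x, q x = 0 <-> I x.
Proof.
have [q qE] := @rmorphism_ex R (uquoT I) (@qcl R I) (@qcl_zmod R I) (@qcl_monoid R I).
exists (uquoT I), q; split=> [c|x]; last by rewrite qE qcl0.
by have [x <-] := qcl_surj c; exists x; rewrite qE.
Qed.

Record maximalI (R : comNzRingType) := MaximalI {
  mxi :> properI R;
  mxi_inv : forall x, ~ mxi x -> exists y, mxi (1 - y * x)
}.

Definition fquoT (R : comNzRingType) (I : maximalI R) := quoT I.
HB.instance Definition _ (R : comNzRingType) (I : maximalI R) :=
  GRing.ComNzRing.on (fquoT I).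

Section QuotientField.
Variables (R : comNzRingType) (I : maximalI R).

Fact fquo_mulVf (x : fquoT I) : x != 0 -> clinv x * x = 1.
Proof.
move=> x0; apply: clmulVx; apply/asboolP; have [y yx] := qcl_surj x.
have [|z Iz] := mxi_inv (m := I) (x := y).
  by move=> /qcl0 y0; move: x0; rewrite -yx y0 eqxx.
exists (qcl I z); rewrite -yx -[LHS](rmorphM (qcl I)).
by apply/esym/eqP; rewrite -subr_eq0 -[1](rmorph1 (qcl I)) -rmorphB; apply/eqP/qcl0.
Qed.

Fact fquo_inv0 : clinv (0 : fquoT I) = 0.
Proof. by apply: clinv_out; rewrite !inE; apply/asboolP => -[y /eqP]; rewrite mulr0 eq_sym oner_eq0. Qed.

HB.instance Definition _ := GRing.ComNzRing_isField.Build (fquoT I) fquo_mulVf fquo_inv0.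
End QuotientField.

Lemma residue_field (A : comUnitRingType) : ideal (@mI A) ->
  exists (k : fieldType) (r : {rmorphism A -> k}),
    (forall c, exists x, r x = c) /\ forall x, r x = 0 <-> mI x.
Proof.
move=> lA; have m1 : ~ @mI A 1 by rewrite /mI unitr1.
have mV x : ~ ProperI lA m1 x -> exists y, ProperI lA m1 (1 - y * x).
  move=> /mI_nunit Ux; exists x^-1; rewrite mulVr // subrr; exact: ideal0 lA.
pose M := MaximalI mV.
have [q qE] := @rmorphism_ex A (fquoT M) (@qcl A M) (@qcl_zmod A M) (@qcl_monoid A M).
exists (fquoT M), q; split=> [c|x]; last by rewrite qE qcl0.
by have [x <-] := qcl_surj c; exists x; rewrite qE.
Qed.

(** * Rings of sequences; rings with principal maximal ideal *)

Record sq (T : comNzRingType) := Sq { sv : nat -> T }.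
HB.instance Definition _ (T : comNzRingType) := gen_eqMixin (sq T).
HB.instance Definition _ (T : comNzRingType) := gen_choiceMixin (sq T).

Section SequenceRing.
Variable T : comNzRingType.
Implicit Types f g h : sq T.

Lemma sq_ext f g : (forall n, sv f n = sv g n) -> f = g.
Proof. by case: f g => [f] [g] /= fg; congr Sq; apply: funext. Qed.

Definition sq0 : sq T := Sq (fun=> 0).
Definition sq1 : sq T := Sq (fun=> 1).
Definition sqadd f g := Sq (fun n => sv f n + sv g n).
Definition sqopp f := Sq (fun n => - sv f n).
Definition sqmul f g := Sq (fun n => sv f n * sv g n).

Fact sqaddA : associative sqadd.
Proof. by move=> f g h; apply: sq_ext => n /=; rewrite addrA. Qed.
Fact sqaddC : commutative sqadd.
Proof. by move=> f g; apply: sq_ext => n /=; rewrite addrC. Qed.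
Fact sqadd0 : left_id sq0 sqadd.
Proof. by move=> f; apply: sq_ext => n /=; rewrite add0r. Qed.
Fact sqaddN : left_inverse sq0 sqopp sqadd.
Proof. by move=> f; apply: sq_ext => n /=; rewrite addNr. Qed.
HB.instance Definition _ := GRing.isZmodule.Build (sq T) sqaddA sqaddC sqadd0 sqaddN.

Fact sqmulA : associative sqmul.
Proof. by move=> f g h; apply: sq_ext => n /=; rewrite mulrA. Qed.
Fact sqmulC : commutative sqmul.
Proof. by move=> f g; apply: sq_ext => n /=; rewrite mulrC. Qed.
Fact sqmul1 : left_id sq1 sqmul.
Proof. by move=> f; apply: sq_ext => n /=; rewrite mul1r. Qed.
Fact sqmulDl : left_distributive sqmul sqadd.
Proof. by move=> f g h; apply: sq_ext => n /=; rewrite mulrDl. Qed.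
Fact sq1_neq0 : sq1 != 0.
Proof.
apply/eqP => /(congr1 (fun f => sv f 0)) /= /eqP; by rewrite (negPf (oner_neq0 T)).
Qed.
HB.instance Definition _ := GRing.Zmodule_isComNzRing.Build (sq T)
  sqmulA sqmulC sqmul1 sqmulDl sq1_neq0.

Lemma svD f g n : sv (f + g) n = sv f n + sv g n. Proof. by []. Qed.
Lemma sv_nat m n : sv (m%:R : sq T) n = m%:R.
Proof. by elim: m => // m IH; rewrite -addn1 !natrD svD IH. Qed.
End SequenceRing.

Section PrincipalMaximalIdeal.
Variables (C : comUnitRingType) (t : C).
Hypothesis mt : @mI C = adj zeroid t.

Lemma principal_mI : ideal (@mI C).
Proof. by rewrite mt; apply/adj_ideal/zeroid_ideal. Qed.

Lemma mI_mul c : mI c -> exists d, c = d * t.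
Proof. by rewrite mt => -[d /eqP]; rewrite subr_eq0 => /eqP ->; exists d. Qed.

Lemma principal_pw n c : pw (@mI C) n c <-> exists d, c = d * t ^+ n.
Proof.
have mt' : mI t by rewrite mt; apply/adj_self/zeroid_ideal.
split=> [|[d ->]]; last first.
  by apply: (idealM (pw_ideal n principal_mI)); apply: pwX.
elim: n c => [|n IH] c; first by exists c; rewrite expr0 mulr1.
elim=> [|x y _ [d ->] _ [e ->]|a b /mI_mul[d ->] /IH[e ->]].
- by exists 0; rewrite mul0r.
- by exists (d + e); rewrite mulrDl.
- by exists (d * e); rewrite exprS; ring.
Qed.

Hypothesis sepC : forall x : C, (forall n, pw (@mI C) n x) -> x = 0.

(** If division by t never ended in a unit, c would be divisible by all t^n and vanish by
    separatedness. *)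
Lemma principal_factor c : c != 0 -> exists n u, u \is a GRing.unit /\ c = u * t ^+ n.
Proof.
move=> c0; apply: contrapT => nf; move/eqP: c0; apply; apply: sepC => n.
apply/principal_pw; elim: n => [|n [d dE]]; first by exists c; rewrite expr0 mulr1.
have [|e de] := @mI_mul d.
  by apply/negP => Ud; apply: nf; exists n, d.
by exists e; rewrite dE de exprS mulrA.
Qed.

Lemma principal_noeth : noeth C.
Proof.
move=> I iI; have [I0|] := pselect (forall x, I x -> x = 0).
  exists [::]; apply: predeq => x; split=> [/I0//|->]; exact: ideal0.
move=> /existsNP[x /not_implyP[Ix /eqP x0]].
have In y : I y -> y != 0 -> exists n u, I (t ^+ n) /\ y = u * t ^+ n.
  move=> Iy /principal_factor[n [u [Uu yE]]]; exists n, u; split=> //.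
  by apply: (ideal_unit iI Uu); rewrite -yE.
have exI : exists n, `[< I (t ^+ n) >].
  by have [n [u [In' _]]] := In x Ix x0; exists n; apply/asboolP.
case: (ex_minnP exI) => n /asboolP Itn nmin.
exists [:: t ^+ n]; apply: predeq => y; split=> [Iy|[d /eqP]]; last first.
  by rewrite subr_eq0 => /eqP ->; apply: idealM.
have [->|y0] := eqVneq y 0.
  exact: ideal0 (adj_ideal _ (@zeroid_ideal C)).
have [m [u [Itm ->]]] := In y Iy y0.
have nm : (n <= m)%N by apply: nmin; apply/asboolP.
rewrite -(subnK nm) exprD mulrA; apply: adj_mul; exact: zeroid_ideal.
Qed.

End PrincipalMaximalIdeal.

(** * The Cohen ring and its map to A *)

Section CohenRing.
Variables (p : nat) (pp : prime p) (T : comNzRingType) (k : fieldType).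
Variable r : {rmorphism T -> k}.
Hypothesis pk : p \in [pchar k].
Hypothesis r_surj : forall x, exists t, r t = x.
Hypothesis p_nonnil : forall n, ~ pw (kerJ r) n.+1 (p%:R ^+ n).

Let J := kerJ r.
Let D := tower p r_surj.
Let iJ : ideal J. Proof. exact: kerJ_ideal. Qed.
Let iF n : ideal (pw J n). Proof. exact: pw_ideal. Qed.
Let Fle m n x : (m <= n)%N -> pw J n x -> pw J m x. Proof. exact: pw_le. Qed.

(* The Cohen ring of k is the ring of coherent sequences modulo those that tend
   to 0 for the kernel filtration. *)
Definition coherent (w : nat -> T) :=
  forall n, D n (w n) /\ pw J n.+1 (w n.+1 - w n).

Lemma coherent_nat m : coherent (fun=> m%:R).
Proof. by move=> n; rewrite subrr; split; [apply: sr_nat|apply: (ideal0 (iF n.+1))]. Qed.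

Lemma coherentB u v : coherent u -> coherent v -> coherent (fun n => u n - v n).
Proof.
move=> cu cv n; have [Du Fu] := cu n; have [Dv Fv] := cv n; split; first exact: sr_B.
have -> : u n.+1 - v n.+1 - (u n - v n) = (u n.+1 - u n) - (v n.+1 - v n) by ring.
exact: (idealB (iF n.+1)).
Qed.

Lemma coherentM u v : coherent u -> coherent v -> coherent (fun n => u n * v n).
Proof.
move=> cu cv n; have [Du Fu] := cu n; have [Dv Fv] := cv n; split; first exact: sr_M.
have -> : u n.+1 * v n.+1 - u n * v n = (u n.+1 - u n) * v n.+1 + u n * (v n.+1 - v n) by ring.
apply: (idealD (iF n.+1)); first exact: (idealRM _ (iF n.+1)).
exact: (idealM (iF n.+1)).
Qed.

Lemma coherentD u v : coherent u -> coherent v -> coherent (fun n => u n + v n).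
Proof.
move=> cu cv n; have [Du Fu] := cu n; have [Dv Fv] := cv n; split; first exact: sr_D.
have -> : u n.+1 + v n.+1 - (u n + v n) = (u n.+1 - u n) + (v n.+1 - v n) by ring.
exact: (idealD (iF n.+1)).
Qed.

Lemma coherent_start t : exists2 w, coherent w & w 0%N = t.
Proof.
have /choice[g gP] : forall nz : nat * T, exists w, D nz.1 nz.2 ->
    D nz.1.+1 w /\ pw J nz.1.+1 (w - nz.2).
  move=> [n z]; have [Dz|nz] := pselect (D n z); last by exists 0.
  have [w Dw Fw] := tower_approx pp pk Dz; exists w => _; split=> //=.
  exact: (ideal_sym (iF n.+1)).
pose w := fix w n := if n is n'.+1 then g (n', w n') else t.
have Dw n : D n (w n).
  by elim: n => // n IH; case: (gP (n, w n) IH).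
by exists w => // n; split=> //; case: (gP (n, w n) (Dw n)).
Qed.

Lemma coherent_ker w : coherent w -> J (w 0%N) -> forall n, J (w n).
Proof.
move=> cw J0; elim=> // n IH; have [_ Fw] := cw n.
by apply: (ideal_trans iJ _ IH); apply/(pw1 _ iJ); apply: Fle Fw.
Qed.

(** The term w_(n+1) is divided, because [tower_ker] returns cofactors one level lower: hence the
    shift of index. Their coherence is cancellation of p by [tower_divp]. *)
Lemma coherent_div w : coherent w -> J (w 0%N) ->
  exists2 v, coherent v & forall n, pw J n.+1 (w n - p%:R * v n).
Proof.
move=> cw J0; have Jw := coherent_ker cw J0.
have /choice[v /choice[e veP]] : forall n, exists c e,
    [/\ D n c, pw J n.+2 e & w n.+1 = p%:R * c + e].
  by move=> n; have [Dw _] := cw n.+1; apply: (tower_ker pp pk Dw (Jw n.+1)).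
exists v => n; have [Dv Fe wE] := veP n; have [Dv' Fe' wE'] := veP n.+1; last first.
  have -> : w n - p%:R * v n = e n - (w n.+1 - w n) by rewrite wE; ring.
  by apply: (idealB (iF n.+1)); [apply: Fle Fe|case: (cw n)].
split=> //; rewrite -[_ - _]mul1r -(expr0 p%:R).
apply: (tower_divp pp pk p_nonnil (n := n)); last 1 first.
- rewrite expr1.
  have -> : p%:R * (v n.+1 - v n) = (w n.+2 - w n.+1) - e n.+1 + e n by rewrite wE wE'; ring.
  apply: (idealD (iF n.+2)) => //; apply: (idealB (iF n.+2)); first by case: (cw n.+1).
  exact: Fle Fe'.
- by apply: sr_B => //; apply: (tower_S).
- by rewrite addn0.
Qed.

Lemma coherent_cancel w : coherent w -> (forall n, pw J n.+1 (p%:R * w n)) ->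
  forall n, pw J n.+1 (w n).
Proof.
move=> cw pw0 n; have [_ Fw] := cw n; have [Dw _] := cw n.+1.
have Fw1 : pw J n.+1 (w n.+1).
  rewrite -[w _]mul1r -(expr0 p%:R); apply: (tower_divp pp pk p_nonnil Dw); rewrite ?expr1 //.
  by rewrite addn0.
have -> : w n = w n.+1 - (w n.+1 - w n) by ring.
exact: (idealB (iF n.+1)).
Qed.

(** A p-adic series truncated diagonally: the summand that appears at index n + 1 carries p^(n+1).
    It yields the limits in the Cohen ring. *)
Lemma coherent_sum (y : nat -> nat -> T) : (forall i, coherent (y i)) ->
  coherent (fun n => \sum_(i < n.+1) p%:R ^+ i * y i n).
Proof.
move=> cy n; split.
  apply: sr_sum => i _; apply: sr_M; first by apply/sr_X/sr_nat.
  by case: (cy i n).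
rewrite big_ord_recr /= addrAC -sumrB; apply: (idealD (iF n.+1)).
  apply: (ideal_sum _ (iF n.+1)) => i _; rewrite -mulrBr.
  by apply: (idealM (iF n.+1)); case: (cy i n).
by apply: (idealRM _ (iF n.+1)); apply: pw_exp_p.
Qed.

Lemma coherent_geom z : coherent z -> J (z 0%N) ->
  coherent (fun n => \sum_(i < n.+1) z n ^+ i).
Proof.
move=> cz J0 n; have Jz := coherent_ker cz J0; split.
  by apply: sr_sum => i _; apply: sr_X; case: (cz n).
rewrite big_ord_recr /= addrAC -sumrB; apply: (idealD (iF n.+1)); last exact: pwX.
apply: (ideal_sum _ (iF n.+1)) => i _; rewrite subrXX.
by apply: (idealRM _ (iF n.+1)); case: (cz n).
Qed.

(** A lift u of the inverse residue is corrected by the geometric series of z = 1 - w u, which lies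
    in the kernel. *)
Lemma coherent_inv w : coherent w -> ~ J (w 0%N) ->
  exists2 v, coherent v & forall n, pw J n.+1 (w n * v n - 1).
Proof.
move=> cw /eqP r0; have [t rt] := r_surj (r (w 0%N))^-1.
have [u cu u0] := coherent_start t.
pose z n := 1%:R - w n * u n.
have cz : coherent z by apply: coherentB; [apply: coherent_nat|apply: coherentM].
have Jz : J (z 0%N).
  by rewrite /J /kerJ rmorphB rmorph1 rmorphM u0 rt divff // subrr.
exists (fun n => u n * \sum_(i < n.+1) z n ^+ i).
  by apply: coherentM => //; apply: coherent_geom.
move=> n; have -> : w n * (u n * \sum_(i < n.+1) z n ^+ i) - 1 = - z n ^+ n.+1.
  have := subrXX 1 (z n) n.+1; rewrite expr1n.
  under eq_bigr do rewrite expr1n mul1r.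
  have -> : 1 - z n = w n * u n by rewrite /z; ring.
  by rewrite mulrA => <-; ring.
by apply: (idealN (iF n.+1)); apply: pwX; apply: coherent_ker.
Qed.

(** Exports the quotient as a map on plain sequences with its algebraic rules, so that the subring
    and quotient types do not appear further on. *)
Lemma coherent_quotient : exists (C : comUnitRingType) (cl : (nat -> T) -> C),
  [/\ forall c, exists2 w, coherent w & cl w = c,
      forall w, coherent w -> cl w = 0 <-> forall n, pw J n.+1 (w n),
      forall u v, coherent u -> coherent v -> cl (fun n => u n - v n) = cl u - cl v,
      forall u v, coherent u -> coherent v -> cl (fun n => u n * v n) = cl u * cl v &
      forall m, cl (fun=> m%:R) = m%:R].
Proof.
pose P (f : sq T) := coherent (sv f).
have P1 : P 1 by exact: (coherent_nat 1).
have PB f g : P f -> P g -> P (f - g) by apply: coherentB.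
have PM f g : P f -> P g -> P (f * g) by apply: coherentM.
pose F := Subring P1 PB PM.
pose N (f : srT F) := forall n, pw J n.+1 (sv (sr_val f) n).
have iN : ideal N.
  split=> [n|f g Nf Ng n|f g Ng n]; first exact: (ideal0 (iF n.+1)).
    exact: (idealD (iF n.+1)).
  exact: (idealM (iF n.+1)).
have N1 : ~ N 1.
  by move=> /(_ 0%N)/(pw1 _ iJ); rewrite /J /kerJ rmorph1 => /eqP; rewrite oner_eq0.
have [C [q [qs q0]]] := quotient_ring (ProperI iN N1).
pose cl w := if pselect (coherent w) is left cw then
  q (@sr_elt _ F (Sq w) cw) else 0.
have clE w (cw : coherent w) : cl w = q (@sr_elt _ F (Sq w) cw).
  rewrite /cl; case: pselect => // cw'; congr (q _).
  exact: sr_inj.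
exists C, cl; split.
- move=> c; have [f fc] := qs c; have cf := sr_eltP f.
  exists (sv (sr_val f)) => //; rewrite clE -fc; congr (q _); apply: sr_inj => /=.
  by case: (sr_val f).
- by move=> w cw; rewrite clE q0.
- move=> u v cu cv; rewrite (clE _ cu) (clE _ cv) (clE _ (coherentB cu cv)) -rmorphB.
  by congr (q _); apply: sr_inj; apply: sq_ext.
- move=> u v cu cv; rewrite (clE _ cu) (clE _ cv) (clE _ (coherentM cu cv)) -rmorphM.
  by congr (q _); apply: sr_inj; apply: sq_ext.
- move=> m; rewrite (clE _ (coherent_nat m)) -(rmorph_nat q); congr (q _).
  apply: sr_inj; rewrite [RHS](rmorph_nat (val : srT F -> sq T)); apply: sq_ext => n.
  by rewrite sv_nat.
Qed.

Variable A : comUnitRingType.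
Hypothesis cA : cnl A.
Variable ev : {rmorphism T -> A}.
Hypothesis evJ : forall t, J t -> mI (ev t).
Hypothesis ev_res : forall a, exists t, mI (a - ev t).

(** C is separated and complete, and its maximal ideal is generated by the nonzerodivisor p, so it
    is regular with the single parameter p. Its map to A is the limit of the images of the terms of
    representing sequences. *)
Lemma cover_charp : exists (C : comUnitRingType) (phi : {rmorphism C -> A}) s,
  cover phi s /\ forall a, exists c, mI (a - phi c).
Proof.
have [lA _ _] := cA.
have pwA n : ideal (pw (@mI A) n) by apply: pw_ideal.
have [C [cl [cl_surj cl0 clB clM clN]]] := coherent_quotient.
have cl_eq u v : coherent u -> coherent v -> cl u = cl v <-> forall n, pw J n.+1 (u n - v n).
  move=> cu cv; rewrite -(cl0 _ (coherentB cu cv)) clB //.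
  by split=> [->|/eqP]; [rewrite subrr|rewrite subr_eq0 => /eqP].
have cl1 : cl (fun=> 1%:R) = 1 := clN 1%N.
have cln m w : coherent w -> m%:R * cl w = cl (fun n => m%:R * w n).
  by move=> cw; rewrite -clN -clM //; apply: coherent_nat.
have clD u v : coherent u -> coherent v -> cl (fun n => u n + v n) = cl u + cl v.
  move=> cu cv; have cuv := coherentD cu cv; apply/eqP.
  rewrite -subr_eq -clB //; apply/eqP.
  by congr cl; apply: funext => n; rewrite addrK.
have mt : @mI C = adj zeroid p%:R.
  apply: predeq => c; split.
    move=> mc; have [w cw wc] := cl_surj c.
    have [|v cv wv] := coherent_div cw.
      apply: contrapT => /(coherent_inv cw)[v cv wv].
      move: mc; rewrite /mI -wc => /negP; apply; apply/unitrPr; exists (cl v).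
      rewrite -clM // -cl1; apply/cl_eq => //; first exact: coherentM.
      exact: coherent_nat.
    exists (cl v); apply/eqP; rewrite subr_eq0 mulrC cln // -wc; apply/eqP.
    apply/cl_eq => //; apply: coherentM => //; exact: coherent_nat.
  move=> [d /eqP]; rewrite subr_eq0 => /eqP ->; apply/negP => /unitrPr[e].
  rewrite mulrAC mulrC; have [w cw <-] := cl_surj (d * e); rewrite cln // -cl1.
  move/cl_eq => /(_ (coherentM (coherent_nat p) cw) (coherent_nat 1) 0%N)/(pw1 _ iJ).
  rewrite /J /kerJ rmorphB rmorphM rmorph1 rmorph_nat (pcharf0 pk) mul0r sub0r.
  by move/eqP; rewrite oppr_eq0 oner_eq0.
have lC := principal_mI mt.
have pX n w : coherent w -> p%:R ^+ n * cl w = cl (fun m => p%:R ^+ n * w m).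
  by move=> cw; rewrite -natrX cln //; congr cl; apply: funext => m; rewrite natrX.
have cpX n w : coherent w -> coherent (fun m => p%:R ^+ n * w m).
  by move=> cw; have := coherentM (coherent_nat (p ^ n)) cw; rewrite natrX.
have sepC (c : C) : (forall n, pw (@mI C) n c) -> c = 0.
  move=> Hc; have [w cw wc] := cl_surj c; rewrite -wc; apply/(cl0 _ cw) => n.
  have /(principal_pw mt)[d dE] := Hc n.+1; have [v cv vd] := cl_surj d.
  move: dE; rewrite -wc -vd mulrC pX // => /cl_eq-/(_ cw (cpX _ _ cv))/(_ n) H.
  apply: (ideal_trans (iF n.+1) H); apply: (idealRM _ (iF n.+1)); exact: pw_exp_p.
have limC (u : nat -> C) : (forall n, pw (@mI C) n (u n.+1 - u n)) ->
    exists l, forall n, pw (@mI C) n (u n - l).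
  move=> Hu; have /choice[y yP] : forall n, exists y, coherent y /\
      u n.+1 - u n = p%:R ^+ n * cl y.
    move=> n; have /(principal_pw mt)[d dE] := Hu n; have [y cy yd] := cl_surj d.
    by exists y; rewrite yd mulrC.
  have cy i : coherent (y i) by case: (yP i).
  (* The tails S_n = sum_i p^i y_(n+i) satisfy S_n = y_n + p S_(n+1), so u_n + p^n S_n does not
     depend on n: this is the limit. *)
  pose S n := cl (fun m => \sum_(i < m.+1) p%:R ^+ i * y (n + i)%N m).
  have cS n : coherent (fun m => \sum_(i < m.+1) p%:R ^+ i * y (n + i)%N m).
    exact: (@coherent_sum (fun i => y (n + i)%N)).
  have SE n : S n = cl (y n) + p%:R * S n.+1.
    rewrite /S cln //.
    have c1 : coherent (fun m => p%:R * \sum_(i < m.+1) p%:R ^+ i * y (n.+1 + i)%N m).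
      by apply: coherentM; [apply: coherent_nat|apply: cS].
    rewrite -clD //; apply/cl_eq; [exact: cS|exact: coherentD|].
    move=> m; rewrite big_ord_recl expr0 mul1r addn0 opprD addrACA subrr add0r.
    rewrite big_ord_recr mulrDr opprD addrA mulr_sumr -sumrB big1 ?sub0r.
      apply: (idealN (iF m.+1)); rewrite mulrA -exprS; apply: (idealRM _ (iF m.+1)).
      exact: pw_exp_p.
    by move=> i _; rewrite mulrA -exprS /= addnS addSn subrr.
  have uE n : u n + p%:R ^+ n * S n = u 0%N + S 0%N.
    elim: n => [|n <-]; first by rewrite expr0 mul1r.
    have [_ yE] := yP n; rewrite [S n]SE mulrDr addrA -yE exprSr mulrA.
    by congr (_ + _); ring.
  exists (u 0%N + S 0%N) => n; rewrite -(uE n) opprD addrA subrr sub0r.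
  apply: (idealN (pw_ideal n lC)); apply/(principal_pw mt); exists (S n).
  by rewrite mulrC.
have cnlC : cnl C by split=> //; apply: principal_noeth mt sepC.
have pwev n x : pw J n x -> pw (@mI A) n (ev x).
  elim: n x => // n IH x; elim=> [|a b _ Ha _ Hb|a b Ja pb].
  - by rewrite rmorph0; apply: mulI0.
  - by rewrite rmorphD; apply: mulID.
  - by rewrite rmorphM; apply: mulIM; [apply: evJ|apply: IH].
have /choice[rp rpP] : forall c, exists w, coherent w /\ cl w = c.
  by move=> c; have [w cw wc] := cl_surj c; exists w.
have crp c : coherent (rp c) by case: (rpP c).
have clrp c : cl (rp c) = c by case: (rpP c).
have [n c|n c d|n c d|n|phi phiP] := @cnl_rmorphism_lim A cA C (fun n c => ev (rp c n)).
- by rewrite -rmorphB; apply: pwev; apply: (Fle (leqnSn n)); case: (crp c n).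
- rewrite -!rmorphB; apply: pwev; apply: (Fle (leqnSn n)).
  have := coherentB (crp c) (crp d) => cB.
  by move: n; apply/(cl_eq _ _ (crp _) cB); rewrite clB // !clrp.
- rewrite -rmorphM -rmorphB; apply: pwev; apply: (Fle (leqnSn n)).
  have := coherentM (crp c) (crp d) => cM.
  by move: n; apply/(cl_eq _ _ (crp _) cM); rewrite clM // !clrp.
- rewrite -(rmorph1 ev) -rmorphB; apply: pwev; apply: (Fle (leqnSn n)).
  by move: n; apply/(cl_eq _ _ (crp _) (coherent_nat 1)); rewrite clN clrp.
exists C, phi, [:: p%:R]; split; first split=> //.
- split=> // c; have [w cw <-] := cl_surj c; rewrite cln // => /cl0 H.
  apply/(cl0 _ cw); apply: (coherent_cancel cw); apply: H.
  by apply: coherentM => //; apply: coherent_nat.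
- move=> c; rewrite mt => -[d /eqP]; rewrite subr_eq0 => /eqP ->.
  rewrite rmorphM rmorph_nat; apply: idealM => //.
  by rewrite -(rmorph_nat ev); apply: evJ; apply: kerJ_p.
move=> a; have [t mt'] := ev_res a; have [w cw w0] := coherent_start t.
pose c := cl w; exists c.
have Jt : J (t - rp c 1%N).
  have -> : t - rp c 1%N = - ((rp c 1%N - w 1%N) + (w 1%N - w 0%N)) by rewrite w0; ring.
  apply: (idealN iJ); apply: (idealD iJ); apply/(pw1 _ iJ); last by case: (cw 0%N).
  by apply: (Fle (leqnSn 1)); move/(cl_eq _ _ (crp c) cw): (clrp c); apply.
have -> : a - phi c = (a - ev t) + ev (t - rp c 1%N) + (ev (rp c 1%N) - phi c).
  by rewrite rmorphB; ring.
apply: (idealD lA); last by apply/(pw1 _ lA); apply: phiP.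
by apply: (idealD lA) => //; apply: evJ.
Qed.

End CohenRing.

(** * Frobenius lifts and the order of p in a free ring *)

Section FrobeniusLift.
Variables (p : nat) (pp : prime p) (T : comNzRingType) (fr : {rmorphism T -> T}).

Definition frob_lift x := exists d, fr x = x ^+ p + p%:R * d.

Lemma frob_lift1 : frob_lift 1.
Proof. by exists 0; rewrite rmorph1 expr1n mulr0 addr0. Qed.

Lemma frob_liftB x y : frob_lift x -> frob_lift y -> frob_lift (x - y).
Proof.
move=> [d dE] [e eE].
have [q _] := @binomial_prime p pp T (full_subring T) (x - y) y Logic.I Logic.I.
rewrite subrK => qE; exists (d - e + (x - y) * y * q).
by rewrite rmorphB dE eE qE; ring.
Qed.

Lemma frob_liftM x y : frob_lift x -> frob_lift y -> frob_lift (x * y).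
Proof.
move=> [d dE] [e eE]; exists (x ^+ p * e + d * y ^+ p + p%:R * (d * e)).
by rewrite rmorphM dE eE exprMn; ring.
Qed.

(** As a subring it is everything once it contains the monomials, on which the lift is the p-th
    power. *)
Definition frob_lifts := Subring frob_lift1 frob_liftB frob_liftM.

End FrobeniusLift.

Section FreeRing.
Import finmap monalg.
Variable A : comNzRingType.

Let T := {malg int[{cmonom A}]}.

(* T is the monoid ring over the integers of the free commutative monoid on A:
   it maps onto A, has no p-torsion and carries a lift of Frobenius. *)
Definition monom (m : {cmonom A}) : T := mkmalgU m 1.

Lemma monomM m n : monom (mmul m n) = monom m * monom n.
Proof. by rewrite malgM_def fgmulUU mulr1. Qed.

Section Hom.
Variables (S : comNzRingType) (h : {cmonom A} -> S).
Hypothesis hP : mmorphism h.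
Definition free_monhom := h.
HB.instance Definition _ := isMultiplicative.Build _ _ free_monhom hP.

Lemma free_hom : exists f : {rmorphism T -> S}, forall m, f (monom m) = h m.
Proof.
exists (mmap (intmul 1) free_monhom) => m.
by rewrite /monom [LHS]mmapU; apply: mul1r.
Qed.
End Hom.

Lemma free_ind (F : subring T) : (forall m, F (monom m)) -> forall x, F x.
Proof.
move=> Fm x; rewrite (monalgE x); apply: sr_sum => m _.
have -> : mkmalgU m (mcoeff m x) = (mcoeff m x)%:~R * monom m.
  have -> : (mcoeff m x)%:~R = malgC (mcoeff m x) :> T.
    by rewrite -[in RHS](intz (mcoeff m x)) rmorph_int.
  by rewrite malgM_def fgmulUU mulr1 mul1m.
apply: sr_M => //; case: (mcoeff m x) => n; first exact: (sr_nat F n).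
by rewrite NegzE rmorphN; apply: sr_N; apply: (sr_nat F n.+1).
Qed.

Definition mon_eval (m : {cmonom A}) : A := \prod_(i <- finsupp m) i ^+ m i.

Lemma mon_evalEw (m : {cmonom A}) (d : {fset A}) : (finsupp m `<=` d)%fset ->
  mon_eval m = \prod_(i <- d) i ^+ m i.
Proof.
move=> le; rewrite /mon_eval (big_fset_incl _ le) //.
by move=> i _; rewrite -cmE_neq0 negbK => /eqP ->; rewrite expr0.
Qed.

Lemma mon_evalP : mmorphism mon_eval.
Proof.
split; last by rewrite /mon_eval mdom1 big_seq_fset0.
move=> m n; pose d := fsetU (finsupp m) (finsupp n).
rewrite (mon_evalEw (d := d) (fsubsetUl _ _)) (mon_evalEw (m := n) (d := d) (fsubsetUr _ _)).
rewrite /mon_eval mdomD -/d -[RHS]big_split /=.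
by apply: eq_bigr => i _; rewrite cmM exprD.
Qed.

Lemma free_ring_exists p : prime p ->
  exists (T : comNzRingType) (ev : {rmorphism T -> A}) (fr : {rmorphism T -> T}),
  [/\ forall a, exists t, ev t = a, forall x, exists d, fr x = x ^+ p + p%:R * d &
      forall x : T, p%:R * x = 0 -> x = 0].
Proof.
move=> pp; have [ev evE] := free_hom mon_evalP.
have frP : mmorphism (fun m => monom m ^+ p).
  by split=> [m n|]; rewrite ?monomM ?exprMn // expr1n.
have [fr frE] := free_hom frP.
exists T, ev, fr; split.
- move=> a; exists (monom (ucm a)); rewrite evE /mon_eval mdomU big_seq_fset1.
  by rewrite cmUU expr1.
- apply: (@free_ind (frob_lifts pp fr)) => m.
  by exists 0; rewrite frE mulr0 addr0.
- move=> x; rewrite mulr_natl => px; apply/malgP => m.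
  have /eqP := congr1 (mcoeff m) px.
  rewrite mcoeffMn mcoeff0 Num.Theory.mulrn_eq0 => /orP[/eqP p0|/eqP -> //].
  by move: pp; rewrite p0.
Qed.

End FreeRing.

Section DeltaRing.
Variables (p : nat) (pp : prime p) (T : comNzRingType) (k : fieldType).
Variables (r : {rmorphism T -> k}) (fr : {rmorphism T -> T}).
Hypothesis pk : p \in [pchar k].
Hypothesis frP : forall x, exists d, fr x = x ^+ p + p%:R * d.
Hypothesis ptf : forall x : T, p%:R * x = 0 -> x = 0.

Let J := kerJ r.
Let iJ : ideal J. Proof. exact: kerJ_ideal. Qed.
Let iF n : ideal (pw J n). Proof. exact: pw_ideal. Qed.

Lemma p_inj (x y : T) : p%:R * x = p%:R * y -> x = y.
Proof.
move=> xy; apply/eqP; rewrite -subr_eq0; apply/eqP/ptf.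
by rewrite mulrBr xy subrr.
Qed.

(* The delta operation attached to the Frobenius lift lowers the order of
   vanishing along the kernel of r by at most one. *)
Lemma delta_pw m x d : pw J m.+1 x -> fr x = x ^+ p + p%:R * d -> pw J m d.
Proof.
have p0 := prime_gt0 pp.
elim: m x d => [//|m IH] x d.
have Jp : J p%:R by apply: kerJ_p.
suff H : pw J m.+2 x -> exists2 d, pw J m.+1 d & fr x = x ^+ p + p%:R * d.
  by move=> /H[e pe ->] /addrI/p_inj <-.
elim=> [|y z py [d1 p1 E1] pz [d2 p2 E2]|a y Ja py].
- exists 0; first exact: mulI0.
  by rewrite rmorph0 mulr0 addr0 expr0n; case: (p) p0.
- have [q _ qE] := @binomial_prime p pp T (full_subring T) y z Logic.I Logic.I.
  exists (d1 + d2 - y * z * q); last by rewrite rmorphD E1 E2 qE; ring.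
  apply: (idealB (iF m.+1)); first exact: (idealD (iF m.+1)).
  by rewrite -mulrA; apply: (idealRM _ (iF m.+1)); apply: (pwS iJ).
have [da aE] := frP a; have [dy yE] := frP y; have pdy := IH _ _ py yE.
exists (a ^+ p * dy + da * y ^+ p + p%:R * (da * dy)); last first.
  by rewrite rmorphM aE yE exprMn; ring.
apply: (idealD (iF m.+1)); first apply: (idealD (iF m.+1)).
- rewrite -(prednK p0) exprS -mulrA; apply: mulIM => //; exact: (idealM (iF m)).
- apply: (idealM (iF m.+1)); rewrite -(prednK p0) exprS; exact: (idealRM _ (iF m.+1)).
- by apply: mulIM => //; apply: (idealM (iF m)).
Qed.

(** Descent on n: delta of p^(n+1) is p^n - p^((n+1)p - 1), whose second term has order at least n +
    1. Excessive vanishing of p^(n+1) is thus handed down to p^n, and in the end to 1. *)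
Lemma p_not_nilpotent n : ~ pw J n.+1 (p%:R ^+ n).
Proof.
have p1 := prime_gt1 pp; elim: n => [|n IH].
  by move=> /(pw1 _ iJ); rewrite /J /kerJ rmorph1 => /eqP; rewrite oner_eq0.
move=> H; apply: IH.
have E : (n.+1 * p = (n.+1 * p).-1.+1)%N by rewrite prednK // muln_gt0; lia.
have e : fr (p%:R ^+ n.+1) =
    (p%:R ^+ n.+1) ^+ p + p%:R * (p%:R ^+ n - p%:R ^+ (n.+1 * p).-1).
  rewrite rmorphXn rmorph_nat -exprM mulrBr -[p%:R * p%:R ^+ n]exprS.
  by rewrite -[p%:R * _ ^+ _.-1]exprS -E addrC subrK.
have H' := delta_pw H e.
apply: (ideal_trans (iF n.+1) H').
have le : (n.+1 <= (n.+1 * p).-1)%N by nia.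
apply: (pw_le iJ le); apply: pwX; exact: kerJ_p.
Qed.

End DeltaRing.

(** If some positive integer is a nonunit, so is one of its prime factors p, and a Cohen ring of the
    residue field serves; otherwise there is a coefficient field. The free ring T maps onto A and
    through A onto the residue field, which makes the Cohen ring map to A. *)
Theorem cohen_structure (A : comUnitRingType) : cnl A ->
  exists (R : comUnitRingType) (psi : {rmorphism R -> A}),
  [/\ cnl R, regular_local_ring R & forall a, exists r, psi r = a].
Proof.
move=> cA; have [lA _ _] := cA.
suff [C [phi [s [cS res]]]] : exists (C : comUnitRingType) (phi : {rmorphism C -> A}) s,
    cover phi s /\ forall a, exists c, mI (a - phi c).
  exact: (cover_regular cA cS res).
have [[n mn]|nmI] := pselect (exists n, mI (n.+1%:R : A)); last first.
  apply: cover_char0 => // n; apply: mI_nunit => mn; apply: nmI; by exists n.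
have [p pp mp] : exists2 p, prime p & mI (p%:R : A).
  have: mI (n.+1%:R : A) by []; rewrite [n.+1]prod_prime_decomp // natr_prod.
  rewrite -(big_map (fun f => (f.1 ^ f.2)%:R) xpredT id) => /(prime_prod (mI_prime lA)).
  case=> _ /mapP[[q e] qe ->] /=; rewrite natrX => /(primeX (mI_prime lA)) mq.
  by exists q => //; case/mem_prime_decomp: qe.
have [k [r0 [r0s r0J]]] := residue_field lA.
have [T [ev [fr [evs frP ptf]]]] := free_ring_exists A pp.
pose r : {rmorphism T -> k} := r0 \o ev.
have pk : p \in [pchar k].
  by rewrite inE pp /= -(rmorph_nat r0); apply/eqP/r0J.
have rs x : exists t, r t = x.
  by have [a <-] := r0s x; have [t <-] := evs a; exists t.
apply: (cover_charp pp pk rs (p_not_nilpotent pp pk frP ptf) cA (ev := ev)).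
  by move=> t /r0J.
move=> a; have [t <-] := evs a; exists t; rewrite subrr; exact: (ideal0 lA).
Qed.

(** * Lengths over a discrete valuation ring *)

Section CompositionSeries.
Variables (O : comUnitRingType) (M : lmodType O) (pi : O).
Hypothesis mpi : @mI O = adj zeroid pi.
Implicit Types (N : M -> Prop) (z : M).

Definition submod (S : M -> Prop) := [/\ S 0, forall x y, S x -> S y -> S (x + y) &
  forall a x, S x -> S (a *: x)].

Lemma submodN (S : M -> Prop) x : submod S -> S x -> S (- x).
Proof. by move=> [_ _ SZ] Sx; rewrite -scaleN1r; apply: SZ. Qed.

Lemma submodB (S : M -> Prop) x y : submod S -> S x -> S y -> S (x - y).
Proof. by move=> sS Sx Sy; have [_ SD _] := sS; apply: SD => //; apply: submodN. Qed.

Lemma submod_unit (S : M -> Prop) a x : submod S -> a \is a GRing.unit -> S (a *: x) -> S x.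
Proof. by move=> [_ _ SZ] Ua Sax; rewrite -[x]scale1r -(mulVr Ua) -scalerA; apply: SZ. Qed.

Lemma submod_closedP (P : {pred M}) : submod_closed P <-> submod (fun x => x \in P).
Proof.
split=> [[P0 PD]|[P0 PD PZ]].
  split=> // [x y Px Py|a x Px]; first by rewrite -[x]scale1r; apply: PD.
  by rewrite -[_ *: _]addr0; apply: PD.
by split=> // a x y Px Py; apply: PD => //; apply: PZ.
Qed.

Definition sadj N z x := exists a, N (x - a *: z).

Lemma sadj_submod N z : submod N -> submod (sadj N z).
Proof.
move=> sN; have [N0 ND NZ] := sN; split=> [|x y [a Na] [b Nb]|a x [b Nb]].
- by exists 0; rewrite scale0r subr0.
- by exists (a + b); rewrite scalerDl opprD addrACA; apply: ND.
- by exists (a * b); rewrite -scalerA -scalerBr; apply: NZ.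
Qed.

Lemma sadj_sub N z x : N x -> sadj N z x.
Proof. by exists 0; rewrite scale0r subr0. Qed.

(* Bottom-up composition series: each step adds one generator that the
   uniformizer pi sends into the previous submodule. *)
Inductive comp : (M -> Prop) -> nat -> Prop :=
| comp0 : comp (fun x => x = 0) 0
| compS N r z : comp N r -> ~ N z -> N (pi *: z) -> comp (sadj N z) r.+1.

Lemma comp_submod N r : comp N r -> submod N.
Proof.
elim=> [|N' r' z _ sN _ _]; last exact: sadj_submod.
by split=> [//|x y -> ->|a x ->]; rewrite ?addr0 ?scaler0.
Qed.

Definition schain (S : nat -> M -> Prop) n :=
  (forall i, (i <= n)%N -> submod (S i)) /\
  (forall i, (i < n)%N -> (forall x, S i x -> S i.+1 x) /\ exists2 x, S i.+1 x & ~ S i x).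

Lemma submodule_chainP n : submodule_chain M n <-> exists S, schain S n.
Proof.
split=> [[S [sS lS]]|[S [sS lS]]].
  exists (fun i x => x \in S i); split=> i ni; first exact/submod_closedP/sS.
  have [SS /existsNP[x /not_implyP[xS xn]]] := lS i ni; split; first exact: SS.
  by exists x.
exists (fun i => [pred x | `[< S i x >]] : {pred M}).
have E i x : (x \in ([pred x | `[< S i x >]] : {pred M})) <-> S i x by rewrite inE; split=> /asboolP.
split=> i ni.
  have [S0 SD SZ] := sS i ni; apply/submod_closedP; split; first exact/E.
    by move=> x y /E Sx /E Sy; apply/E/SD.
  by move=> a x /E Sx; apply/E/SZ.
have [SS [x Sx nx]] := lS i ni; split; first by move=> y /E/SS/E.
by move=> /(_ x (iffRL (E _ _) Sx))/E.
Qed.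

(** Intersecting a chain in N' + (z) with N' costs at most one step: before the first index j where
    the chain leaves N' nothing changes, and from there on strictness is saved by subtracting
    multiples of an element v of S_j outside N'. *)
Lemma comp_bound N r : comp N r -> forall S n, schain S n ->
  (forall x, S n x -> N x) -> (n <= r)%N.
Proof.
elim=> [|N' r' z cN IH Nz Npz] S n cS SN.
  case: n cS SN => // n [sS lS] SN; have [_ [x /SN -> nx]] := lS n (leqnn _).
  by case: nx; have [] := sS n (leqnSn n).
have sN := comp_submod cN; have [N0 ND NZ] := sN.
have [sS lS] := cS.
have [SnN|/existsNP[u0 /not_implyP[Su0 Nu0]]] := pselect (forall x, S n x -> N' x).
  by apply: leqW; apply: IH cS SnN.
case: n cS SN sS lS Su0 => // n cS SN sS lS Su0; rewrite ltnS.
have mono i j x : (i <= j)%N -> (j <= n.+1)%N -> S i x -> S j x.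
  move=> /subnK <-; elim: (j - i)%N => // d IHd dn Sx.
  by have [SS _] := lS (d + i)%N dn; apply: SS; apply: IHd => //; apply: ltnW.
pose Q i := `[< exists2 x, S i x & ~ N' x >].
have exQ : exists i, Q i by exists n.+1; apply/asboolP; exists u0.
case: (ex_minnP exQ) => j /asboolP[v Sv Nv] jmin.
have jn : (j <= n.+1)%N by apply: jmin; apply/asboolP; exists u0.
have below i : (i < j)%N -> forall x, S i x -> N' x.
  move=> ij x Sx; apply: contrapT => Nx.
  have : (j <= i)%N by apply: jmin; apply/asboolP; exists x.
  by rewrite leqNgt ij.
(* The coefficient b of z in v is a unit, since pi z is in N' and v is not; so a multiple of v moves
   x into N'. *)
have strict i : (j <= i)%N -> (i <= n)%N -> exists2 x, S i.+1 x /\ N' x & ~ S i x.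
  move=> ji ni; have [SS [x Sx nx]] := lS i ni.
  have Svi : S i v by apply: (mono j) => //; apply: leqW.
  have [a Na] := SN _ (mono i.+1 n.+1 _ ni (leqnn _) Sx).
  have [b Nb] := SN _ (mono i n.+1 _ (leqW ni) (leqnn _) Svi).
  have Ub : b \is a GRing.unit.
    apply: mI_nunit; rewrite mpi => -[c /eqP]; rewrite subr_eq0 => /eqP bE.
    apply: Nv; rewrite -(subrK (b *: z) v); apply: ND => //.
    by rewrite bE -scalerA; apply: NZ.
  have sSi := sS i (leqW ni); have sSi1 := sS i.+1 ni.
  exists (x - (a / b) *: v).
    split; first by apply: (submodB sSi1) => //; have [_ _ SZ] := sSi1; apply/SZ/SS.
    have -> : x - (a / b) *: v = (x - a *: z) - (a / b) *: (v - b *: z).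
      by rewrite scalerBr scalerA divrK // opprB addrA subrK.
    by apply: (submodB sN) => //; apply: NZ.
  move=> Sxv; apply: nx; rewrite -(subrK ((a / b) *: v) x).
  by have [_ SD SZ] := sSi; apply: SD => //; apply: SZ.
apply: (IH (fun i x => if (i < j)%N then S i x else S i.+1 x /\ N' x)).
  split=> i ni.
    case: ltnP => ij; first by apply: sS; apply: leqW.
    have [S0 SD SZ] := sS i.+1 ni; split=> // [x y [Sx Nx] [Sy Ny]|a x [Sx Nx]].
      by split; [apply: SD|apply: ND].
    by split; [apply: SZ|apply: NZ].
  case: (ltnP i j) => ij.
    case: (ltnP i.+1 j) => i1j.
      by apply: lS; apply: leqW.
    have ij1 : j = i.+1 by apply/eqP; rewrite eqn_leq i1j ij.
    split=> [x Sx|].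
      split; last exact: below ij _ Sx.
      by apply: (mono i i.+2) => //; lia.
    have [x [Sx Nx] nx] : exists2 x, S i.+2 x /\ N' x & ~ S i.+1 x.
      by apply: strict; rewrite ?ij1.
    exists x => // Six; apply: nx; apply: (mono i) => //.
    by apply: leqW.
  rewrite ltnNge (leqW ij) /=; split=> [x [Sx Nx]|].
    by split=> //; apply: (mono i.+1).
  have [x [Sx Nx] nx] := strict i.+1 (leqW ij) ni.
  by exists x => // -[].
move=> x; case: ltnP => nj; last by case.
exact: below nj x.
Qed.

Lemma comp_chain N r : comp N r -> exists S, schain S r /\ S r = N.
Proof.
elim=> [|N' r' z cN [S [[sS lS] SE]] Nz Npz].
  exists (fun _ x => x = 0); split=> //; split=> i // _.
  exact: (comp_submod comp0).
have sN := comp_submod cN; have [N0 ND NZ] := sN.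
exists (fun i => if i == r'.+1 then sadj N' z else S i); split; last by rewrite eqxx.
split=> i ni.
  case: eqP => [_|/eqP ne]; first exact: sadj_submod.
  by apply: sS; rewrite -ltnS ltn_neqAle ne.
rewrite (ltn_eqF ni) eqSS; case: eqP => [->|/eqP ne]; last first.
  by apply: lS; rewrite ltn_neqAle ne.
rewrite SE; split; first exact: sadj_sub.
by exists z => //; exists 1; rewrite scale1r subrr.
Qed.

Lemma comp_length r : comp (fun=> True) r -> mod_length M = Some r.
Proof.
move=> cM; apply/nat_sup_Some; split.
  by have [S [cS _]] := comp_chain cM; apply/submodule_chainP; exists S.
by move=> n /submodule_chainP[S cS]; apply: (comp_bound cM cS).
Qed.

(** The elements pi^(v-1) z, ..., pi z, z are adjoined in turn; every step is strict because v is
    the exact order of z modulo N. *)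
Lemma comp_adjoin N r z v : comp N r -> N (pi ^+ v *: z) ->
  (forall a, N (a *: z) -> exists b, a = b * pi ^+ v) ->
  (forall v, ~ exists b, pi ^+ v = b * pi ^+ v.+1) ->
  comp (sadj N z) (r + v).
Proof.
move=> + + + npi; elim: v N r => [|v IH] N r cN Nv Na.
  have sN := comp_submod cN; have [N0 ND NZ] := sN.
  rewrite addn0 (_ : sadj N z = N) //; apply: predeq => x; split; last exact: sadj_sub.
  case=> a Na'; rewrite -(subrK (a *: z) x); apply: ND => //; apply: NZ.
  by rewrite expr0 scale1r in Nv.
have sN := comp_submod cN; have [N0 ND NZ] := sN.
pose N1 := sadj N (pi ^+ v *: z).
have cN1 : comp N1 r.+1.
  apply: compS => //; first by move=> /Na; apply: npi.
  by rewrite scalerA -exprS.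
have -> : sadj N z = sadj N1 z.
  apply: predeq => x; split=> [[a Nax]|[a [b Nab]]].
    by exists a; apply: sadj_sub.
  exists (a + b * pi ^+ v); rewrite scalerDl opprD addrA -scalerA.
  by [].
rewrite addnS -addSn; apply: IH => //.
  by exists 1; rewrite scale1r subrr.
move=> a [b]; rewrite scalerA -scalerBl => /Na[c cE].
exists (c * pi + b); rewrite mulrDl -mulrA -exprS -cE subrK //.
Qed.

End CompositionSeries.

Section DVR.
Variables (O : idomainType) (pi : O).
Hypotheses (mpi : @mI O = adj zeroid pi) (pi0 : pi != 0).
Hypothesis sepO : forall x : O, (forall n, pw (@mI O) n x) -> x = 0.

Lemma pi_nunit : ~ exists b, 1 = b * pi.
Proof.
move=> [b bE]; have : mI pi by rewrite mpi; apply/adj_self/zeroid_ideal.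
by rewrite /mI => /negP; apply; apply/unitrPr; exists b; rewrite mulrC.
Qed.

Lemma pi_strict v : ~ exists b, pi ^+ v = b * pi ^+ v.+1.
Proof.
move=> [b]; rewrite exprS mulrA => /eqP; rewrite -{1}[pi ^+ v]mul1r.
rewrite -subr_eq0 -mulrBl mulf_eq0 expf_eq0 (negPf pi0) andbF orbF subr_eq0 => /eqP bE.
by apply: pi_nunit; exists b.
Qed.

Lemma dvr_factor c : c != 0 -> exists n u, u \is a GRing.unit /\ c = u * pi ^+ n.
Proof. exact: principal_factor. Qed.

Lemma dvr_min_power (P : O -> Prop) : P 0 ->
  (forall a x, P x -> P (a * x)) -> (exists2 x, P x & x != 0) ->
  exists v, P (pi ^+ v) /\ forall a, P a -> exists b, a = b * pi ^+ v.
Proof.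
move=> P0 PM exP.
have H x : P x -> x != 0 -> exists2 n, P (pi ^+ n) & exists u, x = u * pi ^+ n.
  move=> Px /dvr_factor[n [u [Uu xE]]]; exists n; last by exists u.
  by rewrite -(mulKr Uu (pi ^+ n)) -xE; apply: PM.
have exn : exists n, `[< P (pi ^+ n) >].
  by have [x Px x0] := exP; have [n Pn _] := H x Px x0; exists n; apply/asboolP.
case: (ex_minnP exn) => v /asboolP Pv vmin; exists v; split=> // a Pa.
have [->|a0] := eqVneq a 0; first by exists 0; rewrite mul0r.
have [n Pn [u ->]] := H a Pa a0.
have vn : (v <= n)%N by apply: vmin; apply/asboolP.
by exists (u * pi ^+ (n - v)); rewrite -mulrA -exprD subnK.
Qed.

Lemma length_cyclic (N : submodClosed O^o) w :
  (forall x : O, x \in (N : {pred O^o}) <-> exists b, x = b * pi ^+ w) ->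
  mod_length (quot_mod N) = Some w.
Proof.
move=> NE; apply: (comp_length mpi).
have cl0 (a : O) : a *: quot_class N (1 : O^o) = 0 <-> exists b, a = b * pi ^+ w.
  rewrite -NE; have -> : a *: quot_class N (1 : O^o) = quot_class N (a : O^o).
    by rewrite [LHS]quot_scale_class; congr quot_class; apply: mulr1.
  split=> [/eqP|aN]; [|apply/eqP]; have -> : 0 = quot_class N (0 : O^o).
  - by rewrite /quot_class raddf0.
  - by rewrite -Quotient.idealrBE subr0.
  - by rewrite /quot_class raddf0.
  - by rewrite -Quotient.idealrBE subr0.
have -> : (fun=> True) = sadj (fun x : quot_mod N => x = 0) (quot_class N (1 : O^o)).
  apply: predeq => x; split=> // _; have [y ->] := quot_classP x; exists (y : O).
  apply/eqP; rewrite subr_eq0; apply/eqP.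
  by rewrite [RHS]quot_scale_class; congr quot_class; rewrite /GRing.scale /= mulr1.
rewrite -[w]add0n; apply: comp_adjoin; first exact: comp0.
- by apply/cl0; exists 1; rewrite mul1r.
- by move=> a /cl0.
- exact: pi_strict.
Qed.

(** Otherwise the submodules N + (pi^i z) decrease strictly, and m + 1 such steps exceed the length
    m. *)
Lemma torsion_power (M : lmodType O) (N : M -> Prop) z : submod N -> finite_length M ->
  exists v, N (pi ^+ v *: z).
Proof.
move=> sN [m /nat_sup_Some[_ maxm]]; have [N0 ND NZ] := sN.
apply: contrapT => nv.
have nN v : ~ N (pi ^+ v *: z) by move=> Nv; apply: nv; exists v.
suff : (m.+1 <= m)%N by rewrite ltnn.
apply: maxm; apply/submodule_chainP.
exists (fun j => sadj N (pi ^+ (m.+1 - j) *: z)); split=> j jm.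
  exact: sadj_submod.
have E : (m.+1 - j = (m.+1 - j.+1).+1)%N by lia.
split=> [x [a Na]|].
  by exists (a * pi); rewrite -scalerA [pi *: _]scalerA -exprS -E.
exists (pi ^+ (m.+1 - j.+1) *: z).
  by exists 1; rewrite scale1r subrr.
move=> [a]; rewrite E exprS scalerA => Na0.
have {Na0} Na : N ((1 - a * pi) *: (pi ^+ (m.+1 - j.+1) *: z)).
  by rewrite scalerBl scale1r scalerA -mulrA.
apply: (nN (m.+1 - j.+1)%N); apply: (submod_unit sN) Na.
apply: unit_1B; first by rewrite mpi; apply/adj_ideal/zeroid_ideal.
by rewrite mpi; apply: adj_mul; apply: zeroid_ideal.
Qed.

(** A triangular presentation. With N_i spanned by the first i generators, v_i is the order of xi_i
    modulo N_i, and row i of T writes pi^(v_i) xi_i by earlier generators. The sum of the v_i is at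
    once the exponent of det T and the length. A relation is reduced by the rows from its last entry
    downwards. *)
Lemma length_presentation (M : lmodType O) n (xi : 'I_n -> M) :
  (forall m, exists c : 'I_n -> O, m = \sum_i c i *: xi i) -> finite_length M ->
  exists (T : 'M[O]_n) v, [/\ forall i, \sum_j T i j *: xi j = 0,
    \det T = pi ^+ v, mod_length M = Some v &
    forall c : 'I_n -> O, \sum_j c j *: xi j = 0 ->
      exists b : 'I_n -> O, forall j, c j = \sum_i b i * T i j].
Proof.
move=> xigen finM.
pose Nk k x := exists2 c : 'I_n -> O, (forall j : 'I_n, (k <= j)%N -> c j = 0) &
  x = \sum_j c j *: xi j.
have sNk k : submod (Nk k).
  split=> [|x y [c c0 ->] [d d0 ->]|a x [c c0 ->]].
  - by exists (fun=> 0) => //; rewrite big1 // => j _; rewrite scale0r.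
  - exists (fun j => c j + d j) => [j kj|]; first by rewrite c0 // d0 // addr0.
    by rewrite -big_split; apply: eq_bigr => j _; rewrite scalerDl.
  - exists (fun j => a * c j) => [j kj|]; first by rewrite c0 // mulr0.
    by rewrite scaler_sumr; apply: eq_bigr => j _; rewrite scalerA.
have /choice[v vP] : forall i : 'I_n, exists v, Nk i (pi ^+ v *: xi i) /\
    forall a, Nk i (a *: xi i) -> exists b, a = b * pi ^+ v.
  move=> i; have [N0 _ NZ] := sNk i.
  apply: (dvr_min_power (P := fun a => Nk i (a *: xi i))).
  - by rewrite scale0r.
  - by move=> a x Nx; rewrite -scalerA; apply: NZ.
  - have [w Nw] := torsion_power (xi i) (sNk i) finM; exists (pi ^+ w) => //.
    by rewrite expf_eq0 (negPf pi0) andbF.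
have /choice[d dP] : forall i : 'I_n, exists d : 'I_n -> O,
    (forall j : 'I_n, (i <= j)%N -> d j = 0) /\ pi ^+ v i *: xi i = \sum_j d j *: xi j.
  by move=> i; have [[d d0 dE] _] := vP i; exists d.
pose T : 'M[O]_n := \matrix_(i, j) ((i == j)%:R * pi ^+ v i - d i j).
have Txi i : \sum_j T i j *: xi j = 0.
  under eq_bigr do rewrite mxE scalerBl.
  rewrite sumrB; case: (dP i) => _ <-; rewrite (bigD1 i) //= eqxx mul1r big1.
    by rewrite addr0 subrr.
  by move=> j /negPf ji; rewrite eq_sym ji mul0r scale0r.
have Tii i : T i i = pi ^+ v i.
  by rewrite mxE eqxx mul1r; case: (dP i) => -> //; rewrite subr0.
have Tij (i j : 'I_n) : (i < j)%N -> T i j = 0.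
  move=> ij; rewrite mxE; case: (dP i) => -> //; last exact: ltnW.
  by rewrite -val_eqE /= (ltn_eqF ij) mul0r subr0.
exists T, (\sum_i v i)%N; split=> //.
- rewrite det_trig; last by apply/is_trig_mxP => i j; apply: Tij.
  by rewrite (eq_bigr _ (fun i _ => Tii i)) prodrXr.
- apply: (comp_length mpi).
  have H k : (k <= n)%N -> comp pi (Nk k) (\sum_(i < n | (i < k)%N) v i)%N.
    elim: k => [|k IH] kn.
      rewrite big1 //; have -> : Nk 0%N = fun x => x = 0; last exact: comp0.
      apply: predeq => x; split=> [[c c0 ->]|->]; last by case: (sNk 0%N).
      by rewrite big1 // => j _; rewrite c0 // scale0r.
    pose i := Ordinal kn.
    have -> : Nk k.+1 = sadj (Nk k) (xi i).
      apply: predeq => x; split=> [[c c0 ->]|[a [c c0 xE]]].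
        exists (c i); exists (fun j => if j == i then 0 else c j) => [j|].
          case: eqP => // /eqP ji kj; apply: c0; rewrite ltn_neqAle kj andbT.
          by rewrite eq_sym.
        rewrite (bigD1 i) //= [LHS]addrAC subrr add0r [RHS](bigD1 i) //= eqxx scale0r add0r.
        by apply: eq_bigr => j /negPf ->.
      exists (fun j => c j + (j == i)%:R * a) => [j kj|].
        rewrite c0 ?(ltnW kj) // add0r -val_eqE /= gtn_eqF // mul0r //.
      rewrite -[x](subrK (a *: xi i)) xE; under [RHS]eq_bigr do rewrite scalerDl.
      rewrite big_split /=; congr (_ + _); rewrite (bigD1 i) //= eqxx mul1r big1 ?addr0 //.
      by move=> j /negPf ->; rewrite mul0r scale0r.
    have -> : (\sum_(i0 < n | (i0 < k.+1)%N) v i0 = \sum_(i0 < n | (i0 < k)%N) v i0 + v i)%N.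
      rewrite (bigD1 i) //= addnC; congr addn; apply: eq_bigl => j.
      by rewrite -val_eqE /= ltnS [(j < k)%N]ltn_neqAle andbC.
    have [Nv Na] := vP i; apply: comp_adjoin => //; [exact/IH/ltnW|exact: pi_strict].
  have -> : (fun=> True) = Nk n.
    apply: predeq => x; split=> // _; have [c ->] := xigen x; exists c => // j.
    by rewrite leqNgt ltn_ord.
  rewrite (eq_bigl (fun i : 'I_n => (i < n)%N)); first exact: H.
  by move=> i; rewrite ltn_ord.
have H k : (k <= n)%N -> forall c : 'I_n -> O, (forall j : 'I_n, (k <= j)%N -> c j = 0) ->
    \sum_j c j *: xi j = 0 -> exists b : 'I_n -> O, forall j, c j = \sum_i b i * T i j.
  elim: k => [|k IH] kn c c0 cxi.
    exists (fun=> 0) => j; rewrite c0 // big1 // => i _; exact: mul0r.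
  pose i := Ordinal kn; have [_ Na] := vP i.
  have [|a aE] := Na (c i).
    exists (fun j => if j == i then 0 else - c j) => [j|].
      case: eqP => // /eqP ji kj; rewrite c0 ?oppr0 // ltn_neqAle kj andbT.
      by rewrite eq_sym.
    move: cxi; rewrite (bigD1 i) //= => /eqP; rewrite addr_eq0 => /eqP ->.
    rewrite [RHS](bigD1 i) //= eqxx scale0r add0r -sumrN.
    by apply: eq_bigr => j /negPf ->; rewrite scaleNr.
  have [||b bE] := IH (ltnW kn) (fun j => c j - a * T i j).
  - move=> j; rewrite leq_eqVlt => /orP[/eqP kj|kj].
      have -> : j = i by apply: val_inj.
      by rewrite Tii aE subrr.
    by rewrite c0 // Tij // mulr0 subr0.
  - under eq_bigr do rewrite scalerBl -scalerA.
    by rewrite sumrB cxi -scaler_sumr Txi scaler0 subr0.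
  exists (fun l => b l + (l == i)%:R * a) => j.
  under eq_bigr do rewrite mulrDl; rewrite big_split /= -bE (bigD1 i) //= eqxx mul1r.
  rewrite big1 ?addr0 ?subrK // => l /negPf ->; by rewrite mul0r mul0r.
by move=> c; apply: (H n) => // j; rewrite leqNgt ltn_ord.
Qed.

End DVR.

(** * Augmented rings *)

Lemma gen0_lin (R : comNzRingType) n (f : 'I_n -> R) a :
  gen zeroid (fl f) a <-> exists c : 'I_n -> R, a = \sum_i c i * f i.
Proof.
rewrite (gen_lin _ _ (zeroid_ideal R)).
by split=> [[c /eqP]|[c ->]]; exists c; [apply/eqP; rewrite -subr_eq0|rewrite /zeroid subrr].
Qed.

Lemma fl_nth (R : comNzRingType) (s : seq R) : fl (fun i : 'I_(size s) => s`_i) = s.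
Proof.
apply: (@eq_from_nth _ 0); rewrite size_fl // => i iS.
by rewrite (nth_map (Ordinal iS)) ?size_enum_ord // nth_enum_ord.
Qed.

Lemma ker_ideal (R S : comNzRingType) (f : {rmorphism R -> S}) : ideal (fun r => f r = 0).
Proof.
split=> [|x y fx fy|a x fx]; rewrite ?rmorph0 ?rmorphD ?rmorphM ?fx ?fy ?addr0 //.
by rewrite mulr0.
Qed.

Lemma surj_local_unit (R S : comUnitRingType) (f : {rmorphism R -> S}) r :
  ideal (@mI R) -> (forall a, exists r, f r = a) -> f r \is a GRing.unit -> r \is a GRing.unit.
Proof.
move=> lR fsurj Ufr; have [r' r'E] := fsurj (f r)^-1.
have m1 : mI (1 - r * r').
  apply: (@proper_mI _ (fun r => f r = 0)); first exact: ker_ideal.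
    by rewrite rmorph1 => /eqP; rewrite oner_eq0.
  by rewrite rmorphB rmorph1 rmorphM r'E divrr // subrr.
have := unit_1B lR m1; rewrite opprB addrC subrK unitrM => /andP[] //.
Qed.

(** * Parameters adapted to the map onto the valuation ring *)

Section Coordinates.
Variables (R : comUnitRingType) (O : idomainType) (psi : {rmorphism R -> O}) (pi : O).
Hypotheses (nR : noeth R) (lR : ideal (@mI R)).
Hypothesis psi_surj : forall o, exists r, psi r = o.
Hypotheses (mpi : @mI O = adj zeroid pi) (pi0 : pi != 0).

(** Some member of s maps to a unit times pi, as otherwise pi could not be hit. Divided by a lift of
    that unit it becomes t, and the others are moved into the kernel by multiples of t. They
    generate the kernel by Nakayama with t, pi being a nonzerodivisor. *)
Lemma coordinates s : @mI R = gen zeroid s ->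
  (forall t, size t = size s -> @mI R = gen zeroid t -> reg zeroid t) ->
  exists n (x : 'I_n -> R) t, [/\ size s = n.+1, psi t = pi,
    forall r, psi r = 0 <-> gen zeroid (fl x) r,
    @mI R = gen zeroid (t :: fl x) & reg zeroid (t :: fl x)].
Proof.
move=> mE sreg.
have iO : ideal (@mI O) by rewrite mpi; apply/adj_ideal/zeroid_ideal.
have ms a : a \in s -> mI a by move=> sa; rewrite mE; apply: gen_in sa; apply: zeroid_ideal.
have mpsi r : mI r -> mI (psi r).
  move=> mr; apply/negP => Ur; move/negP: mr; apply.
  exact: surj_local_unit Ur.
have mpsiV r : mI (psi r) -> mI r by move=> /negP mr; apply/negP => /(rmorph_unit psi).
have [c cP] : exists c : R -> R, forall a, mI a -> psi a = psi (c a) * pi.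
  suff /choice[c cP] : forall a, exists c, mI a -> psi a = psi c * pi by exists c.
  move=> a; have [ma|nma] := pselect (mI a); last by exists 0.
  have := mpsi _ ma; rewrite mpi => -[o /eqP]; rewrite subr_eq0 => /eqP oE.
  by have [c cE] := psi_surj o; exists c; rewrite cE.
have [a sa Uca] : exists2 a, a \in s & c a \is a GRing.unit.
  apply: contrapT => nU.
  have [t tE] := psi_surj pi.
  have mt : mI t by apply: mpsiV; rewrite tE mpi; apply/adj_self/zeroid_ideal.
  have : exists d, mI d /\ psi t = d * pi.
    rewrite {1}mE in mt; have := mt; rewrite (genP _ _ (zeroid_ideal R)) => -[e /eqP].
    rewrite subr_eq0 => /eqP ->; exists (\sum_i psi (e i) * psi (c s`_i)); split.
      apply: ideal_sum => // i _; apply: idealM => //; apply: mpsi.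
      by apply/negP => U; apply: nU; exists s`_i => //; apply: mem_nth.
    rewrite rmorph_sum mulr_suml; apply: eq_bigr => i _.
    by rewrite rmorphM (cP s`_i) ?mulrA //; apply/ms/mem_nth.
  case=> d [md]; rewrite tE -{1}[pi]mul1r => /eqP; rewrite -subr_eq0 -mulrBl mulf_eq0.
  rewrite (negPf pi0) orbF subr_eq0 => /eqP d1.
  by move: md; rewrite -d1 /mI unitr1.
pose t := (c a)^-1 * a; have aE : a = c a * t by rewrite mulVKr.
have tpi : psi t = pi.
  apply: (mulfI (x := psi (c a))); first by apply: contraTneq (rmorph_unit psi Uca) => ->; rewrite unitr0.
  by rewrite -rmorphM -aE; apply/cP/ms.
have mt : mI t by apply: mpsiV; rewrite tpi mpi; apply/adj_self/zeroid_ideal.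
case/splitPr: {2}s / sa (erefl s) => s1 s2 sE.
pose l := [seq b - c b * t | b <- s1 ++ s2].
have szE : size s = (size l).+1 by rewrite sE size_map !size_cat addnS.
have sub b : b \in s1 ++ s2 -> b \in s by rewrite sE !mem_cat inE orbCA => ->; rewrite orbT.
have mtl : @mI R = gen zeroid (t :: l).
  apply: predeq => x; split.
    rewrite mE; apply: gen_min; first exact/gen_ideal/zeroid_ideal.
      by move=> y ->; apply: (ideal0 (gen_ideal _ (zeroid_ideal R))).
    have it := gen_ideal (t :: l) (zeroid_ideal R).
    have gt : gen zeroid (t :: l) t by apply: gen_in; [apply: zeroid_ideal|rewrite mem_head].
    move=> b sb; have [bs|bs] := boolP (b \in s1 ++ s2).
      rewrite -(subrK (c b * t) b); apply: (idealD it); last exact: (idealM it).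
      by apply: gen_in; [apply: zeroid_ideal|rewrite inE; apply/orP; right; apply/mapP; exists b].
    have -> : b = a.
      by apply/eqP; move: sb bs; rewrite sE !mem_cat inE => /or3P[->|/eqP->|->]; rewrite ?eqxx ?orbT.
    by rewrite aE; apply: (idealM it).
  apply: gen_min => // [y ->|b]; first exact: ideal0.
  rewrite inE => /orP[/eqP -> //|/mapP[b' /sub sb' ->]].
  by apply: idealB => //; [apply: ms|apply: idealM].
have psil b : b \in l -> psi b = 0.
  by case/mapP => b' /sub/ms/cP b'E ->; rewrite rmorphB rmorphM tpi b'E subrr.
exists (size l), (fun i => l`_i), t; rewrite fl_nth; split=> //; last first.
  by apply: sreg => //; rewrite szE.
have il := gen_ideal l (zeroid_ideal R).
have lker r : gen zeroid l r -> psi r = 0.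
  apply: (@gen_min _ _ (fun r => psi r = 0)) => [|y ->|]; rewrite ?rmorph0 //.
  exact: ker_ideal.
move=> r; split=> [|]; last exact: lker.
apply: (nakayama1 nR lR (ker_ideal psi) il mt) => z z0.
have : mI z by apply: mpsiV; rewrite z0; apply: ideal0.
rewrite mtl (_ : gen zeroid (t :: l) = gen zeroid (rcons l t)); last first.
  by apply: gen_perm => [|b]; [apply: zeroid_ideal|rewrite mem_rcons].
rewrite gen_rcons => -[y zy]; exists y; last by rewrite mulrC.
have /eqP := lker _ zy; rewrite rmorphB z0 sub0r oppr_eq0 rmorphM tpi mulf_eq0.
by rewrite (negPf pi0) orbF => /eqP.
Qed.

(** Rotated to the end, x_j is a nonzerodivisor modulo the other x_i, and r_j x_j is in their
    ideal. *)
Lemma regular_syzygy n (x : 'I_n -> R) (r : 'I_n -> R) : (forall i, mI (x i)) ->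
  reg zeroid (fl x) -> \sum_j r j * x j = 0 -> forall j, gen zeroid (fl x) (r j).
Proof.
move=> mx xreg rx j; have z0 := zeroid_ideal R.
have [l1 [l2 [flE l1P]]] : exists l1 l2, fl x = l1 ++ x j :: l2 /\
    forall i, i != j -> x i \in l1 ++ l2.
  have : j \in enum 'I_n by rewrite mem_enum.
  rewrite /fl => jn; have un := enum_uniq 'I_n; have all i : i \in enum 'I_n by rewrite mem_enum.
  move: un all; case/splitPr: jn => e1 e2 un all.
  exists (map x e1), (map x e2); rewrite map_cat; split=> // i ij.
  rewrite -map_cat map_f //; have := all i; rewrite !mem_cat inE (negPf ij) //.
have gE : gen zeroid (fl x) = gen zeroid (rcons (l1 ++ l2) (x j)).
  by apply: gen_perm => // b; rewrite flE mem_rcons mem_cat !inE mem_cat orbCA.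
have : reg zeroid (rcons (l1 ++ l2) (x j)).
  by rewrite rcons_cat; apply: reg_last => //; rewrite -flE.
rewrite -cats1 reg_cat => -[_ [nz _]].
rewrite gE gen_rcons; apply: adj_sub.
apply: nz; have gI := gen_ideal (l1 ++ l2) z0.
move: rx; rewrite (bigD1 j) //= mulrC => /eqP; rewrite addr_eq0 => /eqP ->.
apply: idealN => //; apply: ideal_sum => // i ij; apply: idealM => //.
by apply: gen_in => //; apply: l1P.
Qed.

End Coordinates.

(** * Presentation of the cotangent module *)

Section Presentation.
Variables (R A : comUnitRingType) (O : idomainType) (piA : augmentation A O).
Variables (phi : {rmorphism R -> A}).
Hypothesis phi_surj : forall a, exists r, phi r = a.
Let psi : {rmorphism R -> O} := piA \o phi.
Variables (n : nat) (x : 'I_n -> R).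
Hypothesis kerx : forall r, psi r = 0 <-> gen zeroid (fl x) r.

Lemma psi_surj o : exists r, psi r = o.
Proof.
by have [a /eqP aE] := aug_surj piA o; have [r rE] := phi_surj a; exists r; rewrite /= rE.
Qed.

Lemma aug_gen i : phi (x i) \in aug_ideal piA.
Proof. by rewrite inE; apply/eqP/kerx; apply: gen_in; [apply: zeroid_ideal|apply: fl_mem]. Qed.

Definition cot_gen i : cotangent piA := cotangent_class (AugElt (aug_gen i)).

Lemma aug_ideal_lift z : z \in aug_ideal piA ->
  exists c : 'I_n -> R, z = phi (\sum_i c i * x i).
Proof.
rewrite inE => /eqP z0; have [r rE] := phi_surj z.
have /kerx/gen0_lin[c cE] : psi r = 0 by rewrite /= rE.
by exists c; rewrite -cE.
Qed.

Lemma cot_gen_sum (c : 'I_n -> R) (z : aug_elt piA) : val z = phi (\sum_i c i * x i) ->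
  cotangent_class z = \sum_i psi (c i) *: cot_gen i.
Proof.
move=> zE; have -> : z = \sum_i aug_act (phi (c i)) (AugElt (aug_gen i)).
  apply: val_inj; rewrite [LHS]zE !raddf_sum /=; apply: eq_bigr => i _.
  by rewrite rmorphM.
rewrite /cotangent_class raddf_sum; apply: eq_bigr => i _.
by rewrite -[LHS]cotangent_scale_class.
Qed.

Lemma cot_gen_span m : exists c : 'I_n -> O, m = \sum_i c i *: cot_gen i.
Proof.
have [z ->] := cotangent_classP m; have [c cE] := aug_ideal_lift (valP z).
by exists (fun i => psi (c i)); apply: cot_gen_sum.
Qed.

Lemma cot_class0 (z : aug_elt piA) : cotangent_class z = 0 <->
  exists a : 'I_n -> R, (forall i, psi (a i) = 0) /\ val z = phi (\sum_i a i * x i).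
Proof.
have -> : cotangent_class z = 0 <-> val z \in ideal_mul (aug_ideal piA) (aug_ideal piA).
  have E : (cotangent_class z == 0) = (z \in @aug_sq A O piA).
    rewrite -[z in RHS]subr0 Quotient.idealrBE; congr eq_op.
    by rewrite -[LHS](raddf0 (\pi_(cotangent piA))).
  by rewrite -[X in _ <-> is_true X]E; split=> /eqP.
split.
  rewrite ideal_mulP; elim=> {z} [|a b _ [c [c0 ->]] _ [d [d0 ->]]|a b pa pb].
  - exists (fun=> 0); split=> [i|]; first exact: rmorph0.
    by rewrite big1 ?rmorph0 // => i _; rewrite mul0r.
  - exists (fun i => c i + d i); split=> [i|]; first by rewrite rmorphD c0 d0 addr0.
    by rewrite -rmorphD -big_split; congr (phi _); apply: eq_bigr => i _; rewrite mulrDl.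
  - have [c ->] := aug_ideal_lift pb; have [r rE] := phi_surj a.
    exists (fun i => r * c i); split=> [i|].
      by move: pa; rewrite rmorphM /= rE /toI inE => /eqP ->; rewrite mul0r.
    rewrite -rE -rmorphM mulr_sumr; congr (phi _); apply: eq_bigr => i _.
    by rewrite mulrA.
case=> a [a0 ->]; apply/ideal_mulP; rewrite rmorph_sum.
elim/big_ind: _ => [|u v Hu Hv|i _]; [exact: mulI0|exact: mulID|].
rewrite rmorphM; apply: mulIM; rewrite /toI ?aug_gen // inE.
by apply/eqP; apply: a0.
Qed.

(** Lifted coefficients give an element in the square of the augmentation ideal. Subtracting
    coefficients from the kernel of R -> O makes it 0 in A without changing residues: relations in
    the cotangent module lift to relations in A. *)
Lemma cot_gen_relation (c : 'I_n -> O) : \sum_i c i *: cot_gen i = 0 <->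
  exists a : 'I_n -> R, (forall i, psi (a i) = c i) /\ phi (\sum_i a i * x i) = 0.
Proof.
split=> [c0|[a [aE a0]]]; last first.
  have := @cot_gen_sum a 0; rewrite raddf0 a0 => /(_ erefl).
  by under eq_bigr do rewrite aE; move=> <-; rewrite /cotangent_class raddf0.
have /choice[r rE] : forall i, exists r, psi r = c i by move=> i; apply: psi_surj.
have pz : phi (\sum_i r i * x i) \in aug_ideal piA.
  rewrite inE -[X in X == _]/(psi _); apply/eqP; rewrite rmorph_sum big1 // => i _.
  have xi0 : psi (x i) = 0 by apply/eqP/aug_gen.
  by rewrite rmorphM xi0 mulr0.
have /cot_class0[b [b0 bE]] : cotangent_class (AugElt pz) = 0.
  rewrite (@cot_gen_sum r) // -[RHS]c0; apply: eq_bigr => i _.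
  by rewrite rE.
exists (fun i => r i - b i); split=> [i|]; first by rewrite rmorphB rE b0 subr0.
under eq_bigr do rewrite mulrBl.
by rewrite sumrB rmorphB -bE subrr.
Qed.

End Presentation.

Section Border.
Variables (R : comNzRingType) (n : nat).
Implicit Types (t : R) (x : 'I_n -> R) (a : 'M[R]_n).

Definition cons_fun t x : 'I_n.+1 -> R := fun i => oapp x t (unlift ord0 i).

(** First row c, the block a below it, and zeros in the first column under c_0: the matrix
    expressing (y', f) by (t, x). *)
Definition border (c : 'I_n.+1 -> R) a : 'M[R]_n.+1 :=
  \matrix_(i, j) oapp (fun i' => oapp (a i') 0 (unlift ord0 j)) (c j) (unlift ord0 i).

Lemma cons_fun0 t x : cons_fun t x ord0 = t.
Proof. by rewrite /cons_fun unlift_none. Qed.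

Lemma cons_funS t x i : cons_fun t x (lift ord0 i) = x i.
Proof. by rewrite /cons_fun liftK. Qed.

Lemma fl_cons t x : fl (cons_fun t x) = t :: fl x.
Proof.
by rewrite flS cons_fun0; congr (_ :: _); apply: eq_map => i; rewrite cons_funS.
Qed.

Lemma lin_border c a t x :
  lin (border c a) (cons_fun t x) = cons_fun (\sum_j c j * cons_fun t x j) (lin a x).
Proof.
apply: funext => i; rewrite /lin; case: (unliftP ord0 i) => [i'|] ->.
  rewrite cons_funS big_ord_recl mxE liftK unlift_none mul0r add0r.
  by apply: eq_bigr => j _; rewrite mxE !liftK cons_funS.
by rewrite cons_fun0; apply: eq_bigr => j _; rewrite mxE unlift_none.
Qed.

Lemma det_border c a : \det (border c a) = c ord0 * \det a.
Proof.
rewrite (expand_det_col _ ord0) big_ord_recl big1 => [|i _]; last first.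
  by rewrite mxE liftK unlift_none mul0r.
rewrite addr0 mxE unlift_none /cofactor expr0 mul1r; congr (_ * \det _).
by apply/matrixP => i j; rewrite !mxE !liftK.
Qed.

End Border.

Section Annihilator.
Variables (A O : comNzRingType) (piA : augmentation A O).

Definition ann_aug (z : A) := forall q, piA q = 0 -> z * q = 0.

Lemma ann_augM a z : ann_aug z -> ann_aug (a * z).
Proof. by move=> Az q q0; rewrite -mulrA Az // mulr0. Qed.

Lemma ann_augB y z : ann_aug y -> ann_aug z -> ann_aug (y - z).
Proof. by move=> Ay Az q q0; rewrite mulrBl Ay // Az // subrr. Qed.

Lemma ann_aug_eq z a b : ann_aug z -> piA a = piA b -> z * a = z * b.
Proof.
by move=> Az ab; apply/eqP; rewrite -subr_eq0 -mulrBr Az // rmorphB ab subrr.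
Qed.

Lemma aug_etaP o : o \in aug_eta piA <-> exists2 z, ann_aug z & piA z = o.
Proof.
split=> [/asboolP[z [/asboolP Az zo]]|[z Az zo]].
  by exists z => // q q0; apply: Az; rewrite inE q0.
apply/asboolP; exists z; split=> //; apply/asboolP => q; rewrite inE => /eqP.
exact: Az.
Qed.

(* Some element of the annihilator maps to a power of [pi], and [y] is a
   multiple of a lift of [pi] modulo the augmentation ideal: so a power of [y]
   kills the intersection of the annihilator with the augmentation ideal. *)
Lemma ann_aug_inj (pi : O) y w z : (forall q, y * q = 0 -> q = 0) ->
  (exists o, piA y = o * pi) -> pi ^+ w \in aug_eta piA ->
  ann_aug z -> piA z = 0 -> z = 0.
Proof.
move=> nzy [o yE] /aug_etaP[d Ad dE] Az z0.
have [t /eqP tE] := aug_surj piA pi; have [u /eqP uE] := aug_surj piA o.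
have zt : z * t ^+ w = 0.
  by rewrite (@ann_aug_eq _ _ d) ?rmorphXn ?tE ?dE // mulrC Ad.
have : y ^+ w * z = 0.
  rewrite mulrC (@ann_aug_eq _ _ ((u * t) ^+ w)) ?rmorphXn ?rmorphM ?yE ?uE ?tE //.
  by rewrite exprMn mulrCA zt mulr0.
elim: w {zt dE} => [|w IH]; first by rewrite mul1r.
by rewrite exprS -mulrA => /nzy.
Qed.

End Annihilator.

(** * The bordered determinant modulo a nonzerodivisor *)

Section Numerical.
Variables (R A : comUnitRingType) (O : idomainType) (piA : augmentation A O).
Variables (phi : {rmorphism R -> A}) (pi : O).
Hypotheses (nR : noeth R) (lR : ideal (@mI R)).
Hypothesis phi_surj : forall a, exists r, phi r = a.
Hypotheses (mpi : @mI O = adj zeroid pi) (pi0 : pi != 0).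
Let psi : {rmorphism R -> O} := piA \o phi.
Variables (n : nat) (x : 'I_n -> R) (t : R).
Hypotheses (tpi : psi t = pi) (kerx : forall r, psi r = 0 <-> gen zeroid (fl x) r).
Hypotheses (mE : @mI R = gen zeroid (t :: fl x)) (txreg : reg zeroid (t :: fl x)).
Variables (y : A).
Hypotheses (ny : y \isn't a GRing.unit) (nzy : forall q, y * q = 0 -> q = 0).
Variable w : nat.
Hypothesis etaE : forall o, o \in aug_eta piA <-> exists b, o = b * pi ^+ w.

Lemma det_ann (a : 'M[R]_n) : (forall i, phi (lin a x i) = 0) -> ann_aug piA (phi (\det a)).
Proof.
move=> ax q q0; have /(aug_ideal_lift phi_surj kerx)[c ->] : q \in aug_ideal piA.
  by rewrite inE q0.
rewrite -rmorphM mulr_sumr rmorph_sum big1 // => j _; rewrite mulrCA rmorphM.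
suff -> : phi (\det a * x j) = 0 by rewrite mulr0.
have : phi (\det a * x j - lin (\adj a) (lin a x) j) = 0.
  by apply: (cramer (ker_ideal phi)) => i; rewrite subrr rmorph0.
rewrite rmorphB => /eqP; rewrite subr_eq0 => /eqP ->.
by apply: (lin_ideal _ _ (ker_ideal phi)) => i; apply: ax.
Qed.

Lemma mx_params i : mI (cons_fun t x i).
Proof.
by rewrite mE -fl_cons; apply: gen_in; [apply: zeroid_ideal|apply: fl_mem].
Qed.

Lemma regular_parameter : exists2 c : 'I_n.+1 -> R,
  phi (\sum_j c j * cons_fun t x j) = y & piA y = psi (c ord0) * pi.
Proof.
have [r rE] := phi_surj y.
have : mI r by apply: contra ny => Ur; rewrite -rE; apply: rmorph_unit.
rewrite mE -fl_cons => /gen0_lin[c cE]; exists c; first by rewrite -cE.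
rewrite -rE cE -[LHS]/(psi _) big_ord_recl cons_fun0 rmorphD rmorphM tpi rmorph_sum big1.
  by rewrite addr0.
move=> j _; rewrite cons_funS rmorphM; apply/eqP; rewrite mulf_eq0; apply/orP; right.
by apply/eqP/kerx; apply: gen_in; [apply: zeroid_ideal|apply: fl_mem].
Qed.

Lemma multiple_ideal : ideal (fun r => exists z, phi r = y * z).
Proof.
split=> [|r s [z zE] [z' zE']|b r [z zE]].
- by exists 0; rewrite rmorph0 mulr0.
- by exists (z + z'); rewrite rmorphD zE zE' mulrDr.
- by exists (phi b * z); rewrite rmorphM zE mulrCA.
Qed.

(** If the bordered determinant were y z in A, then z would annihilate the augmentation ideal, y
    being a nonzerodivisor, and pi times its image would be pi^w, against the minimality of w. So
    the criterion applies to the preimage of yA; y' is then removed from the generators by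
    Nakayama. *)
Lemma regular_relations (a : 'M[R]_n) : (forall i, phi (lin a x i) = 0) ->
  psi (\det a) = pi ^+ w ->
  reg zeroid (fl (lin a x)) /\ forall r, phi r = 0 <-> gen zeroid (fl (lin a x)) r.
Proof.
move=> ax detE; have [c cE yE] := regular_parameter; have z0 := zeroid_ideal R.
have Ad := det_ann ax.
have d0 : pi ^+ w != 0 by rewrite expf_eq0 (negPf pi0) andbF.
have ndet : ~ exists z, phi (\det (border c a)) = y * z.
  case=> z; rewrite det_border => zE.
  have Az : ann_aug piA z.
    move=> q q0; apply: nzy; rewrite mulrA -zE rmorphM -mulrA Ad // mulr0.
    by [].
  have /etaE[b bE] : piA z \in aug_eta piA by apply/aug_etaP; exists z.
  have := congr1 piA zE; rewrite [LHS]/= -[LHS]/(psi _) rmorphM detE rmorphM yE bE.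
  (* If c_0 maps to 0, y is in the augmentation ideal and kills det a; then det a is 0 in A although
     its image is not. *)
  have [c0|c0] := eqVneq (psi (c ord0)) 0.
    have : phi (\det a) = 0.
      apply: nzy; rewrite mulrC Ad // yE c0 mul0r //.
    move=> /(congr1 piA); rewrite rmorph0 -[LHS]/(psi _) detE => /eqP.
    by rewrite (negPf d0).
  rewrite -mulrA => /(mulfI c0) E.
  by apply: (pi_strict mpi pi0 (v := w)); exists b; rewrite E exprS mulrCA.
have [i|y'|||] := det_criterion nR lR (x := cons_fun t x) _ _ _ multiple_ideal _ ndet.
- exact: mx_params.
- by rewrite mE fl_cons.
- by rewrite fl_cons.
- move=> i; rewrite lin_border; case: (unliftP ord0 i) => [i'|] ->.
    by rewrite cons_funS ax; exists 0; rewrite mulr0.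
  by rewrite cons_fun0 cE; exists 1; rewrite mulr1.
rewrite lin_border fl_cons; set y' := \sum_j _ => yreg yE'.
have my' : mI y' by apply: ideal_sum => // j _; apply: idealM => //; apply: mx_params.
have maf b : b \in fl (lin a x) -> mI b.
  apply: fl_memP => i; apply: lin_ideal => // j; have := mx_params (lift ord0 j).
  by rewrite cons_funS.
have freg : reg zeroid (rcons (fl (lin a x)) y') by apply: reg_rot.
split; first by move: freg; rewrite -cats1 reg_cat => -[].
have If r : gen zeroid (fl (lin a x)) r -> phi r = 0.
  apply: (@gen_min _ _ (fun r => phi r = 0)) => [|b ->|]; rewrite ?rmorph0 //.
    exact: ker_ideal.
  exact: (fl_memP (P := fun r => phi r = 0)).
move=> r; split; last exact: If.
apply: (nakayama1 nR lR (ker_ideal phi) (gen_ideal _ z0) my') => s s0.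
have : exists z, phi s = y * z by exists 0; rewrite s0 mulr0.
rewrite -[exists z, _]/((fun r => exists z, phi r = y * z) s) yE'.
have -> : gen zeroid (y' :: fl (lin a x)) = gen zeroid (rcons (fl (lin a x)) y').
  by apply: gen_perm => // b; rewrite mem_rcons.
rewrite gen_rcons => -[e se]; exists e; last by rewrite mulrC.
have /eqP := If _ se; rewrite rmorphB s0 sub0r oppr_eq0 rmorphM cE mulrC => /eqP.
exact: nzy.
Qed.

(** If o were divisible by pi, then det a = s t b in A, where b annihilates the augmentation ideal
    and lies over pi^w: both sides have the same image, and [ann_aug_inj] applies. Then the bordered
    determinant is s b y, a multiple of y, which Wiebe's theorem forbids for (y', f). *)
Lemma det_unit_multiple (a : 'M[R]_n) : reg zeroid (fl (lin a x)) ->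
  (forall r, phi r = 0 <-> gen zeroid (fl (lin a x)) r) ->
  psi (\det a) != 0 -> exists2 o, o \is a GRing.unit & psi (\det a) = o * pi ^+ w.
Proof.
move=> freg fE det0; have z0 := zeroid_ideal R; have [c cE yE] := regular_parameter.
have ax i : phi (lin a x i) = 0 by apply/fE/gen_in => //; apply: fl_mem.
have Ad := det_ann ax.
have /etaE[o oE] : psi (\det a) \in aug_eta piA by apply/aug_etaP; exists (phi (\det a)).
exists o => //; apply: mI_nunit; rewrite mpi => -[o' /eqP]; rewrite subr_eq0 => /eqP oE'.
have /aug_etaP[b Ab bE] : pi ^+ w \in aug_eta piA by apply/etaE; exists 1; rewrite mul1r.
have [s sE] : exists s, piA s = o'.
  by have [s /eqP] := aug_surj piA o'; exists s.
have dE : phi (\det a) = s * phi t * b.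
  apply/eqP; rewrite -subr_eq0; apply/eqP.
  apply: (@ann_aug_inj _ _ piA pi y w) => //.
  - by exists (psi (c ord0)).
  - by apply/etaE; exists 1; rewrite mul1r.
  - by apply: ann_augB => //; apply: ann_augM.
  - rewrite rmorphB !rmorphM sE bE -[piA (phi t)]/(psi t) tpi.
    by rewrite -[piA (phi _)]/(psi _) oE oE' subrr.
have memM : exists z, phi (\det (border c a)) = y * z.
  exists (s * b); rewrite det_border rmorphM dE [RHS]mulrCA [y * b]mulrC.
  rewrite (@ann_aug_eq _ _ piA b y (phi (c ord0) * phi t)) //; first by ring.
  by rewrite yE rmorphM -tpi.
pose y' := \sum_j c j * cons_fun t x j.
have my' : mI y' by apply: ideal_sum => // j _; apply: idealM => //; apply: mx_params.
have yfreg : reg zeroid (y' :: fl (lin a x)).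
  apply: reg_unrot => //.
    apply: fl_memP => i; apply: lin_ideal => // j; have := mx_params (lift ord0 j).
    by rewrite cons_funS.
  rewrite -cats1 reg_cat; split=> //; split=> // r /fE; rewrite rmorphM cE => /nzy ?.
  exact/fE.
have [] := wiebe nR lR (N := n.+1) (J := zeroid) (x := cons_fun t x)
  (f := cons_fun y' (lin a x)) (M := border c a).
- exact: z0.
- by move=> _ ->; apply: ideal0.
- exact: mx_params.
- by rewrite mE fl_cons.
- by move=> i; rewrite lin_border subrr.
- by rewrite fl_cons.
case; case: memM => z zE; rewrite fl_cons.
have -> : gen zeroid (y' :: fl (lin a x)) = gen zeroid (rcons (fl (lin a x)) y').
  by apply: gen_perm => // e; rewrite mem_rcons.
rewrite gen_rcons; have [r rE] := phi_surj z; exists r; apply/fE.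
by rewrite rmorphB rmorphM cE rE zE mulrC subrr.
Qed.

End Numerical.

(** If only the empty sequence were regular, the supremum would be 0 and not infinite. So there is a
    nonempty regular sequence in every case, and its first member serves. *)
Lemma depth_nonzerodivisor (A : comUnitRingType) : leq_ext 1 (depth A) ->
  exists2 y : A, y \isn't a GRing.unit & forall q, y * q = 0 -> q = 0.
Proof.
move=> dA.
have [[|a s] [//= _ sm /regular_sequenceP[[nza _] _]]] : exists s : seq A,
    [/\ (0 < size s)%N, {subset s <= max_ideal A} & regular_sequence s].
  move: dA; case E : (depth A) => [k|] /=.
    by case/nat_sup_Some: E => -[s [<- sm sreg]] _ k1; exists s.
  move=> _; apply: contrapT => nex.
  suff : depth A = Some 0%N by rewrite E.
  apply/nat_sup_Some; split.
    exists [::]; split=> //; apply/regular_sequenceP; split=> //.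
    by apply/eqP; apply: oner_neq0.
  move=> m [s [sz sm sreg]]; rewrite leqNgt; apply/negP => m0.
  by apply: nex; exists s; rewrite sz.
by exists a => //; have := sm a (mem_head _ _); rewrite inE.
Qed.

(** Ranks over the fraction field. *)
Lemma mulmx_det_leq (O : idomainType) n m (D : 'M[O]_(n, m)) (B : 'M[O]_(m, n)) :
  \det (D *m B) != 0 -> (n <= m)%N.
Proof.
pose F p q (M : 'M[O]_(p, q)) := map_mx (@FracField.tofrac O) M.
move=> d0; have /mxrank_unit : F _ _ (D *m B) \in unitmx.
  by rewrite unitmxE det_map_mx unitfE tofrac_eq0.
by rewrite /F map_mxM => {1}<-; apply: mulmx_max_rank.
Qed.

Lemma dvr_uniformizer (O : idomainType) : discrete_valuation_ring O ->
  complete_noetherian_local O -> exists pi, [/\ @mI O = adj zeroid pi, pi != 0 &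
    forall x : O, (forall n, pw (@mI O) n x) -> x = 0].
Proof.
move=> [_ pid [u [u0 nu]]] /cnlP[lO nO [sepO _]].
have [pi piE] := pid _ (is_ideal_ofI lO).
have mpi : @mI O = adj zeroid pi.
  by apply: predeq => x; rewrite -[X in X <-> _](ofIE (@mI O)) piE; apply: ideal_spanP.
exists pi; split=> //; apply: contraNneq u0 => pi0.
have : mI u by [].
by rewrite mpi => -[r]; rewrite pi0 mulr0 subr0 => ->.
Qed.

Lemma power_dvd_leq (O : idomainType) (pi : O) v w : @mI O = adj zeroid pi -> pi != 0 ->
  (exists b, pi ^+ v = b * pi ^+ w) -> (w <= v)%N.
Proof.
move=> mpi pi0 [b bE]; rewrite leqNgt; apply/negP => vw.
apply: (pi_strict mpi pi0 (v := v)); exists (b * pi ^+ (w - v.+1)).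
by rewrite -mulrA -exprD subnK.
Qed.

Section Lengths.
Variables (R A : comUnitRingType) (O : idomainType) (piA : augmentation A O).
Variables (phi : {rmorphism R -> A}) (pi : O).
Hypothesis phi_surj : forall a, exists r, phi r = a.
Hypotheses (mpi : @mI O = adj zeroid pi) (pi0 : pi != 0).
Hypothesis sepO : forall x : O, (forall n, pw (@mI O) n x) -> x = 0.
Let psi : {rmorphism R -> O} := piA \o phi.
Variables (n : nat) (x : 'I_n -> R).
Hypothesis kerx : forall r, psi r = 0 <-> gen zeroid (fl x) r.
Hypothesis finPhi : finite_length (cotangent piA).

Lemma augmentation_lengths : exists (a : 'M[R]_n) v w,
  [/\ (forall i, phi (lin a x i) = 0) /\ psi (\det a) = pi ^+ v,
    mod_length (cotangent piA) = Some v, mod_length (quot_mod (aug_eta piA)) = Some w,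
    forall o, o \in aug_eta piA <-> exists b, o = b * pi ^+ w &
    forall c : 'M[R]_n, (forall i, phi (lin c x i) = 0) ->
      exists b, psi (\det c) = b * psi (\det a)].
Proof.
have [T [v [Txi detT lenv Trel]]] := length_presentation mpi pi0 sepO
  (cot_gen_span phi_surj kerx) finPhi.
have /choice[d dP] : forall i, exists d : 'I_n -> R,
    (forall j, psi (d j) = T i j) /\ phi (\sum_j d j * x j) = 0.
  by move=> i; apply/(cot_gen_relation phi_surj kerx).
pose a := \matrix_(i, j) d i j; have aT : map_mx psi a = T.
  by apply/matrixP => i j; rewrite !mxE; case: (dP i) => ->.
have ax i : phi (lin a x i) = 0.
  case: (dP i) => _ <-; congr (phi _); apply: eq_bigr => j _; by rewrite mxE.
have deta : psi (\det a) = pi ^+ v by rewrite -det_map_mx aT.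
have pv0 : pi ^+ v != 0 by rewrite expf_eq0 (negPf pi0) andbF.
have [|||w [etaw wmin]] := dvr_min_power mpi sepO (P := fun o => o \in aug_eta piA).
- exact: rpred0.
- by move=> b o; apply: (rpredZ (s := aug_eta piA)).
- exists (pi ^+ v) => //; apply/aug_etaP; exists (phi (\det a)) => //.
  exact: (det_ann phi_surj kerx).
have etaE o : o \in aug_eta piA <-> exists b, o = b * pi ^+ w.
  split=> [/wmin //|[b ->]]; exact: (rpredZ (s := aug_eta piA)).
exists a, v, w; split=> // [|c cx]; first exact: (length_cyclic mpi pi0).
have /choice[b bP] : forall i, exists b : 'I_n -> O,
    forall j, psi (c i j) = \sum_k b k * T k j.
  move=> i; apply: (Trel (fun j => psi (c i j))).
  by apply/(cot_gen_relation phi_surj kerx); exists (c i); split=> //; apply: cx.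
exists (\det (\matrix_(i, k) b i k)); rewrite -!det_map_mx aT -det_mulmx; congr (\det _).
by apply/matrixP => i j; rewrite !mxE bP; apply: eq_bigr => k _; rewrite mxE.
Qed.

End Lengths.

(** * The number of relations of a complete intersection *)

Section Relations.
Variables (R A : comUnitRingType) (O : idomainType) (piA : augmentation A O).
Variables (phi : {rmorphism R -> A}).
Hypotheses (nR : noeth R) (lR : ideal (@mI R)).
Let psi : {rmorphism R -> O} := piA \o phi.
Variables (n : nat) (x : 'I_n -> R) (t : R).
Hypothesis kerx : forall r, psi r = 0 <-> gen zeroid (fl x) r.
Hypotheses (mE : @mI R = gen zeroid (t :: fl x)) (txreg : reg zeroid (t :: fl x)).
Variables (c : nat) (f : 'I_c -> R).
Hypotheses (freg : reg zeroid (fl f)) (fE : forall r, phi r = 0 <-> gen zeroid (fl f) r).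

Let mtx b : b \in t :: fl x -> mI b.
Proof. by rewrite mE; apply/gen_in/zeroid_ideal. Qed.

Lemma kernel_lin : exists B : 'M[R]_(c, n), f = lin B x.
Proof.
have /choice[b bE] : forall i, exists b : 'I_n -> R, f i = \sum_j b j * x j.
  move=> i; apply/gen0_lin/kerx; rewrite /psi /= (iffRL (fE (f i))) ?rmorph0 //.
  by apply: gen_in; [apply: zeroid_ideal|apply: fl_mem].
exists (\matrix_(i, j) b i j); apply: funext => i; rewrite bE.
by apply: eq_bigr => j _; rewrite mxE.
Qed.

(** With D expressing the forms of a by the f_k, the rows of a and of D B differ by syzygies of the
    regular sequence x; their entries vanish in O. *)
Lemma relations_factor (a : 'M[R]_n) (B : 'M[R]_(c, n)) : f = lin B x ->
  (forall i, phi (lin a x i) = 0) -> exists D : 'M[R]_(n, c),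
  map_mx psi a = map_mx psi (D *m B).
Proof.
move=> fB ax; have z0 := zeroid_ideal R.
have /choice[d dE] : forall i, exists d : 'I_c -> R, lin a x i = \sum_k d k * f k.
  by move=> i; apply/gen0_lin/fE.
exists (\matrix_(i, k) d i k); apply/matrixP => i j; rewrite [LHS]mxE [RHS]mxE.
apply/eqP; rewrite -subr_eq0 -rmorphB; apply/eqP/kerx.
apply: (regular_syzygy nR lR (r := fun j => a i j - (\matrix_(i, k) d i k *m B) i j)).
- by move=> k; apply: mtx; rewrite inE fl_mem orbT.
- have : reg zeroid (rcons (fl x) t) by apply: reg_rot => //; apply: mtx; rewrite mem_head.
  by rewrite -cats1 reg_cat => -[].
under eq_bigr do rewrite mulrBl; rewrite sumrB.
rewrite -[X in X - _]/(lin a x i) -[X in _ - X]/(lin _ x i) lin_mul -fB dE.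
by apply/eqP; rewrite subr_eq0; apply/eqP/eq_bigr => k _; rewrite mxE.
Qed.

(** Over O the matrix a factors through c rows, and its determinant is not 0. *)
Lemma relations_rank (a : 'M[R]_n) : (forall i, phi (lin a x i) = 0) ->
  psi (\det a) != 0 -> (n <= c)%N.
Proof.
move=> ax; have [B fB] := kernel_lin; have [D aE] := relations_factor fB ax.
by rewrite -det_map_mx aE map_mxM; apply: mulmx_det_leq.
Qed.

(** Together with a lift of y, f is a regular sequence of length c + 1 in a ring whose maximal ideal
    has n + 1 generators. *)
Lemma relations_height (y : A) : (forall a, exists r, phi r = a) ->
  y \isn't a GRing.unit -> (forall q, y * q = 0 -> q = 0) -> (c <= n)%N.
Proof.
move=> phi_surj ny nzy; have z0 := zeroid_ideal R; have [r rE] := phi_surj y.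
have mr : mI r by apply: contra ny => Ur; rewrite -rE; apply: rmorph_unit.
have fyreg : reg zeroid (rcons (fl f) r).
  rewrite -cats1 reg_cat; split=> //; split=> // z /fE; rewrite rmorphM rE => /nzy z1.
  exact/fE.
have [|Q [chQ Q0 _]] := regular_chain nR z0 fyreg (mI_prime lR).
  apply: gen_min => // [b ->|b]; first exact: ideal0.
  rewrite mem_rcons inE => /orP[/eqP -> //|]; apply: fl_memP => i.
  apply: contraT => /negPn Uf; have : phi (f i) = 0.
    by apply/fE/gen_in => //; apply: fl_mem.
  by move: (rmorph_unit phi Uf) => + fi0; rewrite fi0 unitr0.
have := height_bound nR lR (s := t :: fl x) z0 _ mtx chQ Q0.
by rewrite size_rcons !size_fl /= size_fl ltnS; apply=> z; rewrite mE.
Qed.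

End Relations.

(** * The numerical criterion for complete intersections *)

Theorem propositionA1 (O : idomainType) (A : comUnitRingType)
    (piA : augmentation A O)
    (dvrO : discrete_valuation_ring O)
    (completeO : complete_noetherian_local O)
    (completeA : complete_noetherian_local A)
    (finPhi : finite_length (cotangent piA))
    (depthA : leq_ext 1 (depth A)) :
  complete_intersection A <->
  mod_length (cotangent piA) = mod_length (quot_mod (aug_eta piA)).
Proof.
have [pi [mpi pi0 sepO]] := dvr_uniformizer dvrO completeO.
have [y ny nzy] := depth_nonzerodivisor depthA.
have pw0 k : pi ^+ k != 0 by rewrite expf_eq0 (negPf pi0) andbF.
split=> [[R [phi [s' [cR regR phi_surj /regular_sequenceP[sreg _] sE]]]]|].
  have [s [lR nR mE regs]] := regular_local_reg regR.
  have [n [x [t [sn tpi kerx mE' txreg]]]] :=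
    coordinates (psi := piA \o phi) nR lR (psi_surj piA phi_surj) mpi pi0 mE regs.
  have [a [v [w [[ax deta] lenv lenw etaE adet]]]] :=
    augmentation_lengths phi_surj mpi pi0 sepO kerx finPhi.
  have [c [f flE]] : exists c (f : 'I_c -> R), fl f = s'.
    by exists (size s'), (fun i => s'`_i); apply: fl_nth.
  have fE r : phi r = 0 <-> gen zeroid (fl f) r by rewrite sE flE; apply: ideal_spanP.
  have freg : reg zeroid (fl f) by rewrite flE.
  have detaE : piA (phi (\det a)) = pi ^+ v := deta.
  have deta0 : piA (phi (\det a)) != 0 by rewrite detaE.
  have cn : c = n.
    apply/eqP; rewrite eqn_leq (relations_height nR lR mE' freg fE phi_surj ny nzy).
    exact: (relations_rank nR lR kerx mE' txreg fE ax).
  subst c; have [B fB] := kernel_lin kerx fE.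
  have [D aE] := relations_factor nR lR kerx mE' txreg fE fB ax.
  (* The matrix B consists of relations, so det a divides det B in O; the factorization through D
     gives the converse divisibility. This transfers [det_unit_multiple] from B to a. *)
  have [b bE] : exists b, piA (phi (\det B)) = b * pi ^+ v.
    by rewrite -detaE; apply: adet => i; rewrite -fB; apply/fE/gen_in;
      [apply: zeroid_ideal|apply: fl_mem].
  have detD : pi ^+ v = piA (phi (\det D)) * piA (phi (\det B)).
    by rewrite -detaE -!rmorphM -det_mulmx; have := congr1 determinant aE; rewrite !det_map_mx.
  have detB0 : piA (phi (\det B)) != 0.
    by apply: contraNneq (pw0 v) => B0; rewrite detD B0 mulr0.
  have [|||o Uo] := det_unit_multiple nR lR phi_surj mpi tpi kerx mE' ny nzy etaE (a := B).
  - by rewrite -fB.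
  - by rewrite -fB.
  - exact: detB0.
  rewrite -[LHS]/(piA (phi (\det B))) => oE.
  rewrite lenv lenw; congr Some; apply/eqP; rewrite eqn_leq.
  apply/andP; split; apply: (power_dvd_leq mpi pi0).
    by exists (o^-1 * b); rewrite -mulrA -bE oE mulKr.
  by exists (piA (phi (\det D)) * o); rewrite detD -mulrA oE.
move=> lenE; have [R [phi [cR regR phi_surj]]] := cohen_structure (iffLR (cnlP A) completeA).
have [s [lR nR mE regs]] := regular_local_reg regR.
have [n [x [t [sn tpi kerx mE' txreg]]]] :=
  coordinates (psi := piA \o phi) nR lR (psi_surj piA phi_surj) mpi pi0 mE regs.
have [a [v [w [[ax deta] lenv lenw etaE _]]]] :=
  augmentation_lengths phi_surj mpi pi0 sepO kerx finPhi.
have vw : v = w by move: lenE; rewrite lenv lenw => -[].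
rewrite vw in deta.
have [freg fE] := regular_relations nR lR phi_surj mpi pi0 tpi kerx mE' txreg ny nzy etaE ax deta.
exists R, phi, (fl (lin a x)); split=> //; first exact/cnlP.
  apply/regular_sequenceP; split=> //; rewrite -fE rmorph1.
  by apply/eqP; apply: oner_neq0.
by move=> r; rewrite fE; split=> /ideal_spanP.
Qed.
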